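(* Let $v$ be a convex function on $B_1\subset\mathbb{R}^n$. Let $\Sigma_v$ be the set of points $x\in B_1$ such that for every subgradient $p$ of $v$ at $x$ there exist $C_{x,p}>0$ and $h_0>0$ with $$|S^v_{h,p}(x)|<C_{x,p}\,h^{\frac{n+1}{2}}\quad\text{for all }0<h<h_0.$$ Then $\mathcal{H}^{n-1}(\Sigma_v)=0$.
   Context: $p$ is a subgradient of $v$ at $x$ if $v(y)\ge v(x)+p\cdot(y-x)$ for all $y\in B_1$. The section is $S^v_{h,p}(x)=\{y\in B_1: v(y)<v(x)+p\cdot(y-x)+h\}$, and $|\cdot|$ denotes Lebesgue measure. *)

(* Defs.v *)
(* classical reals.  Points of R^n are represented as
   functions x : nat -> R whose coordinates of index >= n vanish
   (this condition is built into the ball B_1 below). *)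
From Stdlib Require Import Reals.
Open Scope R_scope.

Definition pt := nat -> R.

Fixpoint sumR (n : nat) (f : nat -> R) : R :=
  match n with O => 0 | S k => sumR k f + f k end.

Fixpoint prodR (n : nat) (f : nat -> R) : R :=
  match n with O => 1 | S k => prodR k f * f k end.

Definition dot (n : nat) (x y : pt) : R := sumR n (fun i => x i * y i).
Definition dist (n : nat) (x y : pt) : R :=
  sqrt (sumR n (fun i => (x i - y i) ^ 2)).

Definition vsub (x y : pt) : pt := fun i => x i - y i.
Definition comb (t : R) (x y : pt) : pt := fun i => t * x i + (1 - t) * y i.

Definition B1 (n : nat) (x : pt) : Prop :=
  sumR n (fun i => x i ^ 2) < 1 /\ (forall i, (n <= i)%nat -> x i = 0).

Definition convex_on_B1 (n : nat) (v : pt -> R) : Prop :=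
  forall x y t, B1 n x -> B1 n y -> 0 <= t <= 1 ->
    v (comb t x y) <= t * v x + (1 - t) * v y.

Definition subgradient (n : nat) (v : pt -> R) (x p : pt) : Prop :=
  (forall i, (n <= i)%nat -> p i = 0) /\
  forall y, B1 n y -> v y >= v x + dot n p (vsub y x).

Definition section (n : nat) (v : pt -> R) (h : R) (p x : pt) : pt -> Prop :=
  fun y => B1 n y /\ v y < v x + dot n p (vsub y x) + h.

(* Lebesgue (outer) measure of S is < c : S is covered by countably many
   closed boxes [a k, b k] whose total volume is < c. *)
Definition in_box (n : nat) (a b : pt) (y : pt) : Prop :=
  forall i, (i < n)%nat -> a i <= y i <= b i.

Definition leb_measure_lt (n : nat) (S : pt -> Prop) (c : R) : Prop :=
  exists (a b : nat -> pt) (l : R),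
    (forall k i, a k i <= b k i) /\
    infinite_sum (fun k => prodR n (fun i => b k i - a k i)) l /\ l < c /\
    (forall y, S y -> exists k, in_box n (a k) (b k) y).

(* H^s(E) = 0 : for all delta, eps > 0, E is covered by countably many sets
   U k of diameter <= d k < delta with sum over the nonempty U k of
   (d k)^s < eps  (i.e. H^s_delta(E) = 0 for every delta). *)
Definition hausdorff_null (n s : nat) (E : pt -> Prop) : Prop :=
  forall delta eps, 0 < delta -> 0 < eps ->
    exists (U : nat -> pt -> Prop) (d e : nat -> R) (l : R),
      (forall k, 0 <= d k < delta) /\
      (forall k y z, U k y -> U k z -> dist n y z <= d k) /\
      (forall k, (exists y, U k y) -> e k = d k ^ s) /\
      (forall k, e k = 0 \/ e k = d k ^ s) /\
      infinite_sum e l /\ l < eps /\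
      (forall y, E y -> exists k, U k y).

Definition Sigma (n : nat) (v : pt -> R) : pt -> Prop :=
  fun x => B1 n x /\
    forall p, subgradient n v x p ->
      exists C h0, 0 < C /\ 0 < h0 /\
        forall h, 0 < h < h0 ->
          leb_measure_lt n (section n v h p x)
            (C * Rpower h (INR (n + 1) / 2)).

(* Main.v *)
(* Replacing [v] by [v + |.|^2/2] confines a section of height [h = r^2] at [x] to a ball of radius
   [r]. Call the resulting convex set [F].

   Polarity: the slopes [q] whose supporting plane touches near [F] fill a set of volume at least
   [c h^n / |F| >= c r^(n-1) / C], and these sets are pairwise disjoint for disjoint [F]'s. So
   [sum r_i^(n-1)] is bounded along disjoint families.

   Gain: choose [p] to be an extreme point of the subdifferential at [x]. Then [F] contains a cube
   of side [M h] with [M] as large as we please when [h] is small, so that [F] is covered by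
   [C |F| / (M h)^n] cubes of side [M h], of total [(n-1)]-content at most [(C / M) r^(n-1)].

   A Vitali selection of disjoint [F]'s covers all of the set up to a tail of small content (only
   closedness of [F] and [F] being inside the ball of radius [r] are used there), and the
   content of the selected sets is at most [C / M] times a fixed bound.

   Volumes are compared by counting lattice points in boxes sheared by unitriangular maps. *)
From Stdlib Require Import Reals ZArith Lra Lia List FinFun Cantor Classical ClassicalEpsilon
  FunctionalExtensionality.
From Coquelicot Require Import Compactness.
Require Import Defs.
Open Scope R_scope.


(** With [h = r^2] and [|F| <= C r^(n+1)] both estimates land on the same power of [r]: [h^n / |F|]
    is at least [r^(n-1) / C], and [|F| / (M h)] is at most [(C / M) r^(n-1)]. Polarity alone
    therefore gives only finite content. Smallness has to come from [M], and the packing bound must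
    not depend on [M].

    An arbitrary subgradient offers no such [M]. For [v(y) = |y_1| + |y|^2/2] the slope [p = x] is a
    subgradient at each [x] with [x_1 = 0]; its sections have measure of order [h^((n+1)/2)], yet
    these points are not null for the (n-1)-measure. The cap there has width of order [h] only.
    Extremality of [p] excludes this.

    Caps can be arbitrarily eccentric, so no doubling property is at hand; cubes replace caps only
    in the tail, where the packing bound already makes them cheap. The set is cut into countably
    many classes with uniform [C] and uniformly bounded slopes, while the threshold for [h] stays
    pointwise.

    Measure is available only as the cost of a box cover, so every volume inequality compares
    explicit boxes, at the price of a dimensional constant. *)

(** * Finite sums and products *)

Lemma Rabs_le_bounds x d : Rabs x <= d -> - d <= x <= d.
Proof. unfold Rabs. destruct (Rcase_abs x); lra. Qed.

Lemma sumR_ext n f g : (forall i, (i < n)%nat -> f i = g i) -> sumR n f = sumR n g.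
Proof. induction n as [|n IH]; simpl; intros H; auto. rewrite IH, H; auto. Qed.

Lemma sumR_plus n f g : sumR n (fun i => f i + g i) = sumR n f + sumR n g.
Proof. induction n as [|n IH]; simpl; [|rewrite IH]; lra. Qed.

Lemma sumR_scal n c f : sumR n (fun i => c * f i) = c * sumR n f.
Proof. induction n as [|n IH]; simpl; [|rewrite IH]; lra. Qed.

Lemma sumR_const n c : sumR n (fun _ => c) = INR n * c.
Proof. induction n as [|n IH]; [simpl; lra|]. rewrite S_INR. simpl sumR. rewrite IH; lra. Qed.

Lemma sumR_le n f g : (forall i, (i < n)%nat -> f i <= g i) -> sumR n f <= sumR n g.
Proof.
  induction n as [|n IH]; simpl; intros H; [lra|].
  apply Rplus_le_compat; auto.
Qed.

Lemma sumR_nonneg n f : (forall i, (i < n)%nat -> 0 <= f i) -> 0 <= sumR n f.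
Proof.
  intros H. replace 0 with (sumR n (fun _ => 0)) by (rewrite sumR_const; lra).
  now apply sumR_le.
Qed.

Lemma sumR_zero n f : (forall i, (i < n)%nat -> f i = 0) -> sumR n f = 0.
Proof.
  intros H. rewrite (sumR_ext n f (fun _ => 0)) by auto. rewrite sumR_const; lra.
Qed.

Lemma sumR_swap m n (f : nat -> nat -> R) :
  sumR m (fun i => sumR n (f i)) = sumR n (fun j => sumR m (fun i => f i j)).
Proof.
  induction m as [|m IH]; simpl.
  - symmetry; now apply sumR_zero.
  - now rewrite IH, <- sumR_plus.
Qed.

Lemma sumR_Rabs n f : Rabs (sumR n f) <= sumR n (fun i => Rabs (f i)).
Proof.
  induction n as [|n IH]; simpl; [rewrite Rabs_R0; lra|].
  eapply Rle_trans; [apply Rabs_triang|lra].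
Qed.

Lemma sumR_single n k f :
  (k < n)%nat -> (forall i, (i < n)%nat -> i <> k -> f i = 0) -> sumR n f = f k.
Proof.
  induction n as [|n IH]; intros Hk H; [lia|]. simpl.
  destruct (Nat.eq_dec k n) as [->|Hkn].
  - rewrite sumR_zero; [lra|]. intros i Hi; apply H; lia.
  - rewrite IH, (H n); [lra|lia|lia|lia|]. intros i Hi Hne; apply H; lia.
Qed.

Lemma sumR_term_le n k f :
  (forall i, (i < n)%nat -> 0 <= f i) -> (k < n)%nat -> f k <= sumR n f.
Proof.
  induction n as [|n IH]; intros H Hk; [lia|]. simpl.
  destruct (Nat.eq_dec k n) as [->|Hkn].
  - assert (0 <= sumR n f) by (apply sumR_nonneg; auto). lra.
  - assert (f k <= sumR n f) by (apply IH; [auto|lia]). assert (0 <= f n) by auto. lra.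
Qed.

Lemma sumR_mono m n f :
  (forall i, 0 <= f i) -> (m <= n)%nat -> sumR m f <= sumR n f.
Proof.
  intros H Hmn. induction Hmn as [|n Hmn IH]; [lra|]. simpl. specialize (H n). lra.
Qed.

Lemma sumR_split m n f :
  sumR (m + n) f = sumR m f + sumR n (fun i => f (m + i)%nat).
Proof.
  induction n as [|n IH]; [rewrite Nat.add_0_r; simpl; lra|].
  rewrite Nat.add_succ_r; simpl. rewrite IH; lra.
Qed.

Lemma prodR_ext n f g : (forall i, (i < n)%nat -> f i = g i) -> prodR n f = prodR n g.
Proof. induction n as [|n IH]; simpl; intros H; auto. rewrite IH, H; auto. Qed.

Lemma prodR_mult n f g : prodR n (fun i => f i * g i) = prodR n f * prodR n g.
Proof. induction n as [|n IH]; simpl; [|rewrite IH]; lra. Qed.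

Lemma prodR_const n c : prodR n (fun _ => c) = c ^ n.
Proof. induction n as [|n IH]; simpl; [|rewrite IH]; lra. Qed.

Lemma prodR_scal n c f : prodR n (fun i => c * f i) = c ^ n * prodR n f.
Proof. now rewrite prodR_mult, prodR_const. Qed.

Lemma prodR_pos n f : (forall i, (i < n)%nat -> 0 < f i) -> 0 < prodR n f.
Proof.
  induction n as [|n IH]; simpl; intros H; [lra|].
  apply Rmult_lt_0_compat; auto.
Qed.

Lemma prodR_nonneg n f : (forall i, (i < n)%nat -> 0 <= f i) -> 0 <= prodR n f.
Proof.
  induction n as [|n IH]; simpl; intros H; [lra|].
  apply Rmult_le_pos; auto.
Qed.

Lemma prodR_rev n f : prodR n (fun i => f (n - 1 - i)%nat) = prodR n f.
Proof.
  assert (Hl : forall m g, prodR (S m) g = g O * prodR m (fun i => g (S i))).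
  { induction m as [|m IH]; intros g; [simpl; lra|].
    change (prodR (S (S m)) g) with (prodR (S m) g * g (S m)).
    rewrite IH. simpl. lra. }
  induction n as [|n IH]; [reflexivity|].
  rewrite Hl.
  replace (S n - 1 - 0)%nat with n by lia.
  rewrite (prodR_ext n _ (fun i => f (n - 1 - i)%nat)).
  - rewrite IH. simpl. lra.
  - intros i Hi. f_equal. lia.
Qed.

(** * Counting lattice points *)

Lemma grid_interval (eps l : R) :
  0 < eps -> 0 <= l -> forall a, exists L : list R,
    NoDup L /\
    (forall c, In c L <-> (exists k : Z, c = eps * IZR k) /\ a <= c <= a + l) /\
    l / eps - 1 <= INR (length L) <= l / eps + 1.
Proof.
  intros He Hl a.
  (* [up r] is the integer in [(r, r + 1]], so [k0] is the ceiling of [a / eps] and [k1] the floor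
     of [(a + l) / eps]. *)
  set (k0 := (1 - up (- (a / eps)))%Z). set (k1 := (up ((a + l) / eps) - 1)%Z).
  destruct (archimed (- (a / eps))) as [A1 A2].
  destruct (archimed ((a + l) / eps)) as [B1 B2].
  assert (K0 : a / eps <= IZR k0 < a / eps + 1) by (unfold k0; rewrite minus_IZR; lra).
  assert (K1 : (a + l) / eps - 1 < IZR k1 <= (a + l) / eps)
    by (unfold k1; rewrite minus_IZR; lra).
  assert (Hdiv : (a + l) / eps = a / eps + l / eps) by (field; lra).
  assert (Hle : 0 <= l / eps) by (apply Rmult_le_pos; [lra|left; now apply Rinv_0_lt_compat]).
  set (m := (k1 - k0 + 1)%Z).
  assert (Hm : l / eps - 1 < IZR m <= l / eps + 1)
    by (unfold m; rewrite plus_IZR, minus_IZR; lra).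
  assert (Hm0 : (0 <= m)%Z).
  { assert ((-1 < m)%Z) by (apply lt_IZR; lra). lia. }
  exists (map (fun i => eps * IZR (k0 + Z.of_nat i)) (seq 0 (Z.to_nat m))).
  split; [|split].
  - apply Injective_map_NoDup; [|apply seq_NoDup].
    intros i j Hij. apply Rmult_eq_reg_l in Hij; [|lra]. apply eq_IZR in Hij. lia.
  - intros c. rewrite in_map_iff. split.
    + intros [i [<- Hi]]. apply in_seq in Hi. split; [now eexists|].
      assert (Hi' : (k0 <= k0 + Z.of_nat i <= k1)%Z) by lia.
      destruct Hi' as [H1 H2]. apply IZR_le in H1, H2.
      assert (E1 : a = eps * (a / eps)) by (field; lra).
      assert (E2 : a + l = eps * ((a + l) / eps)) by (field; lra).
      split; [rewrite E1|rewrite E2]; apply Rmult_le_compat_l; lra.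
    + intros [[k ->] Hc].
      assert (E1 : a / eps <= IZR k).
      { apply Rmult_le_reg_l with eps; [lra|]. replace (eps * (a / eps)) with a by (field; lra). lra. }
      assert (E2 : IZR k <= (a + l) / eps).
      { apply Rmult_le_reg_l with eps; [lra|].
        replace (eps * ((a + l) / eps)) with (a + l) by (field; lra). lra. }
      assert ((k0 - 1 < k)%Z) by (apply lt_IZR; rewrite minus_IZR; lra).
      assert ((k < k1 + 1)%Z) by (apply lt_IZR; rewrite plus_IZR; lra).
      exists (Z.to_nat (k - k0)). split.
      * do 2 f_equal. lia.
      * apply in_seq. lia.
  - rewrite length_map, length_seq, INR_IZR_INZ, Z2Nat.id by lia. lra.
Qed.

Lemma length_flat_map_bounds (A B : Type) (f : A -> list B) (L : list A) (lo hi : R) :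
  (forall z, In z L -> lo <= INR (length (f z)) <= hi) ->
  lo * INR (length L) <= INR (length (flat_map f L)) <= hi * INR (length L).
Proof.
  induction L as [|z L IH]; intros H.
  - simpl; lra.
  - change (flat_map f (z :: L)) with (f z ++ flat_map f L).
    change (length (z :: L)) with (S (length L)).
    rewrite length_app, plus_INR, S_INR.
    specialize (IH (fun w Hw => H w (or_intror Hw))).
    specialize (H z (or_introl eq_refl)). lra.
Qed.

Lemma NoDup_flat_map_disjoint (A B : Type) (f : A -> list B) (L : list A) :
  NoDup L -> (forall z, In z L -> NoDup (f z)) ->
  (forall z z' b, In z L -> In z' L -> In b (f z) -> In b (f z') -> z = z') ->
  NoDup (flat_map f L).
Proof.
  induction 1 as [|z L Hz HL IH]; intros H1 H2; simpl; [constructor|].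
  apply NoDup_app.
  - apply H1; now left.
  - apply IH; [intros; apply H1; now right|].
    intros u u' b Hu Hu'; apply H2; now right.
  - intros b Hb Hb'. apply in_flat_map in Hb' as [z' [Hz' Hb']].
    rewrite (H2 z z' b) in Hz; auto; [now left|now right].
Qed.

Definition upd (z : pt) (k : nat) (c : R) : pt := fun i => if Nat.eq_dec i k then c else z i.

(* [al k z] is meant to depend on the coordinates of [z] of index [< k] only; the box is then
   the image of an axis-parallel one under successive shears, so its volume is [prodR n l]. *)
Definition tri_box (n : nat) (al : nat -> pt -> R) (l : nat -> R) (z : pt) : Prop :=
  forall i, (i < n)%nat -> al i z <= z i <= al i z + l i.

Definition triangular (al : nat -> pt -> R) : Prop :=
  forall k z z', (forall j, (j < k)%nat -> z j = z' j) -> al k z = al k z'.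

(** Once the coordinates below [k] are fixed, the [k]-th one runs through an interval of length
    [l k]; its position moves with the shear, but its lattice count is [l k / eps] up to 1. As
    [l k / eps >= 2], this error costs at most a factor 2 either way. *)
Lemma tri_box_lattice (eps : R) (al : nat -> pt -> R) (l : nat -> R) (n : nat) :
  0 < eps -> triangular al -> (forall i, (i < n)%nat -> 2 * eps <= l i) ->
  exists L : list pt,
    NoDup L /\
    (forall z, In z L <->
       (forall i, (n <= i)%nat -> z i = 0) /\
       (forall i, (i < n)%nat -> exists m : Z, z i = eps * IZR m) /\
       tri_box n al l z) /\
    prodR n (fun i => l i / (2 * eps)) <= INR (length L) <= prodR n (fun i => 2 * l i / eps).
Proof.
  intros He Ht. induction n as [|n IH]; intros Hl.
  - exists (cons (fun _ => 0) nil). split; [|split].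
    + constructor; [easy|constructor].
    + intros z. split.
      * intros [<-|[]]. repeat split; intros; try lia; easy.
      * intros [H _]. left. apply functional_extensionality. intros i. symmetry; apply H; lia.
    + simpl; lra.
  - destruct IH as [L [ND [HL HB]]]; [intros; apply Hl; lia|].
    assert (Hln : 2 * eps <= l n) by (apply Hl; lia).
    assert (CH : exists I : R -> list R, forall a,
      NoDup (I a) /\
      (forall c, In c (I a) <-> (exists k : Z, c = eps * IZR k) /\ a <= c <= a + l n) /\
      l n / eps - 1 <= INR (length (I a)) <= l n / eps + 1).
    { exists (fun a => proj1_sig (constructive_indefinite_description _
        (grid_interval eps (l n) He ltac:(lra) a))).
      intros a. apply proj2_sig. }
    destruct CH as [I HI].
    exists (flat_map (fun z => map (upd z n) (I (al n z))) L).
    assert (Hup : forall z c, upd z n c n = c).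
    { intros z c. unfold upd. now destruct (Nat.eq_dec n n). }
    assert (Hup' : forall z c i, i <> n -> upd z n c i = z i).
    { intros z c i Hi. unfold upd. now destruct (Nat.eq_dec i n). }
    assert (Hal : forall z c k, (k <= n)%nat -> al k (upd z n c) = al k z).
    { intros z c k Hk. apply Ht. intros j Hj. apply Hup'. lia. }
    split; [|split].
    + apply NoDup_flat_map_disjoint; auto.
      * intros z Hz. apply Injective_map_NoDup; [|apply HI].
        intros c c' Hc. rewrite <- (Hup z c), Hc. apply Hup.
      * intros z z' b Hz Hz' Hb Hb'.
        apply in_map_iff in Hb as [c [<- Hc]]. apply in_map_iff in Hb' as [c' [Hcc' Hc']].
        apply HL in Hz as [Hz _]. apply HL in Hz' as [Hz' _].
        apply functional_extensionality. intros i.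
        destruct (Nat.eq_dec i n) as [->|Hi]; [rewrite Hz, Hz'; auto|].
        rewrite <- (Hup' z c i Hi), <- Hcc'. now apply Hup'.
    + intros z. rewrite in_flat_map. split.
      * intros [w [Hw Hz]]. apply in_map_iff in Hz as [c [<- Hc]].
        apply HL in Hw as [W1 [W2 W3]]. apply HI in Hc as [C1 C2].
        split; [|split].
        -- intros i Hi. rewrite Hup' by lia. apply W1. lia.
        -- intros i Hi. destruct (Nat.eq_dec i n) as [->|Hin].
           ++ now rewrite Hup.
           ++ rewrite Hup' by lia. apply W2. lia.
        -- intros i Hi. rewrite Hal by lia. destruct (Nat.eq_dec i n) as [->|Hin].
           ++ now rewrite Hup.
           ++ rewrite Hup' by lia. apply W3. lia.
      * intros [Z1 [Z2 Z3]]. exists (upd z n 0). split.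
        -- apply HL. split; [|split].
           ++ intros i Hi. destruct (Nat.eq_dec i n) as [->|Hin]; [apply Hup|].
              rewrite Hup' by lia. apply Z1. lia.
           ++ intros i Hi. rewrite Hup' by lia. apply Z2. lia.
           ++ intros i Hi. rewrite Hal, Hup' by lia. apply Z3. lia.
        -- apply in_map_iff. exists (z n). split.
           ++ apply functional_extensionality. intros i.
              destruct (Nat.eq_dec i n) as [->|Hin]; [apply Hup|]. now rewrite !Hup' by lia.
           ++ apply HI. rewrite Hal by lia. split; [apply Z2; lia|apply Z3; lia].
    + assert (H1 : 2 <= l n / eps).
      { apply Rmult_le_reg_r with eps; [lra|]. unfold Rdiv. rewrite Rmult_assoc, Rinv_l; lra. }
      assert (Hp : 0 <= prodR n (fun i => l i / (2 * eps))).
      { apply prodR_nonneg. intros i Hi. assert (2 * eps <= l i) by (apply Hl; lia).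
        apply Rmult_le_pos; [lra|left; apply Rinv_0_lt_compat; lra]. }
      simpl.
      replace (l n / (2 * eps)) with (l n / eps / 2) by (field; lra).
      replace (2 * l n / eps) with (2 * (l n / eps)) by (field; lra).
      destruct (length_flat_map_bounds _ _ (fun z => map (upd z n) (I (al n z))) L
                 (l n / eps / 2) (2 * (l n / eps))) as [G1 G2].
      { intros z _. rewrite length_map. destruct (HI (al n z)) as [_ [_ HH]]. lra. }
      split.
      * eapply Rle_trans; [|apply G1]. rewrite Rmult_comm. apply Rmult_le_compat_l; lra.
      * eapply Rle_trans; [apply G2|]. rewrite (Rmult_comm _ (2 * _)). apply Rmult_le_compat_l; lra.
Qed.

Definition vol (n : nat) (B : pt * pt) : R := prodR n (fun i => snd B i - fst B i).

Definition nondeg (n : nat) (B : pt * pt) : Prop :=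
  forall i, (i < n)%nat -> fst B i < snd B i.

Definition volsum (n : nat) (bs : list (pt * pt)) : R :=
  fold_right (fun B s => vol n B + s) 0 bs.

Lemma finite_min_pos (N : nat) (f : nat -> R) :
  (forall i, (i < N)%nat -> 0 < f i) ->
  exists e, 0 < e /\ forall i, (i < N)%nat -> e <= f i.
Proof.
  induction N as [|N IH]; intros H.
  - exists 1; split; [lra|intros; lia].
  - destruct IH as [e [He HE]]; [auto|].
    exists (Rmin e (f N)). split; [apply Rmin_pos; auto|].
    intros i Hi. destruct (Nat.eq_dec i N) as [->|Hn]; [apply Rmin_r|].
    eapply Rle_trans; [apply Rmin_l|apply HE; lia].
Qed.

Lemma list_min_pos (A : Type) (L : list A) (f : A -> R) :
  (forall a, In a L -> 0 < f a) -> exists e, 0 < e /\ forall a, In a L -> e <= f a.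
Proof.
  induction L as [|a L IH]; intros H.
  - exists 1; split; [lra|easy].
  - destruct IH as [e [He HE]]; [intros; apply H; now right|].
    exists (Rmin e (f a)). split; [apply Rmin_pos; auto; apply H; now left|].
    intros b [<-|Hb]; [apply Rmin_r|]. eapply Rle_trans; [apply Rmin_l|auto].
Qed.

(** Finite subadditivity of volume with a loss of [4^n]. At a mesh below half of every side, the
    lattice points of the disjoint sheared boxes inject into those of the covering boxes; the two
    counts are each off by at most [2^n], and the mesh cancels. *)
Lemma tri_box_volume (n N : nat) (al : nat -> nat -> pt -> R) (l : nat -> nat -> R)
    (bs : list (pt * pt)) :
  (forall i, (i < N)%nat -> triangular (al i)) ->
  (forall i k, (i < N)%nat -> (k < n)%nat -> 0 < l i k) ->
  (forall B, In B bs -> nondeg n B) ->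
  (forall i j z, (i < N)%nat -> (j < N)%nat -> i <> j ->
     tri_box n (al i) (l i) z -> tri_box n (al j) (l j) z -> False) ->
  (forall i z, (i < N)%nat -> tri_box n (al i) (l i) z ->
     exists B, In B bs /\ in_box n (fst B) (snd B) z) ->
  sumR N (fun i => prodR n (l i)) <= 4 ^ n * volsum n bs.
Proof.
  intros Ht Hl Hb Hd Hc.
  assert (E1 : exists e, 0 < e /\ forall i k, (i < N)%nat -> (k < n)%nat -> e <= l i k).
  { clear - Hl. induction N as [|N IH].
    - exists 1; split; [lra|intros; lia].
    - destruct IH as [e [He HE]]; [intros; apply Hl; lia|].
      destruct (finite_min_pos n (l N)) as [e' [He' HE']]; [intros; apply Hl; lia|].
      exists (Rmin e e'). split; [now apply Rmin_pos|].
      intros i k Hi Hk. destruct (Nat.eq_dec i N) as [->|HiN].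
      + eapply Rle_trans; [apply Rmin_r|auto].
      + eapply Rle_trans; [apply Rmin_l|apply HE; [lia|auto]]. }
  assert (E2 : exists e, 0 < e /\ forall B, In B bs -> forall k, (k < n)%nat -> e <= snd B k - fst B k).
  { clear - Hb. induction bs as [|B bs IH].
    - exists 1; split; [lra|easy].
    - destruct IH as [e [He HE]]; [intros; apply Hb; now right|].
      destruct (finite_min_pos n (fun k => snd B k - fst B k)) as [e' [He' HE']].
      { intros k Hk. specialize (Hb B (or_introl eq_refl) k Hk). lra. }
      exists (Rmin e e'). split; [now apply Rmin_pos|].
      intros C [<-|HC] k Hk.
      + eapply Rle_trans; [apply Rmin_r|auto].
      + eapply Rle_trans; [apply Rmin_l|auto]. }
  destruct E1 as [e1 [He1 HE1]]. destruct E2 as [e2 [He2 HE2]].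
  set (eps := Rmin e1 e2 / 2).
  assert (Hm : 0 < Rmin e1 e2) by now apply Rmin_pos.
  assert (Heps : 0 < eps) by (unfold eps; lra).
  assert (Hle1 : 2 * eps <= e1) by (unfold eps; generalize (Rmin_l e1 e2); lra).
  assert (Hle2 : 2 * eps <= e2) by (unfold eps; generalize (Rmin_r e1 e2); lra).
  assert (LA : exists La : nat -> list pt, forall i, (i < N)%nat ->
    NoDup (La i) /\
    (forall z, In z (La i) <-> (forall k, (n <= k)%nat -> z k = 0) /\
       (forall k, (k < n)%nat -> exists m : Z, z k = eps * IZR m) /\ tri_box n (al i) (l i) z) /\
    prodR n (fun k => l i k / (2 * eps)) <= INR (length (La i))).
  { exists (fun i => epsilon (inhabits nil) (fun L => 
    NoDup L /\
    (forall z, In z L <-> (forall k, (n <= k)%nat -> z k = 0) /\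
       (forall k, (k < n)%nat -> exists m : Z, z k = eps * IZR m) /\ tri_box n (al i) (l i) z) /\
    prodR n (fun k => l i k / (2 * eps)) <= INR (length L))).
    intros i Hi. apply epsilon_spec.
    destruct (tri_box_lattice eps (al i) (l i) n) as [L [H1 [H2 [H3 _]]]]; auto.
    - intros k Hk. specialize (HE1 i k Hi Hk). lra.
    - now exists L. }
  destruct LA as [La HLa].
  assert (LB : exists Lb : pt * pt -> list pt, forall B, In B bs ->
    (forall z, In z (Lb B) <-> (forall k, (n <= k)%nat -> z k = 0) /\
       (forall k, (k < n)%nat -> exists m : Z, z k = eps * IZR m) /\ in_box n (fst B) (snd B) z) /\
    INR (length (Lb B)) <= prodR n (fun k => 2 / eps * (snd B k - fst B k))).
  { exists (fun B => epsilon (inhabits nil) (fun L => 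
    (forall z, In z L <-> (forall k, (n <= k)%nat -> z k = 0) /\
       (forall k, (k < n)%nat -> exists m : Z, z k = eps * IZR m) /\ in_box n (fst B) (snd B) z) /\
    INR (length L) <= prodR n (fun k => 2 / eps * (snd B k - fst B k)))).
    intros B HB. apply epsilon_spec.
    destruct (tri_box_lattice eps (fun k _ => fst B k) (fun k => snd B k - fst B k) n)
      as [L [H1 [H2 [_ H3]]]]; auto.
    - now intros k z z' _.
    - intros k Hk. specialize (HE2 B HB k Hk). lra.
    - exists L. split.
      + intros z. rewrite H2. split; intros [Z1 [Z2 Z3]]; (split; [|split]); auto;
          intros k Hk; specialize (Z3 k Hk); simpl in *; lra.
      + eapply Rle_trans; [apply H3|]. apply Req_le, prodR_ext. intros k Hk. field. lra. }
  destruct LB as [Lb HLb].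
  assert (Hlen : (length (flat_map La (seq 0 N)) <= length (flat_map Lb bs))%nat).
  { apply NoDup_incl_length.
    - apply NoDup_flat_map_disjoint; [apply seq_NoDup| |].
      + intros i Hi. apply in_seq in Hi. apply HLa. lia.
      + intros i j z Hi Hj Hz Hz'. apply in_seq in Hi, Hj.
        destruct (Nat.eq_dec i j) as [|Hij]; auto. exfalso.
        apply (Hd i j z); [lia|lia|auto| |].
        * apply HLa in Hz as [_ [_ Hz]]; [auto|lia].
        * apply HLa in Hz' as [_ [_ Hz']]; [auto|lia].
    - intros z Hz. apply in_flat_map in Hz as [i [Hi Hz]]. apply in_seq in Hi.
      apply HLa in Hz as [Z1 [Z2 Z3]]; [|lia].
      destruct (Hc i z) as [B [HB HzB]]; [lia|auto|].
      apply in_flat_map. exists B. split; auto. apply HLb; auto. }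
  apply le_INR in Hlen.
  assert (G1 : (/ (2 * eps)) ^ n * sumR N (fun i => prodR n (l i)) <=
               INR (length (flat_map La (seq 0 N)))).
  { rewrite <- sumR_scal. clear - HLa.
    assert (HH : forall M, (M <= N)%nat ->
      sumR M (fun i => (/ (2 * eps)) ^ n * prodR n (l i)) <= INR (length (flat_map La (seq 0 M)))).
    { induction M as [|M IH]; intros HM; [simpl; lra|].
      rewrite seq_S, flat_map_app, length_app, plus_INR. simpl sumR. simpl flat_map.
      rewrite app_nil_r. apply Rplus_le_compat; [apply IH; lia|].
      rewrite <- prodR_scal. destruct (HLa M) as [_ [_ HH]]; [lia|].
      eapply Rle_trans; [|apply HH]. apply Req_le, prodR_ext. intros k _.
      unfold Rdiv. apply Rmult_comm. }
    apply HH. lia. }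
  assert (G2 : INR (length (flat_map Lb bs)) <= (2 / eps) ^ n * volsum n bs).
  { clear - HLb. induction bs as [|B bs IH]; [simpl; lra|].
    change (flat_map Lb (B :: bs)) with (Lb B ++ flat_map Lb bs).
    change (volsum n (B :: bs)) with (vol n B + volsum n bs).
    rewrite length_app, plus_INR.
    destruct (HLb B (or_introl eq_refl)) as [_ HB]. rewrite prodR_scal in HB.
    specialize (IH (fun C HC => HLb C (or_intror HC))).
    unfold vol at 1. lra. }
  assert (Hp : 0 < (2 * eps) ^ n) by (apply pow_lt; lra).
  assert (E3 : (2 * eps) ^ n * (/ (2 * eps)) ^ n = 1).
  { rewrite <- Rpow_mult_distr, Rinv_r by lra. apply pow1. }
  assert (E4 : (2 * eps) ^ n * (2 / eps) ^ n = 4 ^ n).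
  { rewrite <- Rpow_mult_distr. f_equal. field. lra. }
  rewrite <- E4, <- (Rmult_1_l (sumR _ _)), <- E3, !Rmult_assoc.
  apply Rmult_le_compat_l; lra.
Qed.


(** * From countable to finite covers *)

(** Coquelicot states compactness for the iterated product [Tn n R]. The highest coordinate is
    stored first, so that both translations recurse on [n]. *)
Fixpoint to_Tn (n : nat) (x : pt) : Tn n R :=
  match n with O => tt | S k => (x k, to_Tn k x) end.

Fixpoint of_Tn (n : nat) : Tn n R -> pt :=
  match n with
  | O => fun _ _ => 0
  | S k => fun t => upd (of_Tn k (snd t)) k (fst t)
  end.

Lemma close_of_Tn n d x (t : Tn n R) :
  close_n n d (to_Tn n x) t -> forall i, (i < n)%nat -> Rabs (x i - of_Tn n t i) < d.
Proof.
  induction n as [|n IH]; intros H i Hi; [lia|].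
  destruct t as [t1 t2]. simpl in *. destruct H as [H1 H2]. unfold upd.
  destruct (Nat.eq_dec i n) as [->|Hn]; [auto|]. apply IH; [auto|lia].
Qed.

Lemma bounded_of_Tn n (a b : pt) (t : Tn n R) :
  bounded_n n (to_Tn n a) (to_Tn n b) t -> in_box n a b (of_Tn n t).
Proof.
  induction n as [|n IH]; intros H i Hi; [lia|].
  destruct t as [t1 t2]. simpl in *. destruct H as [H1 H2]. unfold upd.
  destruct (Nat.eq_dec i n) as [->|Hn]; [auto|]. apply IH; [auto|lia].
Qed.

Lemma bounded_to_Tn n (a b x : pt) :
  in_box n a b x -> bounded_n n (to_Tn n a) (to_Tn n b) (to_Tn n x).
Proof.
  induction n as [|n IH]; intros H; simpl; auto.
  split; [apply H; lia|]. apply IH. intros i Hi. apply H. lia.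
Qed.

Lemma box_gauge_cover n (a b : pt) (delta : pt -> R) :
  (forall t, 0 < delta t) ->
  exists l : list pt, forall x, in_box n a b x ->
    exists t, In t l /\ in_box n a b t /\ forall i, (i < n)%nat -> Rabs (x i - t i) < delta t.
Proof.
  (* [compactness_list] provides the finite list only under a double negation. *)
  intros Hd. apply NNPP. intros Hno.
  apply (compactness_list n (to_Tn n a) (to_Tn n b)
           (fun t => mkposreal (delta (of_Tn n t)) (Hd _))).
  intros [l Hl]. apply Hno. exists (map (of_Tn n) l). intros x Hx.
  destruct (Hl (to_Tn n x)) as [t [T1 [T2 T3]]]; [now apply bounded_to_Tn|].
  exists (of_Tn n t). split; [now apply in_map|]. split; [now apply bounded_of_Tn|].
  now apply close_of_Tn.
Qed.

Lemma prodR_enlarge n (x : nat -> R) : (forall i, 0 <= x i) -> forall eta, 0 < eta ->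
  exists d0, 0 < d0 /\ forall d, 0 < d <= d0 -> prodR n (fun i => x i + d) <= prodR n x + eta.
Proof.
  intros Hx. induction n as [|n IH]; intros eta He.
  - exists 1; split; [lra|]. simpl; intros; lra.
  - set (P := prodR n x). assert (HP : 0 <= P) by (apply prodR_nonneg; auto).
    assert (Hn := Hx n).
    set (e := eta / (2 * (x n + 1))).
    assert (E : e * (2 * (x n + 1)) = eta) by (unfold e; field; lra).
    assert (Hee : 0 < e) by (apply Rdiv_lt_0_compat; lra).
    destruct (IH e Hee) as [d0 [Hd0 HD]].
    set (d1 := eta / (2 * (P + e + 1))).
    assert (E1 : d1 * (2 * (P + e + 1)) = eta) by (unfold d1; field; lra).
    assert (Hd1 : 0 < d1) by (apply Rdiv_lt_0_compat; lra).
    exists (Rmin d0 d1). split; [now apply Rmin_pos|]. intros d [D1 D2]. simpl.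
    assert (d <= d0) by (eapply Rle_trans; [apply D2|apply Rmin_l]).
    assert (d <= d1) by (eapply Rle_trans; [apply D2|apply Rmin_r]).
    specialize (HD d ltac:(lra)). fold P in HD |- *.
    apply Rle_trans with ((P + e) * (x n + d)); [apply Rmult_le_compat_r; lra|].
    assert ((P + e) * d <= (P + e) * d1) by (apply Rmult_le_compat_l; lra).
    nra.
Qed.

Lemma sumR_sum_f_R0 f N : sumR (S N) f = sum_f_R0 f N.
Proof. induction N as [|N IH]; [simpl; lra|]. simpl sum_f_R0. rewrite <- IH. reflexivity. Qed.

Lemma sumR_half_pow M : sumR M (fun k => (/ 2) ^ (S k)) = 1 - (/ 2) ^ M.
Proof. induction M as [|M IH]; simpl in *; [lra|]. rewrite IH. lra. Qed.

Lemma sumR_half_pow_le1 M : sumR M (fun k => (/ 2) ^ (S k)) <= 1.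
Proof. rewrite sumR_half_pow. assert (0 < (/ 2) ^ M) by (apply pow_lt; lra). lra. Qed.

Lemma infinite_sum_sumR_le f l M :
  (forall k, 0 <= f k) -> infinite_sum f l -> sumR M f <= l.
Proof.
  intros Hf Hs. destruct M as [|M].
  - simpl. apply Rle_trans with (sum_f_R0 f 0); [apply Hf|]. now apply sum_incr.
  - rewrite sumR_sum_f_R0. now apply sum_incr.
Qed.

Definition box_seq (a b : nat -> pt) (M : nat) : list (pt * pt) :=
  map (fun k => (a k, b k)) (seq 0 M).

Lemma volsum_app n l l' : volsum n (l ++ l') = volsum n l + volsum n l'.
Proof. induction l as [|B l IH]; simpl; [|rewrite IH]; lra. Qed.

Lemma volsum_box_seq n a b M :
  volsum n (box_seq a b M) = sumR M (fun k => prodR n (fun i => b k i - a k i)).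
Proof.
  induction M as [|M IH]; [reflexivity|].
  unfold box_seq in *. rewrite seq_S, map_app, volsum_app, IH. simpl. unfold vol. simpl. lra.
Qed.

Definition affine_comb (n : nat) (y0 : pt) (Y : nat -> pt) (t : pt) : pt :=
  fun j => y0 j + sumR n (fun i => t i * Y i j).

Definition unit_cube (n : nat) (t : pt) : Prop := in_box n (fun _ => 0) (fun _ => 1) t.

(** The slack [c - l] pays for enlarging the [k]-th box at cost [(c - l) / 2^(k+1)]. Every point
    then has a whole neighbourhood inside one enlarged box, and compactness applies. The enlargement
    also makes the boxes nondegenerate, as lattice counting requires. It is chosen before the
    parallelepiped, so one sequence of boxes serves several parallelepipeds at once. *)
Lemma leb_measure_lt_finite_covers n (S : pt -> Prop) c :
  leb_measure_lt n S c ->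
  exists a b : nat -> pt,
    (forall k, nondeg n (a k, b k)) /\
    (forall M, volsum n (box_seq a b M) <= c) /\
    (forall y0 Y, (forall t, unit_cube n t -> S (affine_comb n y0 Y t)) ->
      exists M, forall t, unit_cube n t ->
        exists k, (k < M)%nat /\ in_box n (a k) (b k) (affine_comb n y0 Y t)).
Proof.
  intros [a [b [l [Hab [Hs [Hlc Hcov]]]]]].
  assert (CH : exists d : nat -> R, forall k, 0 < d k /\
    prodR n (fun i => b k i - a k i + d k) <=
      prodR n (fun i => b k i - a k i) + (c - l) * (/ 2) ^ (Datatypes.S k)).
  { exists (fun k => epsilon (inhabits 0) (fun d => 0 < d /\
      prodR n (fun i => b k i - a k i + d) <=
      prodR n (fun i => b k i - a k i) + (c - l) * (/ 2) ^ (Datatypes.S k))).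
    intros k. apply epsilon_spec.
    destruct (prodR_enlarge n (fun i => b k i - a k i)) with
      (eta := (c - l) * (/ 2) ^ (Datatypes.S k)) as [d [Hd HD]].
    - intros i. specialize (Hab k i). lra.
    - apply Rmult_lt_0_compat; [lra|apply pow_lt; lra].
    - exists d. split; auto. apply HD; lra. }
  destruct CH as [d Hd].
  exists (fun k i => a k i - d k / 2), (fun k i => b k i + d k / 2).
  split; [|split].
  - intros k i Hi. simpl. specialize (Hab k i). destruct (Hd k) as [H _]. lra.
  - intros M. rewrite volsum_box_seq.
    apply Rle_trans with (sumR M (fun k => prodR n (fun i => b k i - a k i) +
      (c - l) * (/ 2) ^ (Datatypes.S k))).
    + apply sumR_le. intros k _. eapply Rle_trans; [|apply (Hd k)].
      apply Req_le, prodR_ext. intros i _. lra.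
    + rewrite sumR_plus, sumR_scal.
      assert (sumR M (fun k => prodR n (fun i => b k i - a k i)) <= l).
      { apply infinite_sum_sumR_le; auto. intros k. apply prodR_nonneg.
        intros i _. specialize (Hab k i). lra. }
      assert (H1 := sumR_half_pow_le1 M). nra.
  - intros y0 Y HS.
    (* [B] is a Lipschitz constant, in the sup norm, of the affine map [t -> y0 + sum t_i Y_i]; the
       1 makes it positive. *)
    set (B := 1 + sumR n (fun j => sumR n (fun i => Rabs (Y i j)))).
    assert (HB0 : forall j, (j < n)%nat -> sumR n (fun i => Rabs (Y i j)) < B).
    { intros j Hj. unfold B.
      assert (sumR n (fun i => Rabs (Y i j)) <= sumR n (fun j => sumR n (fun i => Rabs (Y i j)))).
      { apply (sumR_term_le n j (fun j => sumR n (fun i => Rabs (Y i j)))); auto.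
        intros i _. apply sumR_nonneg. intros; apply Rabs_pos. }
      lra. }
    assert (HB : 0 < B).
    { unfold B. assert (0 <= sumR n (fun j => sumR n (fun i => Rabs (Y i j)))); [|lra].
      apply sumR_nonneg. intros; apply sumR_nonneg. intros; apply Rabs_pos. }
    (* [kk t] is an original box containing the image of [t]. Parameters within [d (kk t) / (2 B)]
       of [t] are sent into its enlargement. *)
    set (kk := fun t => epsilon (inhabits O)
                 (fun k => in_box n (a k) (b k) (affine_comb n y0 Y t))).
    assert (Hkk : forall t, unit_cube n t ->
              in_box n (a (kk t)) (b (kk t)) (affine_comb n y0 Y t)).
    { intros t Ht. apply epsilon_spec. apply Hcov, HS, Ht. }
    destruct (box_gauge_cover n (fun _ => 0) (fun _ => 1) (fun t => d (kk t) / 2 / B))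
      as [L HL].
    { intros t. destruct (Hd (kk t)) as [H _].
      apply Rdiv_lt_0_compat; [lra|auto]. }
    exists (Datatypes.S (list_max (map kk L))). intros t Ht.
    destruct (HL t Ht) as [s [Hs1 [Hs2 Hs3]]].
    exists (kk s). split.
    + assert (Hmx : Forall (fun k => (k <= list_max (map kk L))%nat) (map kk L))
        by now apply list_max_le.
      rewrite Forall_forall in Hmx. specialize (Hmx (kk s) (in_map kk L s Hs1)). lia.
    + intros j Hj. specialize (Hkk s Hs2 j Hj). simpl.
      assert (Hdiff : Rabs (affine_comb n y0 Y t j - affine_comb n y0 Y s j) <= d (kk s) / 2).
      { unfold affine_comb.
        replace (y0 j + sumR n (fun i => t i * Y i j) - (y0 j + sumR n (fun i => s i * Y i j)))
          with (sumR n (fun i => (t i - s i) * Y i j)).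
        2:{ rewrite (sumR_ext n _ (fun i => t i * Y i j + (-1) * (s i * Y i j))).
            - rewrite sumR_plus, sumR_scal. lra.
            - intros i _; lra. }
        eapply Rle_trans; [apply sumR_Rabs|].
        apply Rle_trans with (sumR n (fun i => (d (kk s) / 2 / B) * Rabs (Y i j))).
        - apply sumR_le. intros i Hi. rewrite Rabs_mult.
          apply Rmult_le_compat_r; [apply Rabs_pos|]. left; auto.
        - rewrite sumR_scal. destruct (Hd (kk s)) as [H _].
          apply Rle_trans with (d (kk s) / 2 / B * B).
          + apply Rmult_le_compat_l; [left; apply Rdiv_lt_0_compat; lra|].
            left; auto.
          + apply Req_le. field. lra. }
      apply Rabs_le_bounds in Hdiff. lra.
Qed.


(** * Volume of a convex body and of its polar *)

Definition convex_set (K : pt -> Prop) : Prop :=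
  forall y z t, K y -> K z -> 0 <= t <= 1 -> K (comb t y z).

Definition supported (n : nat) (z : pt) : Prop := forall i, (n <= i)%nat -> z i = 0.

Definition zero : pt := fun _ => 0.

Lemma convex_subcombination (K : pt -> Prop) (m : nat) (y : nat -> pt) (t : nat -> R) :
  convex_set K -> K zero -> (forall i, (i < m)%nat -> K (y i)) ->
  (forall i, (i < m)%nat -> 0 <= t i) -> sumR m t <= 1 ->
  K (fun j => sumR m (fun i => t i * y i j)).
Proof.
  intros HK H0. revert t. induction m as [|m IH]; intros t Hy Ht Hs; [exact H0|].
  simpl in Hs.
  assert (Hm : 0 <= t m) by auto.
  assert (Hs0 : 0 <= sumR m t) by (apply sumR_nonneg; auto).
  destruct (Req_dec (t m) 1) as [E|E].
  - replace (fun j => sumR (S m) (fun i => t i * y i j)) with (y m); [auto|].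
    apply functional_extensionality. intros j. simpl. rewrite E, sumR_zero; [lra|].
    intros i Hi. assert (t i <= sumR m t) by (apply sumR_term_le; auto).
    assert (0 <= t i) by auto. replace (t i) with 0 by lra. lra.
  - replace (fun j => sumR (S m) (fun i => t i * y i j))
      with (comb (t m) (y m) (fun j => sumR m (fun i => (t i / (1 - t m)) * y i j))).
    + apply HK; [auto| |lra]. apply IH; auto.
      * intros i Hi. apply Rmult_le_pos; [auto|]. left; apply Rinv_0_lt_compat; lra.
      * rewrite (sumR_ext m _ (fun i => / (1 - t m) * t i)) by (intros; unfold Rdiv; ring).
        rewrite sumR_scal. apply Rmult_le_reg_l with (1 - t m); [lra|].
        rewrite <- Rmult_assoc, Rinv_r; lra.
    + apply functional_extensionality. intros j. unfold comb. simpl.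
      rewrite <- sumR_scal. rewrite Rplus_comm. f_equal.
      apply sumR_ext. intros i _. field. lra.
Qed.

(** Suprema need not be attained, since the sets are not assumed compact; being within a factor 2
    suffices both for pivoting and for the greedy selection of caps. *)
Lemma half_sup (E : R -> Prop) (B : R) :
  (forall r, E r -> r <= B) -> (exists r, E r /\ 0 < r) ->
  exists r, E r /\ 0 < r /\ forall r', E r' -> r' <= 2 * r.
Proof.
  intros HB [r0 [Er0 Hr0]].
  destruct (completeness E) as [s [S1 S2]].
  - exists B. intros r Hr; auto.
  - now exists r0.
  - assert (Hs : 0 < s) by (specialize (S1 r0 Er0); lra).
    destruct (classic (exists r, E r /\ s / 2 < r)) as [[r [Er Hr]]|Hno].
    + exists r. split; [auto|]. split; [lra|]. intros r' Er'. specialize (S1 r' Er'). lra.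
    + assert (s <= s / 2); [|lra]. apply S2. intros r Er.
      destruct (Rle_dec r (s / 2)); auto. exfalso; apply Hno. exists r; split; [auto|lra].
Qed.

(** * Gaussian elimination with pivots taken from a convex set *)

(** The residual of [z] after subtracting multiples of [u 0], ..., [u (k-1)] that kill its
    coordinates 0, ..., k-1 in turn (for unitriangular [u]). [coef u k z] is the multiple of [u k]
    removed next, so the [coef] are the coordinates of [z] in the frame [u]. *)
Fixpoint res (u : nat -> pt) (k : nat) (z : pt) : pt :=
  match k with
  | O => z
  | S k' => fun j => res u k' z j - res u k' z k' * u k' j
  end.

Definition coef (u : nat -> pt) (k : nat) (z : pt) : R := res u k z k.

Definition unitriangular (u : nat -> pt) (k : nat) : Prop :=
  forall i, (i < k)%nat -> u i i = 1 /\ forall j, (j < i)%nat -> u i j = 0.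

Lemma res_linear u k a b z w j :
  res u k (fun j => a * z j + b * w j) j = a * res u k z j + b * res u k w j.
Proof.
  revert j. induction k as [|k IH]; intros j; simpl; [lra|]. rewrite !IH. ring.
Qed.

Lemma res_decomp u k z j : z j = sumR k (fun i => coef u i z * u i j) + res u k z j.
Proof.
  induction k as [|k IH]; simpl; [lra|]. unfold coef at 2. lra.
Qed.

Lemma res_eq0 u k z j : unitriangular u k -> (j < k)%nat -> res u k z j = 0.
Proof.
  intros Hu. revert j. induction k as [|k IH]; intros j Hj; [lia|]. simpl.
  destruct (Nat.eq_dec j k) as [->|Hjk].
  - destruct (Hu k) as [H _]; [lia|]. rewrite H. lra.
  - rewrite IH; [|intros i Hi; apply Hu; lia|lia].
    destruct (Hu k) as [_ H]; [lia|]. rewrite H by lia. lra.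
Qed.

(** With [j = k] it says that [coef u k z - z k] depends only on the coordinates of [z] below [k],
    which turns the box [|coef u k z| <= b k] into a triangular one. *)
Lemma res_triangular u k z z' j :
  (forall i, (i < k)%nat -> z i = z' i) -> res u k z j - z j = res u k z' j - z' j.
Proof.
  revert j. induction k as [|k IH]; intros j H; simpl; [lra|].
  assert (E1 := IH j ltac:(intros; apply H; lia)).
  assert (E2 := IH k ltac:(intros; apply H; lia)).
  rewrite (H k) in E2 by lia. replace (res u k z k) with (res u k z' k) by lra. lra.
Qed.

Lemma res_ext u u' k z : (forall i, (i < k)%nat -> u i = u' i) -> res u k z = res u' k z.
Proof.
  induction k as [|k IH]; intros H; simpl; auto.
  rewrite IH by (intros; apply H; lia). now rewrite (H k) by lia.
Qed.

Lemma res_unit u k i j (e : pt) :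
  (forall m, m <> k -> e m = 0) -> (i <= k)%nat -> res u i e j = e j.
Proof.
  intros He. revert j. induction i as [|i IH]; intros j Hi; simpl; [reflexivity|].
  rewrite !IH by lia. rewrite (He i) by lia. lra.
Qed.

Lemma res_bounded n u k (K : pt -> Prop) R0 :
  (forall z j, K z -> (j < n)%nat -> Rabs (z j) <= R0) -> (k <= n)%nat ->
  exists R1, forall z j, K z -> (j < n)%nat -> Rabs (res u k z j) <= R1.
Proof.
  intros HK. induction k as [|k IH]; intros Hk; [now exists R0|].
  destruct IH as [R1 H1]; [lia|].
  exists (R1 + R1 * sumR n (fun j => Rabs (u k j))). intros z j Hz Hj. simpl.
  unfold Rminus. eapply Rle_trans; [apply Rabs_triang|]. rewrite Rabs_Ropp, Rabs_mult.
  apply Rplus_le_compat; [auto|].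
  apply Rmult_le_compat; [apply Rabs_pos|apply Rabs_pos|apply H1; auto; lia|].
  apply (sumR_term_le n j (fun j => Rabs (u k j))); auto. intros; apply Rabs_pos.
Qed.

Definition contains_cube (n : nat) (K : pt -> Prop) (a : pt) (s : R) : Prop :=
  forall w, supported n w -> (forall i, (i < n)%nat -> Rabs (w i) <= s) -> K (fun j => a j + w j).

(* Gaussian elimination: the [k]-th pivot [y k] is a point of [K] at which the [k]-th coordinate
   of the residual is at least half of its supremum over [K]. *)
Lemma greedy_pivots n (K : pt -> Prop) R0 a s :
  (forall z j, K z -> (j < n)%nat -> Rabs (z j) <= R0) ->
  0 < s -> contains_cube n K a s ->
  forall k, (k <= n)%nat -> exists (u y : nat -> pt) (b : nat -> R),
    unitriangular u k /\
    forall i, (i < k)%nat ->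
      K (y i) /\ 0 < b i /\ b i = Rabs (coef u i (y i)) /\
      (forall j, u i j = res u i (y i) j / coef u i (y i)) /\
      (forall z, K z -> Rabs (coef u i z) <= 2 * b i).
Proof.
  intros HR Hs Hc. induction k as [|k IH]; intros Hk.
  - exists (fun _ => zero), (fun _ => zero), (fun _ => 0). split; intros i Hi; lia.
  - destruct IH as [u [y [b [Hu H]]]]; [lia|].
    destruct (res_bounded n u k K R0 HR) as [R1 HR1]; [lia|].
    destruct (half_sup (fun r => exists z, K z /\ r = Rabs (coef u k z)) R1) as [r [[z [Kz ->]] [Hz1 Hz2]]].
    { intros r [z [Kz ->]]. apply HR1; [auto|lia]. }
    (* The supremum is positive: the residuals of [a] and of [a + s e_k] differ by [s] in coordinate
       [k], so one of them does not vanish there. *)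
    { set (e := fun j : nat => if Nat.eq_dec j k then 1 else 0).
      assert (Ek : e k = 1) by (unfold e; now destruct (Nat.eq_dec k k)).
      assert (Ej : forall m, m <> k -> e m = 0)
        by (intros m Hm; unfold e; now destruct (Nat.eq_dec m k)).
      assert (K1 : K (fun j => a j + zero j)).
      { apply Hc; unfold zero; [now intros i _|]. intros i _. rewrite Rabs_R0. lra. }
      assert (K2 : K (fun j => a j + s * e j)).
      { apply Hc.
        - intros i Hi. rewrite Ej by lia. lra.
        - intros i Hi. destruct (Nat.eq_dec i k) as [->|Hik].
          + rewrite Ek, Rabs_right; lra.
          + rewrite Ej, Rmult_0_r, Rabs_R0; [lra|auto]. }
      assert (E : coef u k (fun j => a j + s * e j) = coef u k (fun j => a j + zero j) + s).
      { unfold coef.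
        replace (fun j => a j + s * e j) with (fun j => 1 * (a j + zero j) + s * e j)
          by (apply functional_extensionality; intros; unfold zero; lra).
        rewrite (res_linear u k 1 s (fun j => a j + zero j) e k), (res_unit u k k k e) by auto.
        rewrite Ek. ring. }
      destruct (Req_dec (coef u k (fun j => a j + zero j)) 0) as [E0|E0].
      - eexists. split; [eexists; split; [apply K2|reflexivity]|].
        rewrite E, E0. apply Rabs_pos_lt. lra.
      - eexists. split; [eexists; split; [apply K1|reflexivity]|].
        now apply Rabs_pos_lt. }
    set (u' := fun i => if Nat.eq_dec i k then (fun j => res u k z j / coef u k z) else u i).
    set (y' := fun i => if Nat.eq_dec i k then z else y i).
    set (b' := fun i => if Nat.eq_dec i k then Rabs (coef u k z) else b i).
    assert (Huk : u' k = fun j => res u k z j / coef u k z)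
      by (unfold u'; now destruct (Nat.eq_dec k k)).
    assert (Hui : forall i, i <> k -> u' i = u i)
      by (intros i Hi; unfold u'; now destruct (Nat.eq_dec i k)).
    assert (Hres : forall i w, (i <= k)%nat -> res u' i w = res u i w)
      by (intros i w Hi; apply res_ext; intros; apply Hui; lia).
    assert (Hcf : forall i w, (i <= k)%nat -> coef u' i w = coef u i w)
      by (intros; unfold coef; now rewrite Hres).
    assert (Hnz : coef u k z <> 0).
    { intros E. rewrite E, Rabs_R0 in Hz1. lra. }
    exists u', y', b'. split.
    + intros i Hi. destruct (Nat.eq_dec i k) as [->|Hik].
      * rewrite Huk. split; [unfold coef; field; auto|]. intros j Hj.
        rewrite (res_eq0 u k z j) by auto. unfold Rdiv. lra.
      * rewrite Hui by auto. apply Hu. lia.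
    + intros i Hi. unfold y', b'. rewrite !Hcf by lia.
      destruct (Nat.eq_dec i k) as [->|Hik].
      * split; [auto|]. split; [auto|]. split; [auto|]. split.
        -- intros j. rewrite Huk, Hres by lia. reflexivity.
        -- intros w Kw. rewrite Hcf by lia. apply Hz2. now exists w.
      * destruct (H i) as [A1 [A2 [A3 [A4 A5]]]]; [lia|].
        split; [auto|]. split; [auto|]. split; [auto|]. split.
        -- intros j. rewrite Hui, Hres by lia. apply A4.
        -- intros w Kw. rewrite Hcf by lia. auto.
Qed.

Definition comb_le (n : nat) (y : nat -> pt) (T : R) (w : pt) : Prop :=
  exists t : nat -> R, (forall i, (i < n)%nat -> Rabs (t i) <= T) /\
    forall j, w j = sumR n (fun i => t i * y i j).

Lemma comb_le_linear n y T1 T2 c1 c2 w1 w2 :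
  comb_le n y T1 w1 -> comb_le n y T2 w2 ->
  comb_le n y (Rabs c1 * T1 + Rabs c2 * T2) (fun j => c1 * w1 j + c2 * w2 j).
Proof.
  intros [t1 [H1 E1]] [t2 [H2 E2]]. exists (fun i => c1 * t1 i + c2 * t2 i). split.
  - intros i Hi. eapply Rle_trans; [apply Rabs_triang|]. rewrite !Rabs_mult.
    apply Rplus_le_compat; apply Rmult_le_compat_l; auto using Rabs_pos.
  - intros j. rewrite E1, E2, <- !sumR_scal, <- sumR_plus. apply sumR_ext. intros; ring.
Qed.

Lemma comb_le_sum n y m (T : nat -> R) (c : nat -> R) C (w : nat -> pt) :
  (forall k, (k < m)%nat -> comb_le n y (T k) (w k)) ->
  (forall k, (k < m)%nat -> Rabs (c k) <= C) -> (forall k, 0 <= T k) ->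
  comb_le n y (C * sumR m T) (fun j => sumR m (fun k => c k * w k j)).
Proof.
  induction m as [|m IH]; intros Hw Hc HT.
  - exists (fun _ => 0). split.
    + intros i _. rewrite Rabs_R0. simpl. lra.
    + intros j. simpl. symmetry. apply sumR_zero. intros; lra.
  - specialize (IH ltac:(auto) ltac:(auto) HT).
    assert (Hm := comb_le_linear _ _ _ _ 1 (c m) _ _ IH (Hw m ltac:(lia))).
    destruct Hm as [t [H1 H2]]. exists t. split.
    + intros i Hi. eapply Rle_trans; [apply H1; auto|]. simpl. rewrite Rabs_R1.
      assert (Rabs (c m) * T m <= C * T m) by (apply Rmult_le_compat_r; auto). lra.
    + intros j. rewrite <- H2. simpl. lra.
Qed.

Lemma sumR_pow3 i : 1 + 2 * sumR i (fun k => 3 ^ k) = 3 ^ i.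
Proof. induction i as [|i IH]; simpl in *; lra. Qed.

(** Solving [y i = sum_(k<i) coef_k u_k + coef_i u_i] for the last term gives, up to sign, [b_i u_i]
    as [y i] minus multiples of the [b_k u_k] by factors of size at most 2. The coefficient bounds
    obey [T_i = 1 + 2 sum_(k<i) T_k], that is [T_i = 3^i]. *)
Lemma pivots_comb_le n (u y : nat -> pt) (b : nat -> R) :
  (forall i, (i < n)%nat ->
      0 < b i /\ b i = Rabs (coef u i (y i)) /\
      (forall j, u i j = res u i (y i) j / coef u i (y i)) /\
      (forall k, (k < n)%nat -> Rabs (coef u k (y i)) <= 2 * b k)) ->
  forall i, (i < n)%nat -> comb_le n y (3 ^ i) (fun j => b i * u i j).
Proof.
  intros H i. induction i as [i IH] using lt_wf_ind. intros Hi.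
  destruct (H i Hi) as [H1 [H2 [H3 H4]]].
  assert (Hnz : coef u i (y i) <> 0) by (intros E; rewrite E, Rabs_R0 in H2; lra).
  assert (A : comb_le n y 1 (y i)).
  { exists (fun k => if Nat.eq_dec k i then 1 else 0). split.
    - intros k _. destruct (Nat.eq_dec k i); rewrite ?Rabs_R1, ?Rabs_R0; lra.
    - intros j. rewrite (sumR_single n i); auto.
      + destruct (Nat.eq_dec i i); [lra|easy].
      + intros k _ Hk. destruct (Nat.eq_dec k i); [easy|lra]. }
  assert (B : comb_le n y (2 * sumR i (fun k => 3 ^ k))
                (fun j => sumR i (fun k => (coef u k (y i) / b k) * (b k * u k j)))).
  { apply (comb_le_sum n y i (fun k => 3 ^ k) (fun k => coef u k (y i) / b k) 2
             (fun k j => b k * u k j)).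
    - intros k Hk. apply IH; lia.
    - intros k Hk. destruct (H k) as [P _]; [lia|].
      unfold Rdiv. rewrite Rabs_mult, (Rabs_right (/ b k)).
      + apply Rmult_le_reg_r with (b k); auto. rewrite Rmult_assoc, Rinv_l by lra.
        rewrite Rmult_1_r. apply H4. lia.
      + left. now apply Rinv_0_lt_compat.
    - intros k. apply pow_le. lra. }
  set (sg := b i / coef u i (y i)).
  assert (Hsg : Rabs sg = 1).
  { unfold sg, Rdiv. rewrite Rabs_mult, (Rabs_right (b i)), Rabs_inv, <- H2 by lra. field. lra. }
  assert (C := comb_le_linear _ _ _ _ sg (- sg) _ _ A B).
  rewrite Rabs_Ropp, Hsg in C.
  rewrite <- sumR_pow3.
  destruct C as [t [T1 T2]]. exists t. split.
  - intros k Hk. eapply Rle_trans; [apply T1; auto|]. lra.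
  - intros j. rewrite <- T2, H3.
    rewrite (res_decomp u i (y i) j).
    rewrite (sumR_ext i (fun k => coef u k (y i) / b k * (b k * u k j))
               (fun k => coef u k (y i) * u k j)).
    + unfold sg. field. auto.
    + intros k Hk. destruct (H k) as [P _]; [lia|]. field. lra.
Qed.

(** * Finite box covers and the volume of the pivot frame *)

Definition finite_cov (n : nat) (A : pt -> Prop) (c : R) : Prop :=
  exists bs : list (pt * pt), (forall B, In B bs -> nondeg n B) /\ volsum n bs <= c /\
    forall z, A z -> exists B, In B bs /\ in_box n (fst B) (snd B) z.

Lemma finite_cov_union n A A' A'' c c' :
  finite_cov n A c -> finite_cov n A' c' -> (forall z, A'' z -> A z \/ A' z) ->
  finite_cov n A'' (c + c').
Proof.
  intros [bs [H1 [H2 H3]]] [bs' [H1' [H2' H3']]] HA. exists (bs ++ bs'). split; [|split].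
  - intros B HB. apply in_app_or in HB as [HB|HB]; auto.
  - rewrite volsum_app. lra.
  - intros z Hz. destruct (HA z Hz) as [Hz'|Hz'].
    + destruct (H3 z Hz') as [B [HB HBz]]. exists B. split; auto. apply in_or_app; auto.
    + destruct (H3' z Hz') as [B [HB HBz]]. exists B. split; auto. apply in_or_app; auto.
Qed.

Lemma finite_cov_translate n A A' c x :
  finite_cov n A c -> (forall z, A' z -> A (fun j => z j - x j)) -> finite_cov n A' c.
Proof.
  intros [bs [H1 [H2 H3]]] HA.
  set (f := fun B : pt * pt => ((fun j => fst B j + x j) : pt, (fun j => snd B j + x j) : pt)).
  exists (map f bs). split; [|split].
  - intros B HB. apply in_map_iff in HB as [C [<- HC]]. intros i Hi. simpl.
    specialize (H1 C HC i Hi). lra.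
  - replace (volsum n (map f bs)) with (volsum n bs); auto.
    clear. induction bs as [|B bs IH]; simpl; auto. rewrite IH. f_equal.
    apply prodR_ext. intros i _. simpl. lra.
  - intros z Hz. destruct (H3 _ (HA z Hz)) as [B [HB HBz]]. exists (f B). split.
    + now apply in_map.
    + intros i Hi. specialize (HBz i Hi). simpl in *. lra.
Qed.

Lemma finite_cov_mono n (A A' : pt -> Prop) c :
  finite_cov n A c -> (forall z, A' z -> A z) -> finite_cov n A' c.
Proof.
  intros [bs [H1 [H2 H3]]] HA. exists bs. split; [auto|]. split; [auto|].
  intros z Hz. apply H3, HA, Hz.
Qed.

Lemma in_box_finite_cov n a b M A c :
  (forall k, nondeg n (a k, b k)) -> (forall M, volsum n (box_seq a b M) <= c) ->
  (forall z, A z -> exists k, (k < M)%nat /\ in_box n (a k) (b k) z) -> finite_cov n A c.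
Proof.
  intros H1 H2 H3. exists (box_seq a b M). split; [|split; auto].
  - intros B HB. apply in_map_iff in HB as [k [<- _]]. apply H1.
  - intros z Hz. destruct (H3 z Hz) as [k [Hk Hb]]. exists (a k, b k). split; auto.
    apply in_map_iff. exists k. split; auto. apply in_seq. lia.
Qed.

Definition slab_combs (n : nat) (Y : nat -> pt) (lo hi : nat -> R) (z : pt) : Prop :=
  exists t, in_box n lo hi t /\ forall j, (j < n)%nat -> z j = sumR n (fun i => t i * Y i j).

(* Stretching the [k]-th range from [0,1] to [-m,m] costs [2m] translates. *)
Lemma finite_cov_stretch n (Y : nat -> pt) (m : nat) (c : R) k :
  (0 < m)%nat -> finite_cov n (slab_combs n Y (fun _ => 0) (fun _ => 1)) c -> (k <= n)%nat ->
  finite_cov n (slab_combs n Y (fun i => if lt_dec i k then - INR m else 0)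
                              (fun i => if lt_dec i k then INR m else 1)) ((2 * INR m) ^ k * c).
Proof.
  intros Hm H. induction k as [|k IH]; intros Hk.
  - simpl. rewrite Rmult_1_l. eapply finite_cov_mono; [apply H|].
    intros z [t [H1 H2]]. exists t. split; auto.
  - specialize (IH ltac:(lia)). set (c' := (2 * INR m) ^ k * c) in *.
    assert (Q : forall q, finite_cov n (slab_combs n Y
       (fun i => if lt_dec i k then - INR m else if Nat.eq_dec i k then - INR m else 0)
       (fun i => if lt_dec i k then INR m else if Nat.eq_dec i k then - INR m + INR (S q) else 1))
       (INR (S q) * c')).
    { assert (Piece : forall q, finite_cov n (slab_combs n Y
       (fun i => if lt_dec i k then - INR m else if Nat.eq_dec i k then - INR m + INR q else 0)
       (fun i => if lt_dec i k then INR m else if Nat.eq_dec i k then - INR m + INR (S q) else 1)) c').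
      { intros q. apply (finite_cov_translate n _ _ c' (fun j => (- INR m + INR q) * Y k j) IH).
        intros z [t [T1 T2]].
        exists (fun i => if Nat.eq_dec i k then t k - (- INR m + INR q) else t i). split.
        - intros i Hi. specialize (T1 i Hi). cbv beta in T1 |- *. rewrite S_INR in T1.
          destruct (lt_dec i k); destruct (Nat.eq_dec i k) as [Ei|]; try lia; try lra.
          subst i. lra.
        - intros j Hj. rewrite T2 by auto. symmetry.
          rewrite (sumR_ext n _ (fun i => t i * Y i j +
             (-1) * (if Nat.eq_dec i k then (- INR m + INR q) * Y k j else 0))).
          + rewrite sumR_plus, sumR_scal.
            rewrite (sumR_single n k (fun i => if Nat.eq_dec i k then _ else 0)); [|lia|].
            * destruct (Nat.eq_dec k k); [lra|easy].
            * intros i _ Hi. now destruct (Nat.eq_dec i k).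
          + intros i _. destruct (Nat.eq_dec i k) as [->|]; lra. }
      induction q as [|q IHq].
      - simpl INR. rewrite Rmult_1_l. eapply finite_cov_mono; [apply (Piece O)|].
        intros z [t [T1 T2]]. exists t. split; auto. intros i Hi. specialize (T1 i Hi).
        simpl in *. destruct (lt_dec i k); destruct (Nat.eq_dec i k); lra.
      - rewrite S_INR, Rmult_plus_distr_r, Rmult_1_l.
        eapply finite_cov_union; [apply IHq|apply (Piece (S q))|].
        intros z [t [T1 T2]].
        destruct (Rle_dec (t k) (- INR m + INR (S q))) as [Hle|Hle].
        + left. exists t. split; auto. intros i Hi. specialize (T1 i Hi). cbv beta in T1 |- *.
          destruct (lt_dec i k); destruct (Nat.eq_dec i k) as [Ei|]; try subst i; lra.
        + right. exists t. split; auto. intros i Hi. specialize (T1 i Hi). cbv beta in T1 |- *.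
          destruct (lt_dec i k); destruct (Nat.eq_dec i k) as [Ei|]; try subst i; rewrite ?(S_INR (S q)); lra. }
    specialize (Q (2 * m - 1)%nat). replace (S (2 * m - 1)) with (2 * m)%nat in Q by lia.
    rewrite mult_INR in Q. simpl (INR 2) in Q.
    replace ((2 * INR m) ^ S k * c) with ((1 + 1) * INR m * c') by (unfold c'; simpl; ring).
    eapply finite_cov_mono; [apply Q|].
    intros z [t [T1 T2]]. exists t. split; auto. intros i Hi. specialize (T1 i Hi). cbv beta in T1 |- *.
    destruct (lt_dec i (S k)); destruct (lt_dec i k); destruct (Nat.eq_dec i k);
      try lia; lra.
Qed.

(** With [m = n * 3^n]: stretching the cover costs [(2 m)^n], lattice counting [4^n], and the sides
    [2 * b k] of the frame give back [2^n]. *)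
Definition vp_const (n : nat) : R := (4 * INR (n * 3 ^ n)) ^ n.

(* [K] lies in the parallelepiped with axes [u k] and half-sides [2 * b k], and its volume is
   comparable to that of the latter. *)
Lemma triangular_frame n (K : pt -> Prop) R0 a s c :
  (0 < n)%nat -> convex_set K -> K zero ->
  (forall z j, K z -> (j < n)%nat -> Rabs (z j) <= R0) ->
  0 < s -> contains_cube n K a s -> leb_measure_lt n K c ->
  exists (u : nat -> pt) (b : nat -> R),
    unitriangular u n /\ (forall k, (k < n)%nat -> 0 < b k) /\
    (forall z, K z -> exists f : nat -> R, (forall k, (k < n)%nat -> Rabs (f k) <= 2 * b k) /\
       forall j, (j < n)%nat -> z j = sumR n (fun k => f k * u k j)) /\
    prodR n b <= vp_const n * c.
Proof.
  intros Hn HK H0 HR Hs Hcube Hm.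
  destruct (greedy_pivots n K R0 a s HR Hs Hcube n) as [u [y [b [Hu H]]]]; [lia|].
  assert (Hdec : forall z j, (j < n)%nat -> z j = sumR n (fun k => coef u k z * u k j)).
  { intros z j Hj. rewrite (res_decomp u n z j) at 1. rewrite (res_eq0 u n z j); auto. lra. }
  exists u, b. split; [auto|]. split; [intros; now apply H|]. split.
  { intros z Hz. exists (fun k => coef u k z). split; [|now apply Hdec].
    intros k Hk. now apply H. }
  (* Dividing the pivots by [n] keeps every combination with coefficients in [[0,1]] inside [K], as
     the weights then sum to at most 1. *)
  set (Y := fun i : nat => (fun j => y i j / INR n) : pt).
  assert (HnR : 0 < INR n) by now apply lt_0_INR.
  set (m := (n * 3 ^ n)%nat).
  assert (Hm0 : (0 < m)%nat) by (unfold m; assert (3 ^ n <> 0)%nat by (apply Nat.pow_nonzero; lia); lia).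
  assert (HP : finite_cov n (slab_combs n Y (fun _ => 0) (fun _ => 1)) c).
  { destruct (leb_measure_lt_finite_covers n K c Hm) as [A [B [N1 [N2 N3]]]].
    destruct (N3 zero Y) as [M HM].
    - intros t Ht.
      replace (affine_comb n zero Y t) with (fun j => sumR n (fun i => (t i / INR n) * y i j)).
      + apply convex_subcombination; auto.
        * intros i Hi. now apply H.
        * intros i Hi. specialize (Ht i Hi). apply Rmult_le_pos; [simpl in Ht; lra|].
          left. now apply Rinv_0_lt_compat.
        * apply Rle_trans with (sumR n (fun _ => / INR n)).
          -- apply sumR_le. intros i Hi. specialize (Ht i Hi). simpl in Ht.
             rewrite <- (Rmult_1_l (/ INR n)). apply Rmult_le_compat_r; [|lra].
             left. now apply Rinv_0_lt_compat.
          -- rewrite sumR_const, Rinv_r; lra.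
      + apply functional_extensionality. intros j. unfold affine_comb, zero, Y.
        rewrite Rplus_0_l. apply sumR_ext. intros i _. field. lra.
    - apply (in_box_finite_cov n A B M); auto.
      intros z [t [T1 T2]]. destruct (HM t T1) as [k [Hk Hbox]]. exists k. split; auto.
      intros i Hi. rewrite T2 by auto. specialize (Hbox i Hi).
      unfold affine_comb, zero in Hbox. lra. }
  assert (HS := finite_cov_stretch n Y m c n Hm0 HP (le_n n)).
  destruct HS as [bs [B1 [B2 B3]]].
  (* A single triangular box, [|coef u k z| <= b k]. Its points are combinations of the [Y i] with
     coefficients at most [n * 3^n = m], hence lie in the stretched cover. *)
  assert (HV := tri_box_volume n 1 (fun _ k z => z k - coef u k z - b k) (fun _ k => 2 * b k) bs).
  assert (HV' : prodR n (fun k => 2 * b k) <= 4 ^ n * volsum n bs).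
  { rewrite <- (Rplus_0_l (prodR n _)). apply HV; auto.
    - intros _ _ k z z' Hz. assert (E := res_triangular u k z z' k Hz). unfold coef. lra.
    - intros i k _ Hk. destruct (H k Hk) as [_ [P _]]. lra.
    - intros i j z Hi Hj. lia.
    - intros i z _ Hz. apply B3.
      assert (Hb : comb_le n y (1 * sumR n (fun k => 3 ^ k))
               (fun j => sumR n (fun k => (coef u k z / b k) * (b k * u k j)))).
      { apply (comb_le_sum n y n (fun k => 3 ^ k) (fun k => coef u k z / b k) 1
                 (fun k j => b k * u k j)).
        - apply pivots_comb_le. intros k Hk. destruct (H k Hk) as [P1 [P2 [P3 [P4 P5]]]].
          repeat split; auto. intros k' Hk'. now apply H.
        - intros k Hk. destruct (H k Hk) as [_ [P _]].
          specialize (Hz k Hk). simpl in Hz.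
          unfold Rdiv. rewrite Rabs_mult, (Rabs_right (/ b k)).
          + apply Rmult_le_reg_r with (b k); auto. rewrite Rmult_assoc, Rinv_l by lra.
            rewrite Rmult_1_r, Rmult_1_l. apply Rabs_le. lra.
          + left. now apply Rinv_0_lt_compat.
        - intros k. apply pow_le. lra. }
      destruct Hb as [t [T1 T2]]. exists (fun i => INR n * t i). split.
      + intros q Hq. cbv beta. destruct (lt_dec q n); [|lia]. specialize (T1 q Hq).
        assert (G : sumR n (fun k => 3 ^ k) <= 3 ^ n).
        { rewrite <- sumR_pow3.
          assert (0 <= sumR n (fun k => 3 ^ k)); [|lra].
          apply sumR_nonneg. intros; apply pow_le; lra. }
        assert (Em : INR m = INR n * 3 ^ n).
        { unfold m. rewrite mult_INR, pow_INR. do 2 f_equal. simpl; lra. }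
        rewrite Em. apply Rabs_le_bounds in T1. split.
        * rewrite Ropp_mult_distr_r. apply Rmult_le_compat_l; lra.
        * apply Rmult_le_compat_l; lra.
      + intros j Hj. rewrite (Hdec z j Hj).
        transitivity (sumR n (fun i => t i * y i j)).
        * rewrite <- T2. apply sumR_ext. intros k Hk. destruct (H k Hk) as [_ [P _]]. field. lra.
        * apply sumR_ext. intros q _. unfold Y. field. lra. }
  rewrite prodR_scal in HV'. unfold vp_const. fold m.
  assert (P2 : 0 < 2 ^ n) by (apply pow_lt; lra).
  apply Rmult_le_reg_l with (2 ^ n); auto.
  eapply Rle_trans; [apply HV'|].
  replace (2 ^ n * ((4 * INR m) ^ n * c)) with (4 ^ n * ((2 * INR m) ^ n * c)).
  - apply Rmult_le_compat_l; auto. apply pow_le; lra.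
  - rewrite !Rpow_mult_distr. ring.
Qed.


Lemma finite_cov_double n A A' c a :
  finite_cov n A c -> (forall z, A' z -> A (fun j => (z j + a j) / 2)) ->
  finite_cov n A' (2 ^ n * c).
Proof.
  intros [bs [H1 [H2 H3]]] HA.
  set (f := fun B : pt * pt => ((fun j => 2 * fst B j - a j) : pt, (fun j => 2 * snd B j - a j) : pt)).
  exists (map f bs). split; [|split].
  - intros B HB. apply in_map_iff in HB as [C [<- HC]]. intros i Hi. simpl.
    specialize (H1 C HC i Hi). lra.
  - replace (volsum n (map f bs)) with (2 ^ n * volsum n bs).
    + apply Rmult_le_compat_l; auto. apply pow_le; lra.
    + clear. induction bs as [|B bs IH]; simpl; [lra|]. rewrite <- IH, Rmult_plus_distr_l.
      f_equal. unfold vol. rewrite <- prodR_scal. apply prodR_ext. intros i _. simpl. lra.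
  - intros z Hz. destruct (H3 _ (HA z Hz)) as [B [HB HBz]]. exists (f B). split.
    + now apply in_map.
    + intros i Hi. specialize (HBz i Hi). simpl in *. lra.
Qed.

(** * Separated points in a convex body *)

Definition separated (n : nat) (s : R) (y z : pt) : Prop :=
  exists k, (k < n)%nat /\ s <= Rabs (y k - z k).

(* A cube of half-side [s / 3] around a point of [K] lies in [2 K - a], because [K] contains the
   cube of half-side [s] around [a]. *)
Lemma separated_count n (K : pt -> Prop) a s c N (z : nat -> pt) :
  convex_set K -> (forall y, K y -> supported n y) ->
  0 < s -> contains_cube n K a s -> leb_measure_lt n K c ->
  (forall i, (i < N)%nat -> K (z i)) ->
  (forall i j, (i < j < N)%nat -> separated n s (z i) (z j)) ->
  INR N * (2 * s / 3) ^ n <= 8 ^ n * c.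
Proof.
  intros HK Hsup Hs Hcube Hm Hz Hsep.
  destruct (leb_measure_lt_finite_covers n K c Hm) as [A [B [N1 [N2 N3]]]].
  (* [y0 i] and [Y] parametrise the cube of side [s / 3] centred at the midpoint of [z i] and [a].
     It lies in [K] as the set of midpoints of [z i] with the cube of half-side [s / 3] around
     [a]. *)
  set (y0 := fun (i j : nat) => if lt_dec j n then (z i j + a j) / 2 - s / 6 else 0).
  set (Y := fun (k j : nat) => if Nat.eq_dec k j then s / 3 else 0).
  assert (Haff : forall i t j, (j < n)%nat ->
            affine_comb n (y0 i) Y t j = (z i j + a j) / 2 - s / 6 + t j * (s / 3)).
  { intros i t j Hj. unfold affine_comb, y0. destruct (lt_dec j n); [|lia].
    rewrite (sumR_single n j); auto.
    - unfold Y. destruct (Nat.eq_dec j j); [lra|easy].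
    - intros k _ Hk. unfold Y. destruct (Nat.eq_dec k j); [easy|lra]. }
  assert (HM : exists M, forall i t, (i < N)%nat -> unit_cube n t ->
            exists k, (k < M)%nat /\ in_box n (A k) (B k) (affine_comb n (y0 i) Y t)).
  { assert (H1 : forall i, (i < N)%nat -> exists M, forall t, unit_cube n t ->
            exists k, (k < M)%nat /\ in_box n (A k) (B k) (affine_comb n (y0 i) Y t)).
    { intros i Hi. apply N3. intros t Ht.
      set (w := fun j : nat => if lt_dec j n then - s / 3 + 2 * s / 3 * t j else 0).
      assert (Ka : K (fun j => a j + w j)).
      { apply Hcube.
        - intros j Hj. unfold w. destruct (lt_dec j n); [lia|auto].
        - intros j Hj. unfold w. destruct (lt_dec j n); [|lia]. specialize (Ht j Hj).
          simpl in Ht. apply Rabs_le. nra. }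
      replace (affine_comb n (y0 i) Y t) with (comb (/ 2) (z i) (fun j => a j + w j)).
      { apply HK; auto. lra. }
      apply functional_extensionality. intros j. destruct (lt_dec j n) as [Hj|Hj].
      - rewrite Haff by auto. unfold comb, w. destruct (lt_dec j n); [|lia]. lra.
      - unfold comb. rewrite (Hsup _ (Hz i Hi) j), (Hsup _ Ka j) by lia.
        unfold affine_comb, y0. destruct (lt_dec j n); [lia|].
        rewrite sumR_zero; [lra|]. intros k Hk. unfold Y.
        destruct (Nat.eq_dec k j); [lia|lra]. }
    clear - H1. induction N as [|N IH].
    - exists O. intros; lia.
    - destruct IH as [M HM]; [intros; apply H1; lia|].
      destruct (H1 N) as [M' HM']; [lia|].
      exists (Nat.max M M'). intros i t Hi Ht. destruct (Nat.eq_dec i N) as [->|HiN].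
      + destruct (HM' t Ht) as [k [Hk Hb]]. exists k. split; [lia|auto].
      + destruct (HM i t) as [k [Hk Hb]]; [lia|auto|]. exists k. split; [lia|auto]. }
  destruct HM as [M HM].
  set (T := fun q => exists i, (i < N)%nat /\
              tri_box n (fun k _ => z i k - s / 3) (fun _ => 2 * s / 3) q).
  assert (HF : finite_cov n (fun y => exists i t, (i < N)%nat /\ unit_cube n t /\
                 forall j, (j < n)%nat -> y j = affine_comb n (y0 i) Y t j) c).
  { apply (in_box_finite_cov n A B M); auto. intros y [i [t [Hi [Ht Hy]]]].
    destruct (HM i t Hi Ht) as [k [Hk Hb]]. exists k. split; auto.
    intros j Hj. rewrite Hy by auto. now apply Hb. }
  assert (HT : finite_cov n T (2 ^ n * c)).
  { apply (finite_cov_double n _ T c a HF). intros q [i [Hi Hq]].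
    exists i, (fun j => (q j - z i j + s / 3) / (2 * s / 3)). split; [auto|]. split.
    - intros j Hj. specialize (Hq j Hj). cbv beta in Hq |- *. split.
      + apply Rmult_le_pos; [lra|]. left. apply Rinv_0_lt_compat. lra.
      + apply Rmult_le_reg_r with (2 * s / 3); [lra|]. unfold Rdiv at 1.
        rewrite Rmult_assoc, Rinv_l; lra.
    - intros j Hj. rewrite Haff by auto. field. lra. }
  destruct HT as [bs [B1 [B2 B3]]].
  assert (HV := tri_box_volume n N (fun i k _ => z i k - s / 3) (fun _ _ => 2 * s / 3) bs).
  cbv beta in HV. rewrite sumR_const, prodR_const in HV.
  eapply Rle_trans; [apply HV|].
  - now intros i _ k q q' _.
  - intros; lra.
  - auto.
  - assert (HS : forall i j q, (i < j < N)%nat ->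
      tri_box n (fun k _ => z i k - s / 3) (fun _ => 2 * s / 3) q ->
      tri_box n (fun k _ => z j k - s / 3) (fun _ => 2 * s / 3) q -> False).
    { intros i j q Hij Hi Hj. destruct (Hsep i j Hij) as [k [Hk Hd]].
      specialize (Hi k Hk). specialize (Hj k Hk). cbv beta in Hi, Hj.
      assert (Rabs (z i k - z j k) <= 2 * s / 3) by (apply Rabs_le; lra). lra. }
    intros i j q Hi Hj Hij Qi Qj.
    destruct (Nat.lt_ge_cases i j); [apply (HS i j q)|apply (HS j i q)]; auto; lia.
  - intros i q Hi Hq. apply B3. now exists i.
  - replace (8 ^ n * c) with (4 ^ n * (2 ^ n * c)).
    + apply Rmult_le_compat_l; auto. apply pow_le; lra.
    + rewrite <- Rmult_assoc, <- Rpow_mult_distr. do 2 f_equal. lra.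
Qed.

Lemma maximal_list (A : Type) (P : list A -> Prop) (b : nat) :
  P nil -> (forall l, P l -> (length l <= b)%nat) ->
  exists l, P l /\ forall y, ~ P (y :: l).
Proof.
  intros H0 Hb.
  assert (H : forall k l, P l -> (b - length l = k)%nat -> exists l, P l /\ forall y, ~ P (y :: l)).
  { induction k as [k IH] using lt_wf_ind. intros l Hl Hk.
    destruct (classic (exists y, P (y :: l))) as [[y Hy]|Hno].
    - apply (IH (b - length (y :: l))%nat) with (y :: l); auto.
      apply Hb in Hy. simpl in *. lia.
    - exists l. split; auto. intros y Hy. apply Hno. now exists y. }
  now apply (H (b - length (@nil A))%nat nil).
Qed.

(** A maximal [s]-separated list is an [s]-net; it exists because the packing bound limits the
    length of separated lists. *)
Lemma separated_net n (K : pt -> Prop) a s c :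
  convex_set K -> (forall y, K y -> supported n y) ->
  0 < s -> contains_cube n K a s -> leb_measure_lt n K c ->
  exists l : list pt, INR (length l) * (2 * s / 3) ^ n <= 8 ^ n * c /\
    forall y, K y -> exists z, In z l /\ forall k, (k < n)%nat -> Rabs (y k - z k) < s.
Proof.
  intros HK Hsup Hs Hcube Hm.
  set (P := fun l : list pt => (forall i, (i < length l)%nat -> K (nth i l zero)) /\
     forall i j, (i < j < length l)%nat -> separated n s (nth i l zero) (nth j l zero)).
  assert (HP : forall l, P l -> INR (length l) * (2 * s / 3) ^ n <= 8 ^ n * c).
  { intros l [P1 P2]. apply (separated_count n K a s c (length l) (fun i => nth i l zero)); auto. }
  assert (Hpos : 0 < (2 * s / 3) ^ n) by (apply pow_lt; lra).
  destruct (archimed (8 ^ n * c / (2 * s / 3) ^ n)) as [Hup _].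
  destruct (maximal_list pt P (Z.to_nat (up (8 ^ n * c / (2 * s / 3) ^ n)))) as [l [Pl Hmax]].
  - split; simpl; intros; lia.
  - intros l Hl. apply HP in Hl.
    assert (INR (length l) <= 8 ^ n * c / (2 * s / 3) ^ n).
    { apply Rmult_le_reg_r with ((2 * s / 3) ^ n); auto. unfold Rdiv at 2.
      rewrite Rmult_assoc, Rinv_l; lra. }
    assert ((Z.of_nat (length l) < up (8 ^ n * c / (2 * s / 3) ^ n))%Z).
    { apply lt_IZR. rewrite <- INR_IZR_INZ. lra. }
    lia.
  - exists l. split; [auto|]. intros y Ky.
    apply NNPP. intros Hno. apply (Hmax y). destruct Pl as [P1 P2]. split.
    + intros [|i] Hi; simpl in *; auto. apply P1. lia.
    + intros [|i] [|j] Hij; simpl in *; try lia.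
      * apply NNPP. intros Hsep. apply Hno. exists (nth j l zero). split; [apply nth_In; lia|].
        intros k Hk. apply Rnot_le_lt. intros Hle. apply Hsep. now exists k.
      * apply P2. lia.
Qed.

(** * Disjoint dual boxes *)

Definition dual_box (n : nat) (u : nat -> pt) (g : nat -> R) (c q : pt) : Prop :=
  forall k, (k < n)%nat -> Rabs (dot n (vsub q c) (u k)) <= g k.

(* In reversed coordinates a dual box is triangular. *)
Lemma dual_box_volume n N (u : nat -> nat -> pt) (g : nat -> nat -> R) (c : nat -> pt) (R0 : R) :
  0 < R0 ->
  (forall i, (i < N)%nat -> unitriangular (u i) n) ->
  (forall i k, (i < N)%nat -> (k < n)%nat -> 0 < g i k) ->
  (forall i j q, (i < N)%nat -> (j < N)%nat -> i <> j ->
     dual_box n (u i) (g i) (c i) q -> dual_box n (u j) (g j) (c j) q -> False) ->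
  (forall i q, (i < N)%nat -> dual_box n (u i) (g i) (c i) q ->
     forall k, (k < n)%nat -> Rabs (q k) <= R0) ->
  sumR N (fun i => prodR n (fun k => 2 * g i k)) <= 4 ^ n * (2 * R0) ^ n.
Proof.
  intros HR Hu Hg Hd Hb.
  set (rev := fun z : pt => (fun j => z (n - 1 - j)%nat) : pt).
  set (al := fun i k (z : pt) => if lt_dec k n then
     z k - dot n (vsub (rev z) (c i)) (u i (n - 1 - k)%nat) - g i (n - 1 - k)%nat else 0).
  assert (Htri : forall i z, tri_box n (al i) (fun k => 2 * g i (n - 1 - k)%nat) z ->
                   dual_box n (u i) (g i) (c i) (rev z)).
  { intros i z Hz k Hk. specialize (Hz (n - 1 - k)%nat ltac:(lia)). unfold al in Hz.
    destruct (lt_dec (n - 1 - k) n); [|lia].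
    replace (n - 1 - (n - 1 - k))%nat with k in Hz by lia. apply Rabs_le. lra. }
  assert (HV := tri_box_volume n N al (fun i k => 2 * g i (n - 1 - k)%nat)
                  (((fun _ => - R0) : pt, (fun _ => R0) : pt) :: nil)).
  eapply Rle_trans; [|eapply Rle_trans; [apply HV|]].
  - apply Req_le, sumR_ext. intros i _. symmetry. apply (prodR_rev n (fun k => 2 * g i k)).
  - intros i Hi k z z' Hzz. unfold al. destruct (lt_dec k n) as [Hk|]; auto.
    (* As [u i] is unitriangular, pairing with its vector of index [n - 1 - k] involves only
       original coordinates from [n - 1 - k] on, with coefficient 1 at the first. After reversal
       these are the coordinates up to [k]. *)
    assert (E : dot n (vsub (rev z) (c i)) (u i (n - 1 - k)%nat) -
                dot n (vsub (rev z') (c i)) (u i (n - 1 - k)%nat) = z k - z' k).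
    { unfold dot.
      transitivity (sumR n (fun j => (rev z j - rev z' j) * u i (n - 1 - k)%nat j)).
      - rewrite (sumR_ext n (fun j => (rev z j - rev z' j) * _) (fun j =>
          vsub (rev z) (c i) j * u i (n - 1 - k)%nat j +
          (-1) * (vsub (rev z') (c i) j * u i (n - 1 - k)%nat j))).
        + rewrite sumR_plus, sumR_scal. lra.
        + intros j _. unfold vsub. ring.
      - destruct (Hu i Hi (n - 1 - k)%nat ltac:(lia)) as [U1 U2].
        rewrite (sumR_single n (n - 1 - k)); [|lia|].
        + rewrite U1. unfold rev. replace (n - 1 - (n - 1 - k))%nat with k by lia. lra.
        + intros j Hj Hjk. destruct (Nat.lt_ge_cases j (n - 1 - k)) as [Hlt|Hge].
          * rewrite U2 by auto. lra.
          * unfold rev. rewrite (Hzz (n - 1 - j)%nat) by lia. lra. }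
    lra.
  - intros i k Hi Hk. specialize (Hg i (n - 1 - k)%nat Hi ltac:(lia)). lra.
  - intros B [<-|[]] i Hi. simpl. lra.
  - intros i j z Hi Hj Hij Zi Zj. apply (Hd i j (rev z)); auto.
  - intros i z Hi Hz. eexists. split; [now left|]. intros k Hk. simpl.
    specialize (Hb i (rev z) Hi (Htri i z Hz) (n - 1 - k)%nat ltac:(lia)).
    unfold rev in Hb. replace (n - 1 - (n - 1 - k))%nat with k in Hb by lia.
    apply Rabs_le_bounds in Hb. lra.
  - apply Req_le. unfold volsum, vol. simpl. rewrite prodR_const, Rplus_0_r. do 2 f_equal. lra.
Qed.

Lemma dot_sumR_r n x (f : nat -> R) (u : nat -> pt) m :
  dot n x (fun j => sumR m (fun k => f k * u k j)) = sumR m (fun k => f k * dot n x (u k)).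
Proof.
  unfold dot.
  rewrite (sumR_ext n _ (fun j => sumR m (fun k => f k * (x j * u k j)))).
  - rewrite sumR_swap. apply sumR_ext. intros k _. apply sumR_scal.
  - intros j _. rewrite <- sumR_scal. apply sumR_ext. intros; ring.
Qed.

(** A crude lower bound for the volume product of a body and its polar. [K] lies in the
    parallelepiped with axes [u k] and half-sides [2 * b k], so half-widths [h / (2 n b k)] keep
    each of the [n] terms of the pairing below [h / n]; the product of [b k] and [2 * g k] is
    [h / n]. *)
Lemma polar_dual_box n (K : pt -> Prop) R0 a s c h :
  (0 < n)%nat -> convex_set K -> K zero ->
  (forall z j, K z -> (j < n)%nat -> Rabs (z j) <= R0) ->
  0 < s -> contains_cube n K a s -> leb_measure_lt n K c -> 0 < h ->
  exists (u : nat -> pt) (g : nat -> R),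
    unitriangular u n /\ (forall k, (k < n)%nat -> 0 < g k) /\
    (forall x0 q z, dual_box n u g x0 q -> K z -> Rabs (dot n (vsub q x0) z) <= h) /\
    (h / INR n) ^ n <= vp_const n * c * prodR n (fun k => 2 * g k).
Proof.
  intros Hn HK H0 HR Hs Hcube Hm Hh.
  destruct (triangular_frame n K R0 a s c) as [u [b [Hu [Hb [Hf HP]]]]]; auto.
  assert (HnR : 0 < INR n) by now apply lt_0_INR.
  exists u, (fun k => h / (2 * INR n * b k)). split; [auto|]. split; [|split].
  - intros k Hk. specialize (Hb k Hk). apply Rdiv_lt_0_compat; [auto|].
    apply Rmult_lt_0_compat; lra.
  - intros x0 q z Hq Kz. destruct (Hf z Kz) as [f [F1 F2]].
    replace (dot n (vsub q x0) z) with (sumR n (fun k => f k * dot n (vsub q x0) (u k))).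
    + eapply Rle_trans; [apply sumR_Rabs|].
      apply Rle_trans with (sumR n (fun _ => h / INR n)).
      * apply sumR_le. intros k Hk. rewrite Rabs_mult. specialize (Hb k Hk).
        replace (h / INR n) with (2 * b k * (h / (2 * INR n * b k))) by (field; lra).
        apply Rmult_le_compat; auto using Rabs_pos.
      * rewrite sumR_const. apply Req_le. field. lra.
    + rewrite <- dot_sumR_r. unfold dot. apply sumR_ext. intros j Hj. now rewrite F2.
  - assert (Hpb : 0 < prodR n b) by now apply prodR_pos.
    assert (E : (h / INR n) ^ n = prodR n b * prodR n (fun k => 2 * (h / (2 * INR n * b k)))).
    { rewrite <- prodR_mult, <- prodR_const. apply prodR_ext. intros k Hk.
      specialize (Hb k Hk). field. lra. }
    rewrite E. apply Rmult_le_compat_r; auto. left. apply prodR_pos.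
    intros k Hk. specialize (Hb k Hk).
    apply Rmult_lt_0_compat; [lra|]. apply Rdiv_lt_0_compat; [auto|].
    apply Rmult_lt_0_compat; lra.
Qed.


(** * Extreme linear minorants of a sublinear functional *)

Definition vadd (x y : pt) : pt := fun i => x i + y i.
Definition vscal (c : R) (x : pt) : pt := fun i => c * x i.
Definition basis (k : nat) : pt := fun i => if Nat.eq_dec i k then 1 else 0.

Definition sublinear (phi : pt -> R) : Prop :=
  (forall c d, 0 < c -> phi (vscal c d) = c * phi d) /\
  (forall d d', phi (vadd d d') <= phi d + phi d').

Definition linear_along (phi : pt -> R) (e : pt) (c : R) : Prop :=
  forall d s, phi (vadd d (vscal s e)) = phi d + s * c.

Ltac pt_ext := apply functional_extensionality; intros ?; unfold vadd, vscal, vsub, zero; try ring.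

Lemma sublinear_zero phi : sublinear phi -> phi zero = 0.
Proof.
  intros [H _]. assert (E := H 2 zero ltac:(lra)).
  replace (vscal 2 zero) with zero in E by pt_ext. lra.
Qed.

Lemma glb_exists (E : R -> Prop) (m : R) :
  (exists r, E r) -> (forall r, E r -> m <= r) ->
  exists g, (forall r, E r -> g <= r) /\ (forall eta, 0 < eta -> exists r, E r /\ r < g + eta).
Proof.
  intros [r0 Hr0] Hm.
  destruct (completeness (fun r => E (- r))) as [s [S1 S2]].
  - exists (- m). intros r Hr. apply Hm in Hr. lra.
  - exists (- r0). now rewrite Ropp_involutive.
  - exists (- s). split.
    + intros r Hr. specialize (S1 (- r)). cbv beta in S1. rewrite Ropp_involutive in S1. apply S1 in Hr. lra.
    + intros eta He. apply NNPP. intros Hno.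
      assert (s <= s - eta); [|lra]. apply S2. intros r Hr.
      destruct (Rle_dec r (s - eta)); auto. exfalso. apply Hno. exists (- r). split; [auto|lra].
Qed.

(* The functional [phi' d = inf_T (phi (d + T e) - T phi e)] is the support function of the face
   of maximal [e]-slope. *)
Lemma sublinear_face phi e : sublinear phi ->
  exists phi' : pt -> R,
    sublinear phi' /\ (forall d, phi' d <= phi d) /\ linear_along phi' e (phi e) /\
    (forall e' c, linear_along phi e' c -> linear_along phi' e' c) /\
    (forall d eta, 0 < eta -> exists T0, 0 <= T0 /\ forall T, T0 <= T ->
       phi (vadd d (vscal T e)) <= phi' d + T * phi e + eta).
Proof.
  intros Hphi. destruct (Hphi) as [Hh Hs]. assert (H0 := sublinear_zero _ Hphi).
  set (q := fun d T => phi (vadd d (vscal T e)) - T * phi e).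
  assert (Hsc : forall T, 0 <= T -> phi (vscal T e) = T * phi e).
  { intros T [HT|<-]; auto. replace (vscal 0 e) with zero by pt_ext. lra. }
  (* By subadditivity [q d] is nonincreasing in [T], and [Hlow] bounds it from below: the infimum is
     a limit at infinity. *)
  assert (Hmono : forall d T T', T <= T' -> q d T' <= q d T).
  { intros d T T' HT. unfold q.
    replace (vadd d (vscal T' e)) with (vadd (vadd d (vscal T e)) (vscal (T' - T) e)) by pt_ext.
    eapply Rle_trans with (phi (vadd d (vscal T e)) + phi (vscal (T' - T) e) - T' * phi e).
    - apply Rplus_le_compat_r, Hs.
    - rewrite Hsc; lra. }
  assert (Hlow : forall d T, 0 <= T -> - phi (vscal (-1) d) <= q d T).
  { intros d T HT. unfold q.
    assert (E := Hs (vadd d (vscal T e)) (vscal (-1) d)).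
    replace (vadd (vadd d (vscal T e)) (vscal (-1) d)) with (vscal T e) in E by pt_ext.
    rewrite Hsc in E by auto. lra. }
  assert (CH : forall d, exists g, (forall T, 0 <= T -> g <= q d T) /\
     (forall eta, 0 < eta -> exists T, 0 <= T /\ q d T < g + eta)).
  { intros d. destruct (glb_exists (fun r => exists T, 0 <= T /\ r = q d T) (- phi (vscal (-1) d)))
      as [g [G1 G2]].
    - exists (q d 0), 0. split; [lra|auto].
    - intros r [T [HT ->]]. auto.
    - exists g. split.
      + intros T HT. apply G1. now exists T.
      + intros eta He. destruct (G2 eta He) as [r [[T [HT ->]] Hr]]. now exists T. }
  set (phi' := fun d => proj1_sig (constructive_indefinite_description _ (CH d))).
  assert (P1 : forall d T, 0 <= T -> phi' d <= q d T).
  { intros d. unfold phi'. destruct (constructive_indefinite_description _ (CH d)) as [g [G1 G2]]; auto. }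
  assert (P2 : forall d eta, 0 < eta -> exists T, 0 <= T /\ q d T < phi' d + eta).
  { intros d. unfold phi'. destruct (constructive_indefinite_description _ (CH d)) as [g [G1 G2]]; auto. }
  (* By monotonicity a lower bound at arbitrarily large [T] is enough, so a shift of [T] by a
     constant is harmless. *)
  assert (P3 : forall d m, (forall T, 0 <= T -> exists T', T <= T' /\ m <= q d T') -> m <= phi' d).
  { intros d m Hm. apply Rnot_lt_le. intros Hlt.
    destruct (P2 d (m - phi' d)) as [T [HT HqT]]; [lra|].
    destruct (Hm T HT) as [T' [HT' Hle]]. assert (E := Hmono d T T' HT'). lra. }
  exists phi'. split; [|split; [|split; [|split]]].
  - split.
    + assert (Hle : forall c d, 0 < c -> c * phi' d <= phi' (vscal c d)).
      { intros c d Hc. apply P3. intros T HT. exists T. split; [lra|].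
        replace (q (vscal c d) T) with (c * q d (T / c)).
        - apply Rmult_le_compat_l; [lra|]. apply P1. apply Rmult_le_pos; [auto|].
          left. now apply Rinv_0_lt_compat.
        - unfold q. replace (vadd (vscal c d) (vscal T e)) with (vscal c (vadd d (vscal (T / c) e))).
          + rewrite Hh by auto. field. lra.
          + pt_ext. field. lra. }
      intros c d Hc. apply Rle_antisym; [|auto].
      assert (Hi : 0 < / c) by now apply Rinv_0_lt_compat.
      assert (E := Hle (/ c) (vscal c d) Hi).
      replace (vscal (/ c) (vscal c d)) with d in E by (pt_ext; field; lra).
      apply Rmult_le_reg_l with (/ c); auto. rewrite <- Rmult_assoc, Rinv_l; lra.
    + intros d d'. apply le_epsilon. intros eta He.
      destruct (P2 d (eta / 2)) as [T [HT H1]]; [lra|].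
      destruct (P2 d' (eta / 2)) as [T' [HT' H1']]; [lra|].
      assert (E := P1 (vadd d d') (T + T') ltac:(lra)).
      assert (E' : q (vadd d d') (T + T') <= q d T + q d' T').
      { unfold q. assert (G := Hs (vadd d (vscal T e)) (vadd d' (vscal T' e))).
        replace (vadd (vadd d (vscal T e)) (vadd d' (vscal T' e)))
          with (vadd (vadd d d') (vscal (T + T') e)) in G by pt_ext.
        lra. }
      lra.
  - intros d. assert (E := P1 d 0 ltac:(lra)). unfold q in E.
    replace (vadd d (vscal 0 e)) with d in E by pt_ext. lra.
  - intros d s.
    assert (Hq : forall d s T, q (vadd d (vscal s e)) T = q d (T + s) + s * phi e).
    { intros d0 s0 T. unfold q.
      replace (vadd (vadd d0 (vscal s0 e)) (vscal T e)) with (vadd d0 (vscal (T + s0) e)) by pt_ext.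
      ring. }
    apply Rle_antisym.
    + apply Rle_trans with ((phi' (vadd d (vscal s e)) - s * phi e) + s * phi e); [lra|].
      apply Rplus_le_compat_r. apply P3. intros T HT.
      exists (T + Rabs s). split; [generalize (Rabs_pos s); lra|].
      assert (0 <= T + Rabs s - s) by (generalize (Rle_abs s); lra).
      assert (E := P1 (vadd d (vscal s e)) (T + Rabs s - s) H). rewrite Hq in E.
      replace (T + Rabs s - s + s) with (T + Rabs s) in E by ring. lra.
    + apply P3. intros T HT. exists (T + Rabs s). split; [generalize (Rabs_pos s); lra|].
      rewrite Hq. apply Rplus_le_compat_r. apply P1.
      assert (- s <= Rabs s) by (rewrite <- Rabs_Ropp; apply Rle_abs). lra.
  - intros e' c Hl d s.
    assert (Hq : forall d s T, q (vadd d (vscal s e')) T = q d T + s * c).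
    { intros d0 s0 T. unfold q.
      replace (vadd (vadd d0 (vscal s0 e')) (vscal T e))
        with (vadd (vadd d0 (vscal T e)) (vscal s0 e')) by pt_ext.
      rewrite Hl. ring. }
    apply Rle_antisym.
    + apply Rle_trans with ((phi' (vadd d (vscal s e')) - s * c) + s * c); [lra|].
      apply Rplus_le_compat_r. apply P3. intros T HT. exists T. split; [lra|].
      assert (E := P1 (vadd d (vscal s e')) T HT). rewrite Hq in E. lra.
    + apply P3. intros T HT. exists T. split; [lra|]. rewrite Hq.
      apply Rplus_le_compat_r. auto.
  - intros d eta He. destruct (P2 d eta He) as [T0 [HT0 H1]].
    exists T0. split; auto. intros T HT. assert (E := Hmono d T0 T HT). unfold q in E, H1. lra.
Qed.

(** Faces are taken successively along the basis vectors. In the last clause [D] is built backwards: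
    a large multiple of the newest basis vector is fixed first, and the earlier directions are then
    handled for the translated list. The number [lam] is the common effect of [D] on all functionals
    with the prescribed slopes, so it cancels in comparisons. *)
Lemma sublinear_faces phi : sublinear phi -> forall k, exists (phi' : pt -> R) (p : nat -> R),
  sublinear phi' /\ (forall d, phi' d <= phi d) /\
  (forall i, (i < k)%nat -> linear_along phi' (basis i) (p i)) /\
  (forall (W : list pt) eta, 0 < eta -> exists D lam, supported k D /\
     (forall psi, (forall i, (i < k)%nat -> linear_along psi (basis i) (p i)) ->
        forall d, psi (vadd d D) = psi d + lam) /\
     forall w, In w W -> phi (vadd w D) <= phi' (vadd w D) + eta).
Proof.
  intros Hphi. induction k as [|k IH].
  - exists phi, (fun _ => 0). split; [auto|]. split; [intros; lra|]. split; [intros; lia|].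
    intros W eta He. exists zero, 0. split; [now intros i _|]. split.
    + intros psi _ d. replace (vadd d zero) with d by pt_ext. lra.
    + intros w _. lra.
  - destruct IH as [f [p [F1 [F2 [F3 F4]]]]].
    destruct (sublinear_face f (basis k) F1) as [f' [G1 [G2 [G3 [G4 G5]]]]].
    set (p' := fun i => if Nat.eq_dec i k then f (basis k) else p i).
    assert (Pk : p' k = f (basis k)) by (unfold p'; now destruct (Nat.eq_dec k k)).
    assert (Pi : forall i, (i < k)%nat -> p' i = p i)
      by (intros i Hi; unfold p'; destruct (Nat.eq_dec i k); [lia|auto]).
    exists f', p'. split; [auto|]. split; [intros d; eapply Rle_trans; [apply G2|apply F2]|].
    split.
    { intros i Hi. destruct (Nat.eq_dec i k) as [->|Hik].
      - now rewrite Pk.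
      - rewrite Pi by lia. apply G4, F3. lia. }
    intros W eta He.
    assert (HT : exists T, 0 <= T /\ forall w, In w W ->
              f (vadd w (vscal T (basis k))) <= f' w + T * f (basis k) + eta / 2).
    { assert (HT0 : exists T0, 0 <= T0 /\ forall T w, T0 <= T -> In w W ->
              f (vadd w (vscal T (basis k))) <= f' w + T * f (basis k) + eta / 2).
      { clear - G5 He. induction W as [|w W IH].
        - exists 0. split; [lra|easy].
        - destruct IH as [T1 [HT1 H1]]. destruct (G5 w (eta / 2)) as [T2 [HT2 H2]]; [lra|].
          exists (T1 + T2). split; [lra|]. intros T w' HT [<-|Hw'].
          + apply H2. lra.
          + apply H1; [lra|auto]. }
      destruct HT0 as [T0 [HT0 H1]]. exists T0. split; auto. intros w Hw. apply H1; [lra|auto]. }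
    destruct HT as [T [HT HTW]].
    (* Each of the two passages, from [phi] to [f] and from [f] to [f'], is allowed an error
       [eta / 2]. *)
    destruct (F4 (map (fun w => vadd w (vscal T (basis k))) W) (eta / 2)) as [D [lam [D1 [D2 D3]]]];
      [lra|].
    exists (vadd (vscal T (basis k)) D), (T * f (basis k) + lam). split; [|split].
    + intros i Hi. unfold vadd, vscal, basis. rewrite (D1 i) by lia.
      destruct (Nat.eq_dec i k); [lia|lra].
    + intros psi Hpsi d.
      replace (vadd d (vadd (vscal T (basis k)) D)) with (vadd (vadd d (vscal T (basis k))) D) by pt_ext.
      rewrite D2.
      * rewrite (Hpsi k) by lia. rewrite Pk. ring.
      * intros i Hi. rewrite <- Pi by auto. apply Hpsi. lia.
    + intros w Hw.
      replace (vadd w (vadd (vscal T (basis k)) D)) with (vadd (vadd w (vscal T (basis k))) D) by pt_ext.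
      assert (A := D3 _ (in_map (fun w => vadd w (vscal T (basis k))) W w Hw)).
      rewrite (D2 f F3) in A.
      rewrite (D2 f') by (intros i Hi; apply G4, F3; lia).
      rewrite G3. specialize (HTW w Hw). lra.
Qed.

Definition trunc (n : nat) (d : pt) : pt := fun i => if lt_dec i n then d i else 0.

Lemma linear_along_all n psi p :
  sublinear psi -> (forall i, (i < n)%nat -> linear_along psi (basis i) (p i)) ->
  forall d, supported n d -> psi d = dot n p d.
Proof.
  intros Hs Hl.
  assert (H : forall k d, (k <= n)%nat -> supported k d -> psi d = dot k p d).
  { induction k as [|k IH]; intros d Hk Hd.
    - replace d with zero; [now apply sublinear_zero|].
      apply functional_extensionality. intros i. symmetry. apply Hd. lia.
    - replace d with (vadd (trunc k d) (vscal (d k) (basis k))).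
      + rewrite Hl by lia. rewrite IH.
        * unfold dot. simpl. f_equal.
          -- apply sumR_ext. intros i Hi. unfold trunc, vadd, vscal, basis.
             destruct (lt_dec i k); [|lia]. destruct (Nat.eq_dec i k); [lia|]. ring.
          -- unfold trunc, vadd, vscal, basis. destruct (lt_dec k k); [lia|].
             destruct (Nat.eq_dec k k); [ring|lia].
        * lia.
        * intros i Hi. unfold trunc. destruct (lt_dec i k); [lia|auto].
      + apply functional_extensionality. intros i. unfold trunc, vadd, vscal, basis.
        destruct (lt_dec i k); destruct (Nat.eq_dec i k) as [->|]; try lia; try ring.
        rewrite (Hd i) by lia. ring. }
  intros d Hd. now apply H.
Qed.

(** After [n] faces the functional is linear on [R^n]. Its slope [p] is the lexicographically
    largest one below [phi], hence an extreme point; the last clause is the form in which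
    extremality is used. *)
Lemma extreme_minorant n phi : sublinear phi ->
  exists p, supported n p /\ (forall d, supported n d -> dot n p d <= phi d) /\
    forall (W : list pt) eta, 0 < eta -> (forall w, In w W -> supported n w) ->
      exists D, supported n D /\ forall w, In w W -> phi (vadd w D) <= dot n p (vadd w D) + eta.
Proof.
  intros Hphi. destruct (sublinear_faces phi Hphi n) as [f [p [F1 [F2 [F3 F4]]]]].
  assert (Hf : forall d, supported n d -> f d = dot n (trunc n p) d).
  { intros d Hd. rewrite (linear_along_all n f p F1 F3 d Hd). unfold dot.
    apply sumR_ext. intros i Hi. unfold trunc. now destruct (lt_dec i n). }
  exists (trunc n p). split; [|split].
  - intros i Hi. unfold trunc. destruct (lt_dec i n); [lia|auto].
  - intros d Hd. rewrite <- Hf by auto. apply F2.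
  - intros W eta He HW. destruct (F4 W eta He) as [D [lam [D1 [_ D3]]]].
    exists D. split; auto. intros w Hw. rewrite <- Hf; auto.
    intros i Hi. unfold vadd. rewrite (HW w Hw i Hi), (D1 i Hi). lra.
Qed.


(** * Extreme subgradients *)

Lemma B1_comb n y z t : B1 n y -> B1 n z -> 0 <= t <= 1 -> B1 n (comb t y z).
Proof.
  intros [Y1 Y2] [Z1 Z2] Ht. split.
  - apply Rle_lt_trans with (t * sumR n (fun i => y i ^ 2) + (1 - t) * sumR n (fun i => z i ^ 2)).
    + rewrite <- !sumR_scal, <- sumR_plus. apply sumR_le. intros i _. unfold comb.
      assert (0 <= t * (1 - t) * (y i - z i) ^ 2).
      { apply Rmult_le_pos; [nra|apply pow2_ge_0]. }
      replace ((t * y i + (1 - t) * z i) ^ 2)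
        with (t * y i ^ 2 + (1 - t) * z i ^ 2 - t * (1 - t) * (y i - z i) ^ 2) by ring.
      lra.
    + set (X := sumR n (fun i => y i ^ 2)) in *. set (Y := sumR n (fun i => z i ^ 2)) in *.
      assert (Rmax X Y < 1) by now apply Rmax_lub_lt.
      assert (t * X <= t * Rmax X Y) by (apply Rmult_le_compat_l; [lra|apply Rmax_l]).
      assert ((1 - t) * Y <= (1 - t) * Rmax X Y) by (apply Rmult_le_compat_l; [lra|apply Rmax_r]).
      lra.
  - intros i Hi. unfold comb. rewrite Y2, Z2 by auto. lra.
Qed.

Lemma B1_ray n x d : B1 n x -> supported n d ->
  exists t0, 0 < t0 /\ forall t, 0 <= t <= t0 -> B1 n (vadd x (vscal t d)).
Proof.
  intros [X1 X2] Hd.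
  set (X := sumR n (fun i => x i ^ 2)) in *.
  set (A := sumR n (fun i => 2 * Rabs (x i * d i) + d i ^ 2)).
  assert (HA : 0 <= A).
  { apply sumR_nonneg. intros i _. generalize (Rabs_pos (x i * d i)) (pow2_ge_0 (d i)). lra. }
  exists (Rmin 1 ((1 - X) / (2 * (A + 1)))).
  assert (Hp : 0 < (1 - X) / (2 * (A + 1))) by (apply Rdiv_lt_0_compat; lra).
  split; [apply Rmin_pos; lra|]. intros t [T1 T2].
  assert (t <= 1) by (eapply Rle_trans; [apply T2|apply Rmin_l]).
  assert (T3 : t <= (1 - X) / (2 * (A + 1))) by (eapply Rle_trans; [apply T2|apply Rmin_r]).
  split.
  - apply Rle_lt_trans with (X + t * A).
    + unfold X, A. rewrite <- sumR_scal, <- sumR_plus. apply sumR_le. intros i _.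
      unfold vadd, vscal. generalize (Rle_abs (x i * d i)) (pow2_ge_0 (d i)). intros E1 E2.
      assert (t * t * d i ^ 2 <= t * d i ^ 2) by (apply Rmult_le_compat_r; nra).
      nra.
    + assert (t * (2 * (A + 1)) <= 1 - X).
      { apply Rle_trans with ((1 - X) / (2 * (A + 1)) * (2 * (A + 1))).
        - apply Rmult_le_compat_r; lra.
        - apply Req_le. field. lra. }
      nra.
  - intros i Hi. unfold vadd, vscal. rewrite X2, Hd by auto. lra.
Qed.

Lemma convex_slope_mono n v x d t t' :
  convex_on_B1 n v -> B1 n x -> B1 n (vadd x (vscal t d)) -> 0 < t' <= t ->
  B1 n (vadd x (vscal t' d)) /\
  (v (vadd x (vscal t' d)) - v x) / t' <= (v (vadd x (vscal t d)) - v x) / t.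
Proof.
  intros Hv Hx Ht Htt.
  assert (E : vadd x (vscal t' d) = comb (t' / t) (vadd x (vscal t d)) x).
  { apply functional_extensionality. intros i. unfold comb, vadd, vscal. field. lra. }
  assert (Hq : 0 <= t' / t <= 1).
  { split.
    - apply Rmult_le_pos; [lra|]. left. apply Rinv_0_lt_compat. lra.
    - apply Rmult_le_reg_r with t; [lra|]. unfold Rdiv. rewrite Rmult_assoc, Rinv_l; lra. }
  split.
  - rewrite E. now apply B1_comb.
  - assert (H := Hv _ _ _ Ht Hx Hq). rewrite <- E in H.
    apply Rmult_le_reg_r with t'; [lra|].
    replace ((v (vadd x (vscal t' d)) - v x) / t' * t') with (v (vadd x (vscal t' d)) - v x)
      by (field; lra).
    replace ((v (vadd x (vscal t d)) - v x) / t * t')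
      with (t' / t * (v (vadd x (vscal t d)) - v x)) by (field; lra).
    lra.
Qed.

(** [phi d] is the infimum of the difference quotients along [d], which decrease with the step by
    convexity. The open ball leaves room in the direction [-d], and this bounds the quotients from
    below. *)
Lemma directional_derivative n v x : convex_on_B1 n v -> B1 n x ->
  exists phi : pt -> R, sublinear phi /\
    (forall y, B1 n y -> phi (vsub y x) <= v y - v x) /\
    (forall d eta, supported n d -> 0 < eta -> exists t0, 0 < t0 /\ forall t, 0 < t <= t0 ->
       B1 n (vadd x (vscal t d)) /\ v (vadd x (vscal t d)) <= v x + t * (phi d + eta)).
Proof.
  intros Hv Hx.
  (* Truncating [d] keeps [X d t] in [R^n] for every sequence [d], so that [phi] is sublinear on all
     of [pt]. *)
  set (X := fun d t => vadd x (vscal t (trunc n d))).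
  set (q := fun d t => (v (X d t) - v x) / t).
  assert (Hsup : forall d, supported n (trunc n d)).
  { intros d i Hi. unfold trunc. destruct (lt_dec i n); [lia|auto]. }
  assert (Hmono : forall d t t', B1 n (X d t) -> 0 < t' <= t -> B1 n (X d t') /\ q d t' <= q d t).
  { intros d t t' H1 H2. now apply convex_slope_mono. }
  assert (Hex : forall d, exists t0, 0 < t0 /\ forall t, 0 <= t <= t0 -> B1 n (X d t)).
  { intros d. apply B1_ray; auto. }
  (* [X (d + d') t] is the midpoint of [X d (2 t)] and [X d' (2 t)]. With [d' = -d] this bounds the
     quotients below; for general [d'] it gives subadditivity. *)
  assert (Hmid : forall d d' t, 0 < t -> B1 n (X d (2 * t)) -> B1 n (X d' (2 * t)) ->
            B1 n (X (vadd d d') t) /\ q (vadd d d') t <= q d (2 * t) + q d' (2 * t)).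
  { intros d d' t Ht H1 H2.
    assert (E : X (vadd d d') t = comb (/ 2) (X d (2 * t)) (X d' (2 * t))).
    { apply functional_extensionality. intros i. unfold X, comb, vadd, vscal, trunc.
      destruct (lt_dec i n); field. }
    split; [rewrite E; apply B1_comb; auto; lra|].
    assert (H := Hv _ _ (/ 2) H1 H2 ltac:(lra)). rewrite <- E in H. unfold q.
    apply Rmult_le_reg_r with t; [lra|].
    replace ((v (X (vadd d d') t) - v x) / t * t) with (v (X (vadd d d') t) - v x) by (field; lra).
    replace (((v (X d (2 * t)) - v x) / (2 * t) + (v (X d' (2 * t)) - v x) / (2 * t)) * t)
      with (/ 2 * (v (X d (2 * t)) - v x) + / 2 * (v (X d' (2 * t)) - v x)) by (field; lra).
    lra. }
  assert (CH : forall d, exists g, (forall t, 0 < t -> B1 n (X d t) -> g <= q d t) /\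
     (forall eta, 0 < eta -> exists t, 0 < t /\ B1 n (X d t) /\ q d t < g + eta)).
  { intros d. destruct (Hex d) as [t0 [Ht0 H0]].
    destruct (Hex (vscal (-1) d)) as [t1 [Ht1 H1]].
    destruct (glb_exists (fun r => exists t, 0 < t /\ B1 n (X d t) /\ r = q d t)
                (- q (vscal (-1) d) t1)) as [g [G1 G2]].
    - exists (q d t0), t0. split; [auto|]. split; [apply H0; lra|auto].
    - intros r [t [Ht [Bt ->]]].
      set (s := Rmin t t1 / 2).
      assert (Hmin : 0 < Rmin t t1) by now apply Rmin_pos.
      assert (Hs : 0 < s) by (unfold s; lra).
      assert (Hs1 : 2 * s <= t) by (unfold s; generalize (Rmin_l t t1); lra).
      assert (Hs2 : 2 * s <= t1) by (unfold s; generalize (Rmin_r t t1); lra).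
      destruct (Hmono d t (2 * s) Bt ltac:(lra)) as [A1 A2].
      destruct (Hmono (vscal (-1) d) t1 (2 * s) ltac:(apply H1; lra) ltac:(lra)) as [A3 A4].
      destruct (Hmid d (vscal (-1) d) s Hs A1 A3) as [_ A5].
      assert (E : X (vadd d (vscal (-1) d)) s = x).
      { apply functional_extensionality. intros i. unfold X, vadd, vscal, trunc.
        destruct (lt_dec i n); ring. }
      unfold q at 1 in A5. rewrite E in A5.
      replace ((v x - v x) / s) with 0 in A5 by (field; lra). lra.
    - exists g. split.
      + intros t Ht Bt. apply G1. now exists t.
      + intros eta He. destruct (G2 eta He) as [r [[t [Ht [Bt ->]]] Hr]]. now exists t. }
  set (phi := fun d => proj1_sig (constructive_indefinite_description _ (CH d))).
  assert (P1 : forall d t, 0 < t -> B1 n (X d t) -> phi d <= q d t).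
  { intros d. unfold phi. destruct (constructive_indefinite_description _ (CH d)) as [g [G1 G2]]; auto. }
  assert (P2 : forall d eta, 0 < eta -> exists t, 0 < t /\ B1 n (X d t) /\ q d t < phi d + eta).
  { intros d. unfold phi. destruct (constructive_indefinite_description _ (CH d)) as [g [G1 G2]]; auto. }
  exists phi. split; [split|split].
  - assert (Hle : forall c d, 0 < c -> c * phi d <= phi (vscal c d)).
    { intros c d Hc. apply le_epsilon. intros eta He.
      destruct (P2 (vscal c d) eta He) as [t [Ht [Bt Hq]]].
      assert (E : X (vscal c d) t = X d (c * t)).
      { apply functional_extensionality. intros i. unfold X, vadd, vscal, trunc.
        destruct (lt_dec i n); ring. }
      rewrite E in Bt. assert (Hct : 0 < c * t) by now apply Rmult_lt_0_compat.
      assert (A := P1 d (c * t) Hct Bt).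
      assert (E2 : q (vscal c d) t = c * q d (c * t)) by (unfold q; rewrite E; field; lra).
      assert (c * phi d <= c * q d (c * t)) by (apply Rmult_le_compat_l; lra). lra. }
    intros c d Hc. apply Rle_antisym; [|auto].
    assert (Hi : 0 < / c) by now apply Rinv_0_lt_compat.
    assert (E := Hle (/ c) (vscal c d) Hi).
    replace (vscal (/ c) (vscal c d)) with d in E by (pt_ext; field; lra).
    apply Rmult_le_reg_l with (/ c); auto. rewrite <- Rmult_assoc, Rinv_l; lra.
  - intros d d'. apply le_epsilon. intros eta He.
    destruct (P2 d (eta / 2)) as [t [Ht [Bt Hq]]]; [lra|].
    destruct (P2 d' (eta / 2)) as [t' [Ht' [Bt' Hq']]]; [lra|].
    set (s := Rmin t t' / 2).
    assert (Hmin : 0 < Rmin t t') by now apply Rmin_pos.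
    assert (Hs : 0 < s) by (unfold s; lra).
    assert (Hs1 : 2 * s <= t) by (unfold s; generalize (Rmin_l t t'); lra).
    assert (Hs2 : 2 * s <= t') by (unfold s; generalize (Rmin_r t t'); lra).
    destruct (Hmono d t (2 * s) Bt ltac:(lra)) as [A1 A2].
    destruct (Hmono d' t' (2 * s) Bt' ltac:(lra)) as [A3 A4].
    destruct (Hmid d d' s Hs A1 A3) as [A5 A6].
    assert (A7 := P1 _ _ Hs A5). lra.
  - intros y Hy.
    assert (E : X (vsub y x) 1 = y).
    { apply functional_extensionality. intros i. unfold X, vadd, vscal, trunc, vsub.
      destruct (lt_dec i n); [ring|]. destruct Hy as [_ Hy], Hx as [_ Hx].
      rewrite Hy, Hx by lia. ring. }
    assert (A := P1 (vsub y x) 1 ltac:(lra)). unfold q in A. rewrite E in A.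
    specialize (A Hy). lra.
  - intros d eta Hd He. destruct (P2 d eta He) as [t0 [Ht0 [Bt0 Hq0]]].
    assert (Ed : trunc n d = d).
    { apply functional_extensionality. intros i. unfold trunc. destruct (lt_dec i n); auto.
      symmetry. apply Hd. lia. }
    exists t0. split; auto. intros t Ht. destruct (Hmono d t0 t Bt0 Ht) as [A1 A2].
    unfold q, X in *. rewrite Ed in *. split; auto.
    assert (A3 : (v (vadd x (vscal t d)) - v x) / t <= phi d + eta) by lra.
    assert (A4 : (v (vadd x (vscal t d)) - v x) / t * t <= (phi d + eta) * t)
      by (apply Rmult_le_compat_r; lra).
    replace ((v (vadd x (vscal t d)) - v x) / t * t) with (v (vadd x (vscal t d)) - v x) in A4
      by (field; lra).
    lra.
Qed.

(* The last clause expresses that [p] is an extreme point of the subdifferential: an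
   arbitrarily large ball [D + W] of directions is almost flat for [v - p]. *)
Definition extreme_subgradient (n : nat) (v : pt -> R) (x p : pt) : Prop :=
  subgradient n v x p /\
  forall (W : list pt) eta, 0 < eta -> (forall w, In w W -> supported n w) ->
    exists D t0, supported n D /\ 0 < t0 /\ forall t w, 0 < t <= t0 -> In w W ->
      B1 n (vadd x (vscal t (vadd w D))) /\
      v (vadd x (vscal t (vadd w D))) <= v x + t * (dot n p (vadd w D) + eta).

Lemma extreme_subgradient_exists n v x :
  convex_on_B1 n v -> B1 n x -> exists p, extreme_subgradient n v x p.
Proof.
  intros Hv Hx.
  destruct (directional_derivative n v x Hv Hx) as [phi [H1 [H2 H3]]].
  destruct (extreme_minorant n phi H1) as [p [P1 [P2 P3]]].
  exists p. split; [split|].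
  - exact P1.
  - intros y Hy. specialize (H2 y Hy).
    assert (dot n p (vsub y x) <= phi (vsub y x)); [|lra].
    apply P2. intros i Hi. unfold vsub. destruct Hx as [_ Hx], Hy as [_ Hy].
    rewrite Hx, Hy by auto. lra.
  (* One half of [eta] is for replacing [phi] by [p] on [D + W], the other for replacing [v] by its
     directional derivative. *)
  - intros W eta He HW. destruct (P3 W (eta / 2) ltac:(lra) HW) as [D [D1 D2]].
    exists D.
    assert (HT : exists t0, 0 < t0 /\ forall t w, 0 < t <= t0 -> In w W ->
      B1 n (vadd x (vscal t (vadd w D))) /\
      v (vadd x (vscal t (vadd w D))) <= v x + t * (dot n p (vadd w D) + eta)).
    { clear P3. induction W as [|w W IH].
      - exists 1. split; [lra|easy].
      - destruct IH as [t1 [T1 T1']]; [intros; apply HW; now right|intros; apply D2; now right|].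
        destruct (H3 (vadd w D) (eta / 2)) as [t2 [T2 T2']]; [|lra|].
        { intros i Hi. unfold vadd. rewrite (HW w (or_introl eq_refl) i Hi), (D1 i Hi). lra. }
        exists (Rmin t1 t2). split; [now apply Rmin_pos|].
        intros t w' Ht [<-|Hw'].
        + destruct (T2' t) as [A1 A2]; [generalize (Rmin_r t1 t2); lra|]. split; auto.
          assert (A3 := D2 w (or_introl eq_refl)).
          assert (t * (phi (vadd w D) + eta / 2) <= t * (dot n p (vadd w D) + eta))
            by (apply Rmult_le_compat_l; lra).
          lra.
        + apply T1'; [generalize (Rmin_l t1 t2); lra|auto]. }
    destruct HT as [t0 [T1 T2]]. now exists t0.
Qed.


(** * Hausdorff content *)

(** Hausdorff content with bounded partial sums in place of a convergent series, so that covers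
    combine without limits. A weight may be 0 on an empty set: for [s = 0] any power is 1, even
    [0 ^ 0], and idle members of the sequence must stay free of charge. *)
Definition hcov (n s : nat) (delta : R) (E : pt -> Prop) (c : R) : Prop :=
  exists (U : nat -> pt -> Prop) (d e : nat -> R),
    (forall k, 0 <= d k < delta) /\
    (forall k y z, U k y -> U k z -> dist n y z <= d k) /\
    (forall k, (exists y, U k y) -> e k = d k ^ s) /\
    (forall k, e k = 0 \/ e k = d k ^ s) /\
    (forall N, sumR N e <= c) /\
    (forall y, E y -> exists k, U k y).

Lemma hausdorff_null_of_hcov n s E :
  (forall delta eps, 0 < delta -> 0 < eps -> hcov n s delta E eps) -> hausdorff_null n s E.
Proof.
  intros H delta eps Hd He.
  destruct (H delta (eps / 2) Hd ltac:(lra)) as [U [d [e [H1 [H2 [H3 [H4 [H5 H6]]]]]]]].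
  assert (Hpos : forall k, 0 <= e k).
  { intros k. destruct (H4 k) as [->| ->]; [lra|]. apply pow_le, H1. }
  assert (Hg : Un_growing (fun N => sum_f_R0 e N)).
  { intros N. simpl. specialize (Hpos (S N)). lra. }
  destruct (growing_cv (fun N => sum_f_R0 e N) Hg) as [l Hl].
  { exists (eps / 2). intros r [N ->]. rewrite <- sumR_sum_f_R0. apply H5. }
  exists U, d, e, l. repeat split; auto; try apply H1.
  apply Rle_lt_trans with (eps / 2); [|lra].
  apply Rnot_lt_le. intros Hlt.
  destruct (Hl (l - eps / 2)) as [N HN]; [lra|].
  specialize (HN N (le_n N)). unfold Rdist in HN.
  assert (E1 := H5 (S N)). rewrite sumR_sum_f_R0 in E1.
  apply Rabs_def2 in HN. lra.
Qed.

Lemma hcov_mono n s delta (E E' : pt -> Prop) c c' :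
  (forall y, E' y -> E y) -> c <= c' -> hcov n s delta E c -> hcov n s delta E' c'.
Proof.
  intros HE Hc [U [d [e [H1 [H2 [H3 [H4 [H5 H6]]]]]]]]. exists U, d, e.
  repeat split; auto; try apply H1. intros N. specialize (H5 N). lra.
Qed.

Lemma hcov_empty n s delta (E : pt -> Prop) : 0 < delta -> (forall y, ~ E y) -> hcov n s delta E 0.
Proof.
  intros Hd HE. exists (fun _ _ => False), (fun _ => 0), (fun _ => 0).
  split; [intros; lra|]. split; [easy|]. split; [now intros k [y Hy]|].
  split; [now left|]. split; [intros; rewrite sumR_const; lra|].
  intros y Hy. now apply HE in Hy.
Qed.

Lemma hcov_single n s delta (E : pt -> Prop) d :
  0 <= d < delta -> (forall y z, E y -> E z -> dist n y z <= d) -> hcov n s delta E (d ^ s).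
Proof.
  intros Hd HE.
  exists (fun k y => k = O /\ E y), (fun _ => d), (fun k => if Nat.eq_dec k O then d ^ s else 0).
  split; [auto|]. split; [intros k y z [_ Hy] [_ Hz]; auto|].
  split; [intros k [y [-> _]]; reflexivity|].
  split; [intros k; destruct (Nat.eq_dec k 0); auto|]. split.
  - intros [|N].
    + simpl. apply pow_le. lra.
    + rewrite (sumR_single (S N) O); [simpl; lra|lia|].
      intros i _ Hi. now destruct (Nat.eq_dec i 0).
  - intros y Hy. now exists O.
Qed.

(** The pairs with code below [N] lie in the square of side [N], because a code is at least as large
    as both components. *)
Lemma sumR_cantor_le (e : nat -> nat -> R) N :
  (forall i j, 0 <= e i j) ->
  sumR N (fun m => e (fst (Cantor.of_nat m)) (snd (Cantor.of_nat m))) <=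
  sumR N (fun i => sumR N (e i)).
Proof.
  intros He.
  set (ind := fun m i j : nat => if Nat.eq_dec m (Cantor.to_nat (i, j)) then e i j else 0).
  assert (Hle : forall m, let (i, j) := Cantor.of_nat m in (i <= m /\ j <= m)%nat).
  { intros m. assert (E := Cantor.cancel_to_of m). destruct (Cantor.of_nat m) as [i j].
    assert (G := Cantor.to_nat_non_decreasing i j). lia. }
  rewrite (sumR_ext N _ (fun m => sumR N (fun i => sumR N (fun j => ind m i j)))).
  - rewrite sumR_swap. apply sumR_le. intros i Hi.
    rewrite sumR_swap. apply sumR_le. intros j Hj.
    destruct (Nat.lt_ge_cases (Cantor.to_nat (i, j)) N) as [Hlt|Hge].
    + rewrite (sumR_single N (Cantor.to_nat (i, j))); auto.
      * unfold ind. destruct (Nat.eq_dec _ _); [lra|easy].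
      * intros m _ Hm. unfold ind. now destruct (Nat.eq_dec _ _).
    + rewrite sumR_zero; auto. intros m Hm. unfold ind. destruct (Nat.eq_dec _ _); [lia|auto].
  - intros m Hm. specialize (Hle m). assert (E := Cantor.cancel_to_of m).
    destruct (Cantor.of_nat m) as [i j]. simpl.
    assert (Hneq : forall i' j', (i', j') <> (i, j) -> ind m i' j' = 0).
    { intros i' j' Hne. unfold ind. destruct (Nat.eq_dec _ _) as [Em|]; auto.
      exfalso. apply Hne. apply (f_equal Cantor.of_nat) in Em.
      rewrite Cantor.cancel_of_to, <- E, Cantor.cancel_of_to in Em. now symmetry. }
    rewrite (sumR_single N i); [|lia|].
    + rewrite (sumR_single N j); [|lia|].
      * unfold ind. destruct (Nat.eq_dec _ _); [auto|lia].
      * intros j' _ Hj'. apply Hneq. congruence.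
    + intros i' _ Hi'. apply sumR_zero. intros j' _. apply Hneq. congruence.
Qed.

Lemma hcov_countable n s delta (E : pt -> Prop) (A : nat -> pt -> Prop) (c : nat -> R) C :
  (forall k, hcov n s delta (A k) (c k)) -> (forall N, sumR N c <= C) ->
  (forall y, E y -> exists k, A k y) -> hcov n s delta E C.
Proof.
  intros HA Hc HE.
  set (P := fun k (t : (nat -> pt -> Prop) * (nat -> R) * (nat -> R)) =>
    let '(U, d, e) := t in
    (forall k, 0 <= d k < delta) /\
    (forall k y z, U k y -> U k z -> dist n y z <= d k) /\
    (forall k, (exists y, U k y) -> e k = d k ^ s) /\
    (forall k, e k = 0 \/ e k = d k ^ s) /\
    (forall N, sumR N e <= c k) /\
    (forall y, A k y -> exists k, U k y)).
  assert (CH : forall k, exists t, P k t).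
  { intros k. destruct (HA k) as [U [d [e H]]]. now exists (U, d, e). }
  set (f := fun k => proj1_sig (constructive_indefinite_description _ (CH k))).
  assert (Hf : forall k, P k (f k)) by (intros k; apply proj2_sig).
  set (U := fun k => fst (fst (f k))). set (d := fun k => snd (fst (f k))).
  set (e := fun k => snd (f k)).
  assert (HP : forall k, P k (U k, d k, e k)).
  { intros k. specialize (Hf k). unfold U, d, e. now destruct (f k) as [[? ?] ?]. }
  clearbody U d e. clear f Hf CH. unfold P in HP.
  assert (Hpos : forall i j, 0 <= e i j).
  { intros i j. destruct (HP i) as [H1 [_ [_ [H4 _]]]]. destruct (H4 j) as [->| ->]; [lra|].
    apply pow_le, H1. }
  exists (fun m => U (fst (Cantor.of_nat m)) (snd (Cantor.of_nat m))),
         (fun m => d (fst (Cantor.of_nat m)) (snd (Cantor.of_nat m))),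
         (fun m => e (fst (Cantor.of_nat m)) (snd (Cantor.of_nat m))).
  split; [intros; apply HP|]. split; [intros k; apply HP|]. split; [intros; now apply HP|].
  split; [intros; now apply HP|]. split.
  - intros N. eapply Rle_trans; [now apply sumR_cantor_le|].
    eapply Rle_trans; [|apply (Hc N)]. apply sumR_le. intros i _. apply HP.
  - intros y Hy. destruct (HE y Hy) as [i Hi].
    destruct (HP i) as [_ [_ [_ [_ [_ H6]]]]]. destruct (H6 y Hi) as [j Hj].
    exists (Cantor.to_nat (i, j)). now rewrite Cantor.cancel_of_to.
Qed.

Lemma dist_le_sup n y z D :
  0 <= D -> (forall k, (k < n)%nat -> Rabs (y k - z k) <= D) -> dist n y z <= INR n * D.
Proof.
  intros HD H. unfold dist.
  assert (Hs : sumR n (fun i => (y i - z i) ^ 2) <= INR n * D ^ 2).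
  { rewrite <- sumR_const. apply sumR_le. intros i Hi. specialize (H i Hi).
    apply Rabs_le_bounds in H. nra. }
  assert (Hn : INR n <= INR n * INR n).
  { destruct n as [|n]; [simpl; lra|]. assert (1 <= INR (S n)).
    { rewrite S_INR. generalize (pos_INR n). lra. } nra. }
  assert (Hn0 := pos_INR n).
  rewrite <- (sqrt_pow2 (INR n * D)) by now apply Rmult_le_pos.
  apply sqrt_le_1_alt. eapply Rle_trans; [apply Hs|].
  assert (0 <= D ^ 2) by apply pow2_ge_0.
  replace ((INR n * D) ^ 2) with (INR n * INR n * D ^ 2) by ring.
  now apply Rmult_le_compat_r.
Qed.

Lemma hcov_net n s delta (E : pt -> Prop) (l : list pt) r :
  0 < r -> 2 * INR n * r < delta ->
  (forall y, E y -> exists z, In z l /\ forall k, (k < n)%nat -> Rabs (y k - z k) < r) ->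
  hcov n s delta E (INR (length l) * (2 * INR n * r) ^ s).
Proof.
  intros Hr Hd HE.
  assert (Hn0 := pos_INR n).
  assert (H0 : 0 <= 2 * INR n * r) by (apply Rmult_le_pos; lra).
  apply (hcov_countable n s delta E
    (fun i y => (i < length l)%nat /\ forall k, (k < n)%nat -> Rabs (y k - nth i l zero k) < r)
    (fun i => if lt_dec i (length l) then (2 * INR n * r) ^ s else 0)).
  - intros i. destruct (lt_dec i (length l)) as [Hi|Hi].
    + apply hcov_single; [lra|]. intros y z [_ Hy] [_ Hz].
      replace (2 * INR n * r) with (INR n * (2 * r)) by ring. apply dist_le_sup; [lra|].
      intros k Hk. specialize (Hy k Hk). specialize (Hz k Hk).
      apply Rabs_def2 in Hy, Hz. apply Rabs_le. lra.
    + apply hcov_empty; [lra|]. intros y [H _]. lia.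
  - intros N. assert (Hp : 0 <= (2 * INR n * r) ^ s) by now apply pow_le.
    set (w := fun i => if lt_dec i (length l) then (2 * INR n * r) ^ s else 0).
    assert (Hw : forall i, 0 <= w i) by (intros i; unfold w; destruct (lt_dec _ _); lra).
    apply Rle_trans with (sumR (length l + N) w); [apply sumR_mono; [auto|lia]|].
    rewrite sumR_split, (sumR_zero N).
    + rewrite <- sumR_const, Rplus_0_r. apply Req_le, sumR_ext. intros i Hi. unfold w.
      now destruct (lt_dec _ _).
    + intros i _. unfold w. destruct (lt_dec _ _); [lia|auto].
  - intros y Hy. destruct (HE y Hy) as [z [Hz Hyz]].
    destruct (In_nth l z zero Hz) as [i [Hi Ez]]. exists i. rewrite Ez. auto.
Qed.

(** * Vitali covering by regular closed sets *)

Lemma tail_small (w : nat -> R) B eps :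
  (forall k, 0 <= w k) -> (forall N, sumR N w <= B) -> 0 < eps ->
  exists m, forall N, sumR N (fun i => w (m + i)%nat) <= eps.
Proof.
  intros Hw HB He.
  destruct (completeness (fun r => exists N, r = sumR N w)) as [S [S1 S2]].
  - exists B. intros r [N ->]. auto.
  - now exists 0, O.
  - apply NNPP. intros Hno.
    assert (S <= S - eps); [|lra]. apply S2. intros r [m ->].
    apply Rnot_lt_le. intros Hlt. apply Hno. exists m. intros N.
    assert (E : sumR (m + N) w <= S) by (apply S1; now eexists).
    rewrite sumR_split in E. lra.
Qed.

Lemma sumR_nth (A : Type) (L : list A) (g : A -> R) (d : A) :
  sumR (length L) (fun i => g (nth i L d)) = fold_right (fun a t => g a + t) 0 L.
Proof.
  induction L as [|a L IH]; [reflexivity|].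
  change (length (a :: L)) with (1 + length L)%nat. rewrite sumR_split. simpl. rewrite <- IH. lra.
Qed.

Definition disjoint (A B : pt -> Prop) : Prop := forall y, A y -> B y -> False.

(* Greedy selection of items of nearly maximal radius.  The points missed by the first [m]
   selected sets are only caught by the tripled cubes of the tail, whose total content is small
   whatever the shape of the sets. *)
Lemma vitali_cover (n s : nat) (I : Type) (V : I -> Prop) (ctr : I -> pt) (rad : I -> R)
    (F : I -> pt -> Prop) (E : pt -> Prop) (delta rho B kappa eps : R) :
  0 < delta -> 6 * INR n * rho < delta -> 0 <= kappa -> 0 <= B -> 0 < eps ->
  (forall i, V i -> 0 < rad i <= rho) ->
  (forall i y k, V i -> F i y -> (k < n)%nat -> Rabs (y k - ctr i k) <= rad i) ->
  (forall N (f : nat -> I), (forall i, (i < N)%nat -> V (f i)) ->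
     (forall i j, (i < j < N)%nat -> disjoint (F (f i)) (F (f j))) ->
     sumR N (fun i => rad (f i) ^ s) <= B) ->
  (forall i, V i -> hcov n s delta (F i) (kappa * rad i ^ s)) ->
  (forall x (L : list I), E x -> (forall j, In j L -> V j /\ ~ F j x) ->
     exists i, V i /\ ctr i = x /\ forall j, In j L -> disjoint (F i) (F j)) ->
  hcov n s delta E (kappa * B + eps).
Proof.
  intros Hdel Hrho Hk HB0 He H1 H2 H3 H4 H5.
  set (avail := fun (L : list I) i => V i /\ forall j, In j L -> disjoint (F i) (F j)).
  assert (CH : forall L, exists o : option I, match o with
    | Some i => avail L i /\ forall i', avail L i' -> rad i' <= 2 * rad i
    | None => forall i, ~ avail L i end).
  { intros L. destruct (classic (exists i, avail L i)) as [[i0 Hi0]|Hno].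
    - destruct (half_sup (fun r => exists i, avail L i /\ r = rad i) rho) as [r [[i [Hi ->]] [R1 R2]]].
      + intros r [i [[Hi _] ->]]. now apply H1.
      + exists (rad i0). split; [now exists i0|]. apply H1. apply Hi0.
      + exists (Some i). split; auto. intros i' Hi'. apply R2. now exists i'.
    - exists None. intros i Hi. apply Hno. now exists i. }
  set (nxt := fun L => proj1_sig (constructive_indefinite_description _ (CH L))).
  assert (Hnxt : forall L, match nxt L with
    | Some i => avail L i /\ forall i', avail L i' -> rad i' <= 2 * rad i
    | None => forall i, ~ avail L i end) by (intros L; apply proj2_sig).
  clearbody nxt.
  (* The items selected before stage [k], newest first; the list stays constant once nothing is
     available. *)
  set (st := fix st k := match k with
    | O => nil
    | S k' => match nxt (st k') with Some i => i :: st k' | None => st k' end end).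
  set (o := fun k => nxt (st k)).
  assert (Hst : forall k, st (S k) = match o k with Some i => i :: st k | None => st k end) by auto.
  assert (Hin : forall k j, In j (st k) <-> exists k', (k' < k)%nat /\ o k' = Some j).
  { induction k as [|k IH]; intros j.
    - split; [easy|]. intros [k' [Hk' _]]. lia.
    - rewrite Hst. split.
      + intros Hj. destruct (o k) as [i|] eqn:Eo.
        * destruct Hj as [->|Hj]; [exists k; split; [lia|auto]|].
          apply IH in Hj as [k' [Hk' E']]. exists k'. split; [lia|auto].
        * apply IH in Hj as [k' [Hk' E']]. exists k'. split; [lia|auto].
      + intros [k' [Hk' E']]. destruct (Nat.eq_dec k' k) as [->|Hne].
        * rewrite E'. now left.
        * assert (Hj : In j (st k)) by (apply IH; exists k'; split; [lia|auto]).
          destruct (o k); [now right|auto]. }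
  assert (Hav : forall k i, o k = Some i -> avail (st k) i).
  { intros k i Ei. specialize (Hnxt (st k)). fold (o k) in Hnxt. rewrite Ei in Hnxt. apply Hnxt. }
  set (w := fun k => match o k with Some i => rad i ^ s | None => 0 end).
  assert (Hw0 : forall k, 0 <= w k).
  { intros k. unfold w. destruct (o k) as [i|] eqn:Eo; [|lra].
    apply pow_le. left. apply H1. now apply Hav in Eo as [Eo _]. }
  assert (HwB : forall N, sumR N w <= B).
  { intros N.
    assert (HL : (forall i, In i (st N) -> V i) /\
      (forall i j d, (i < j < length (st N))%nat -> disjoint (F (nth i (st N) d)) (F (nth j (st N) d))) /\
      sumR N w = fold_right (fun i t => rad i ^ s + t) 0 (st N)).
    { induction N as [|N [I1 [I2 I3]]].
      - split; [easy|]. split; [simpl; intros; lia|auto].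
      - rewrite Hst. simpl sumR. rewrite I3. unfold w. destruct (o N) as [i|] eqn:Eo.
        + apply Hav in Eo as [E1 E2]. split; [|split].
          * intros j [<-|Hj]; auto.
          * intros [|a] [|b] d Hab; simpl in *; try lia.
            -- apply E2. apply nth_In. lia.
            -- apply I2. lia.
          * simpl. lra.
        + split; [auto|]. split; [auto|]. lra. }
    destruct HL as [L1 [L2 ->]]. destruct (st N) as [|i0 L] eqn:EL; [exact HB0|].
    rewrite <- (sumR_nth _ (i0 :: L) (fun i => rad i ^ s) i0).
    apply (H3 (length (i0 :: L)) (fun i => nth i (i0 :: L) i0)).
    - intros i Hi. apply L1. now apply nth_In.
    - intros i j Hij. now apply L2. }
  assert (H6s : 0 < (6 * INR n) ^ s + 1).
  { assert (0 <= (6 * INR n) ^ s) by (apply pow_le; generalize (pos_INR n); lra). lra. }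
  (* A cube of half-side [3 * rad i] has diameter at most [6 * INR n * rad i], which accounts for
     the factor [(6 * INR n) ^ s]; the 1 added makes the divisor positive. *)
  destruct (tail_small w B (eps / ((6 * INR n) ^ s + 1)) Hw0 HwB) as [m Hm].
  { now apply Rdiv_lt_0_compat. }
  set (A := fun k y => match o k with
    | Some i => if lt_dec k m then F i y
                else forall q, (q < n)%nat -> Rabs (y q - ctr i q) <= 3 * rad i
    | None => False end).
  apply (hcov_countable n s delta E A
    (fun k => (if lt_dec k m then kappa else (6 * INR n) ^ s) * w k)).
  - intros k. unfold A, w. destruct (o k) as [i|] eqn:Eo.
    + apply Hav in Eo as [Vi _]. destruct (lt_dec k m) as [Hkm|Hkm]; [now apply H4|].
      destruct (H1 i Vi) as [R1 R2].
      rewrite <- Rpow_mult_distr. apply hcov_single.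
      * assert (Hn := pos_INR n). split; [apply Rmult_le_pos; lra|].
        apply Rle_lt_trans with (6 * INR n * rho); auto. apply Rmult_le_compat_l; lra.
      * intros y z Hy Hz. replace (6 * INR n * rad i) with (INR n * (6 * rad i)) by ring.
        apply dist_le_sup; [lra|]. intros q Hq. specialize (Hy q Hq). specialize (Hz q Hq).
        apply Rabs_le_bounds in Hy, Hz. apply Rabs_le. lra.
    + rewrite Rmult_0_r. now apply hcov_empty.
  - intros N.
    set (g := fun k => (if lt_dec k m then kappa else (6 * INR n) ^ s) * w k).
    assert (Hg : forall k, 0 <= g k).
    { intros k. unfold g. apply Rmult_le_pos; auto. destruct (lt_dec k m); auto.
      apply pow_le. generalize (pos_INR n). lra. }
    apply Rle_trans with (sumR (m + N) g); [apply sumR_mono; [auto|lia]|].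
    rewrite sumR_split. apply Rplus_le_compat.
    + apply Rle_trans with (kappa * sumR m w).
      * rewrite <- sumR_scal. apply Req_le, sumR_ext. intros k Hkm. unfold g.
        destruct (lt_dec k m); [auto|lia].
      * apply Rmult_le_compat_l; auto.
    + apply Rle_trans with ((6 * INR n) ^ s * sumR N (fun i => w (m + i)%nat)).
      * rewrite <- sumR_scal. apply Req_le, sumR_ext. intros k _. unfold g.
        destruct (lt_dec (m + k) m); [lia|auto].
      * apply Rle_trans with (((6 * INR n) ^ s + 1) * (eps / ((6 * INR n) ^ s + 1))).
        -- apply Rmult_le_compat; auto; try lra.
           ++ apply pow_le. generalize (pos_INR n). lra.
           ++ apply sumR_nonneg. auto.
        -- apply Req_le. field. lra.
  - intros x Ex.
    destruct (classic (exists k i, (k < m)%nat /\ o k = Some i /\ F i x)) as [[k [i [Hkm [Eo Fx]]]]|Hno].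
    { exists k. unfold A. rewrite Eo. now destruct (lt_dec k m). }
    destruct (H5 x (st m) Ex) as [i [Vi [Ci Di]]].
    { intros j Hj. apply Hin in Hj as [k [Hkm Eo]]. split.
      - now apply Hav in Eo as [Vj _].
      - intros Fx. apply Hno. now exists k, j. }
    assert (Hbest : forall k, avail (st k) i -> exists j, o k = Some j /\ rad i <= 2 * rad j).
    { intros k Hak. specialize (Hnxt (st k)). fold (o k) in Hnxt.
      destruct (o k) as [j|]; [|now apply Hnxt in Hak]. exists j. split; auto. now apply Hnxt. }
    (* If [i] stayed available forever, every selected radius would be at least [rad i / 2], against
       the bound [B] on the sums. *)
    destruct (classic (forall k, avail (st k) i)) as [Hall|Hmeet].
    + exfalso. destruct (H1 i Vi) as [R1 _].
      assert (Hc : 0 < (rad i / 2) ^ s) by (apply pow_lt; lra).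
      assert (Hw1 : forall k, (rad i / 2) ^ s <= w k).
      { intros k. destruct (Hbest k (Hall k)) as [j [Eo Hr]]. unfold w. rewrite Eo.
        apply pow_incr. lra. }
      destruct (INR_unbounded (B / (rad i / 2) ^ s)) as [N HN].
      assert (E1 : INR N * (rad i / 2) ^ s <= B).
      { eapply Rle_trans; [|apply (HwB N)]. rewrite <- sumR_const. apply sumR_le. auto. }
      assert (E2 : B / (rad i / 2) ^ s * (rad i / 2) ^ s < INR N * (rad i / 2) ^ s)
        by now apply Rmult_lt_compat_r.
      replace (B / (rad i / 2) ^ s * (rad i / 2) ^ s) with B in E2 by (field; lra). lra.
    + assert (Hfirst : exists k j, avail (st k) i /\ o k = Some j /\ ~ disjoint (F i) (F j)).
      { apply NNPP. intros Hn. apply Hmeet. induction k as [|k IH].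
        - split; auto. easy.
        - split; auto. intros j Hj. rewrite Hst in Hj. destruct (o k) as [j'|] eqn:Eo.
          + destruct Hj as [<-|Hj]; [|now apply IH].
            apply NNPP. intros Hd. apply Hn. now exists k, j'.
          + now apply IH. }
      destruct Hfirst as [k [j [Hak [Eo Hd]]]].
      exists k. unfold A. rewrite Eo. destruct (lt_dec k m) as [Hkm|Hkm].
      { exfalso. apply Hd, Di, Hin. now exists k. }
      destruct (Hbest k Hak) as [j' [Eo' Hr]]. rewrite Eo in Eo'. injection Eo' as <-.
      (* [F i] meets [F j] and [rad i <= 2 * rad j], so the centre [x] of [i] is within
         [rad i + rad j <= 3 * rad j] of the centre of [j] in each coordinate. *)
      intros q Hq. apply NNPP. intros Hbig. apply Hd. intros y Fi Fj. apply Hbig.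
      apply Hav in Eo as [Vj _].
      assert (A1 := H2 i y q Vi Fi Hq). assert (A2 := H2 j y q Vj Fj Hq).
      rewrite Ci in A1. apply Rabs_le_bounds in A1, A2. apply Rabs_le. lra.
Qed.


(** * Caps of the strongly convex perturbation *)

Definition sqn (n : nat) (z : pt) : R := sumR n (fun i => z i ^ 2).

(** The excess at [y] of [v + |.|^2/2] over its supporting plane at [x] of slope [p + x]. This is
    why dual boxes are centred at [vadd p x]. *)
Definition gap (n : nat) (v : pt -> R) (x p y : pt) : R :=
  v y - v x - dot n p (vsub y x) + sqn n (vsub y x) / 2.

(* A sublevel set of [v + |.|^2/2] minus its supporting plane at [x]; the quadratic term confines
   it to a ball of radius [sqrt h], and it lies in the section of [v] of height [h]. *)
Definition cap (n : nat) (v : pt -> R) (x p : pt) (h : R) (y : pt) : Prop :=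
  B1 n y /\ gap n v x p y <= h / 2.

Definition cap0 (n : nat) (v : pt -> R) (x p : pt) (h : R) (z : pt) : Prop :=
  cap n v x p h (vadd x z).

Lemma dot_linear_r n p a b s t :
  dot n p (fun i => s * a i + t * b i) = s * dot n p a + t * dot n p b.
Proof. unfold dot. rewrite <- !sumR_scal, <- sumR_plus. apply sumR_ext. intros; ring. Qed.

Lemma sqn_nonneg n z : 0 <= sqn n z.
Proof. apply sumR_nonneg. intros; apply pow2_ge_0. Qed.

Lemma gap_self n v x p : gap n v x p x = 0.
Proof.
  unfold gap, dot, sqn, vsub. rewrite !sumR_zero; [lra| |]; intros; ring.
Qed.

Lemma gap_convex n v x p y z t :
  convex_on_B1 n v -> B1 n y -> B1 n z -> 0 <= t <= 1 ->
  gap n v x p (comb t y z) <= t * gap n v x p y + (1 - t) * gap n v x p z.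
Proof.
  intros Hv Hy Hz Ht. assert (H := Hv y z t Hy Hz Ht). unfold gap.
  replace (vsub (comb t y z) x) with (fun i => t * vsub y x i + (1 - t) * vsub z x i)
    by (apply functional_extensionality; intros i; unfold vsub, comb; ring).
  rewrite dot_linear_r.
  assert (Hs : sqn n (fun i => t * vsub y x i + (1 - t) * vsub z x i) <=
               t * sqn n (vsub y x) + (1 - t) * sqn n (vsub z x)).
  { unfold sqn. rewrite <- !sumR_scal, <- sumR_plus. apply sumR_le. intros i _.
    set (a := vsub y x i). set (b := vsub z x i).
    assert (0 <= t * (1 - t) * (a - b) ^ 2).
    { apply Rmult_le_pos; [nra|apply pow2_ge_0]. }
    replace ((t * a + (1 - t) * b) ^ 2)
      with (t * a ^ 2 + (1 - t) * b ^ 2 - t * (1 - t) * (a - b) ^ 2) by ring.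
    lra. }
  lra.
Qed.

Lemma cap_convex n v x p h : convex_on_B1 n v -> convex_set (cap n v x p h).
Proof.
  intros Hv y z t [Y1 Y2] [Z1 Z2] Ht. split; [now apply B1_comb|].
  eapply Rle_trans; [now apply gap_convex|].
  assert (t * gap n v x p y <= t * (h / 2)) by (apply Rmult_le_compat_l; lra).
  assert ((1 - t) * gap n v x p z <= (1 - t) * (h / 2)) by (apply Rmult_le_compat_l; lra).
  lra.
Qed.

Lemma cap0_convex n v x p h : convex_on_B1 n v -> convex_set (cap0 n v x p h).
Proof.
  intros Hv y z t Hy Hz Ht. unfold cap0.
  replace (vadd x (comb t y z)) with (comb t (vadd x y) (vadd x z))
    by (apply functional_extensionality; intros i; unfold vadd, comb; ring).
  now apply cap_convex.
Qed.

Lemma cap_self n v x p h : B1 n x -> 0 < h -> cap n v x p h x.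
Proof. intros Hx Hh. split; auto. rewrite gap_self. lra. Qed.

Lemma cap_sqn n v x p h y :
  subgradient n v x p -> cap n v x p h y -> sqn n (vsub y x) <= h.
Proof. intros [_ Hp] [Y1 Y2]. specialize (Hp y Y1). unfold gap in Y2. lra. Qed.

Lemma Rabs_le_of_sq a r : 0 <= r -> a ^ 2 <= r ^ 2 -> Rabs a <= r.
Proof. intros Hr H. unfold Rabs. destruct (Rcase_abs a); nra. Qed.

Lemma cap_bounded n v x p r y k :
  subgradient n v x p -> 0 < r -> cap n v x p (r ^ 2) y -> (k < n)%nat -> Rabs (y k - x k) <= r.
Proof.
  intros Hp Hr Hy Hk. apply Rabs_le_of_sq; [lra|].
  eapply Rle_trans; [|apply (cap_sqn _ _ _ _ _ _ Hp Hy)].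
  apply (sumR_term_le n k (fun i => vsub y x i ^ 2)); auto. intros; apply pow2_ge_0.
Qed.

Lemma cap_section n v x p h y : 0 < h -> cap n v x p h y -> section n v h p x y.
Proof.
  intros Hh [Y1 Y2]. split; auto. assert (E := sqn_nonneg n (vsub y x)). unfold gap in Y2. lra.
Qed.

(** The gap is convex and vanishes at [x], so the segment to [y] is still in the cap at the fraction
    [t = (h / 2) / G]. There the pairing is at most [h / 8], a quarter of [t * G]; dividing by [t]
    bounds it at [y] by [G / 4]. *)
Lemma dot_le_outside_cap n v x p h xi y :
  convex_on_B1 n v -> B1 n x -> 0 < h -> B1 n y -> ~ cap n v x p h y ->
  (forall z, cap0 n v x p h z -> Rabs (dot n xi z) <= h / 8) ->
  0 < gap n v x p y - dot n xi (vsub y x).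
Proof.
  intros Hv Hx Hh Hy Hno Hxi.
  assert (Hg : h / 2 < gap n v x p y).
  { apply Rnot_le_lt. intros Hle. apply Hno. now split. }
  set (G := gap n v x p y) in *. set (t := h / 2 / G).
  assert (Et : t * G = h / 2) by (unfold t; field; lra).
  assert (Ht : 0 < t <= 1).
  { split; [apply Rdiv_lt_0_compat; lra|]. apply Rmult_le_reg_r with G; lra. }
  assert (Hc : cap0 n v x p h (fun i => t * vsub y x i + 0 * zero i)).
  { unfold cap0.
    replace (vadd x (fun i => t * vsub y x i + 0 * zero i)) with (comb t y x)
      by (apply functional_extensionality; intros i; unfold vadd, comb, vsub; ring).
    split; [apply B1_comb; auto; lra|].
    eapply Rle_trans; [apply gap_convex; auto; lra|]. rewrite gap_self. fold G. lra. }
  specialize (Hxi _ Hc). rewrite dot_linear_r in Hxi.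
  apply Rabs_le_bounds in Hxi.
  assert (E : t * dot n xi (vsub y x) <= t * (G / 4)) by lra.
  apply Rmult_le_reg_l in E; lra.
Qed.

(* If [q] were dual to both caps, [v + |.|^2/2 - q] would be strictly larger at each centre than
   at the other one. *)
Lemma dual_disjoint n v x p h x' p' h' q :
  convex_on_B1 n v -> B1 n x -> B1 n x' -> 0 < h -> 0 < h' ->
  disjoint (cap n v x p h) (cap n v x' p' h') ->
  (forall z, cap0 n v x p h z -> Rabs (dot n (vsub q (vadd p x)) z) <= h / 8) ->
  (forall z, cap0 n v x' p' h' z -> Rabs (dot n (vsub q (vadd p' x')) z) <= h' / 8) -> False.
Proof.
  intros Hv Hx Hx' Hh Hh' Hd Hq Hq'.
  assert (A := dot_le_outside_cap n v x p h _ x' Hv Hx Hh Hx'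
    ltac:(intros H; apply (Hd x'); auto; now apply cap_self) Hq).
  assert (A' := dot_le_outside_cap n v x' p' h' _ x Hv Hx' Hh' Hx
    ltac:(intros H; apply (Hd x); auto; now apply cap_self) Hq').
  unfold gap in A, A'.
  (* In the sum of the two strict inequalities the values of [v] cancel, and by this identity so
     does everything else: the sum reads [0 < 0]. *)
  assert (E : - dot n p (vsub x' x) + sqn n (vsub x' x) / 2 - dot n (vsub q (vadd p x)) (vsub x' x)
    - dot n p' (vsub x x') + sqn n (vsub x x') / 2 - dot n (vsub q (vadd p' x')) (vsub x x') = 0).
  { clear. unfold dot, sqn, vsub, vadd. induction n as [|n IH]; simpl in *; lra. }
  lra.
Qed.

(* Closedness of a cap at a point of subdifferentiability: the subgradient bounds [v] below. *)
Lemma cap_avoid n v x p x' p' h' :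
  subgradient n v x p -> B1 n x -> ~ cap n v x' p' h' x ->
  exists r0, 0 < r0 /\ forall r, 0 < r <= r0 -> disjoint (cap n v x p (r ^ 2)) (cap n v x' p' h').
Proof.
  intros Hp Hx Hno.
  assert (Hg : h' / 2 < gap n v x' p' x).
  { apply Rnot_le_lt. intros Hle. apply Hno. now split. }
  set (w := fun k => p k - p' k + (x k - x' k)).
  set (S := sumR n (fun k => Rabs (w k))).
  assert (HS : 0 <= S) by (apply sumR_nonneg; intros; apply Rabs_pos).
  set (e := gap n v x' p' x - h' / 2).
  exists (e / (2 * (S + 1))). assert (He : 0 < e) by (unfold e; lra).
  split; [apply Rdiv_lt_0_compat; lra|].
  intros r [Hr1 Hr2] y Hy [Y1 Y2].
  assert (E : gap n v x' p' y >= gap n v x' p' x + dot n w (vsub y x)).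
  { destruct Hp as [_ Hp]. specialize (Hp y (proj1 Hy)).
    assert (E0 : dot n p (vsub y x) - dot n p' (vsub y x') + dot n p' (vsub x x')
      + sqn n (vsub y x') / 2 - sqn n (vsub x x') / 2 =
      dot n w (vsub y x) + sqn n (vsub y x) / 2).
    { clear. unfold dot, sqn, vsub, w. induction n as [|n IH]; simpl in *; lra. }
    assert (E1 := sqn_nonneg n (vsub y x)). unfold gap. lra. }
  assert (E2 : Rabs (dot n w (vsub y x)) <= r * S).
  { unfold dot, S. eapply Rle_trans; [apply sumR_Rabs|]. rewrite <- sumR_scal.
    apply sumR_le. intros k Hk. rewrite Rabs_mult, Rmult_comm.
    apply Rmult_le_compat_r; [apply Rabs_pos|]. now apply (cap_bounded n v x p r y). }
  apply Rabs_le_bounds in E2.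
  assert (E3 : r * (2 * (S + 1)) <= e).
  { apply Rle_trans with (e / (2 * (S + 1)) * (2 * (S + 1))).
    - apply Rmult_le_compat_r; lra.
    - apply Req_le. field. lra. }
  unfold e in E3. nra.
Qed.

(** [W] consists of 0 and the vertices of a cross-polytope of radius [n * M], which contains the
    cube of half-side [M]. At [h (w + D)] extremality bounds the excess of [v] over its plane by
    [h / 4], and a small [h] bounds the quadratic part by [h / 4]: the cap of level [h / 2] contains
    these points and their hull. [D] depends on [M] but not on [h]. *)
Lemma cap0_contains_cube n v x p M :
  (0 < n)%nat -> convex_on_B1 n v -> extreme_subgradient n v x p -> 0 < M ->
  exists h1, 0 < h1 /\ forall h, 0 < h <= h1 ->
    exists a, contains_cube n (cap0 n v x p h) a (M * h).
Proof.
  intros Hn Hv [Hp Hext] HM.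
  assert (HnR : 0 < INR n) by now apply lt_0_INR.
  set (rho := INR n * M). assert (Hrho : 0 < rho) by now apply Rmult_lt_0_compat.
  set (W := zero :: map (fun k => vscal rho (basis k)) (seq 0 n) ++
                    map (fun k => vscal (- rho) (basis k)) (seq 0 n)).
  assert (HW : forall w, In w W -> supported n w).
  { assert (Hb : forall k c, (k < n)%nat -> supported n (vscal c (basis k))).
    { intros k c Hk i Hi. unfold vscal, basis. destruct (Nat.eq_dec i k); [lia|lra]. }
    intros w [<-|Hw]; [now intros i _|].
    apply in_app_or in Hw as [Hw|Hw]; apply in_map_iff in Hw as [k [<- Hk]];
      apply in_seq in Hk; apply Hb; lia. }
  destruct (Hext W (/ 4) ltac:(lra) HW) as [D [t0 [D1 [T1 T2]]]].
  destruct (list_min_pos pt W (fun w => / (2 * (sqn n (vadd w D) + 1)))) as [e [He1 He2]].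
  { intros w _. apply Rinv_0_lt_compat. generalize (sqn_nonneg n (vadd w D)). lra. }
  exists (Rmin t0 e). split; [now apply Rmin_pos|]. intros h [Hh1 Hh2].
  assert (Hht : h <= t0) by (eapply Rle_trans; [apply Hh2|apply Rmin_l]).
  assert (Hhe : h <= e) by (eapply Rle_trans; [apply Hh2|apply Rmin_r]).
  exists (vscal h D).
  assert (Hcap : forall w, In w W -> cap0 n v x p h (vadd (vscal h D) (vscal h w))).
  { intros w Hw. destruct (T2 h w ltac:(lra) Hw) as [A1 A2]. unfold cap0.
    replace (vadd x (vadd (vscal h D) (vscal h w))) with (vadd x (vscal h (vadd w D))) by pt_ext.
    split; auto. unfold gap.
    replace (vsub (vadd x (vscal h (vadd w D))) x) with (vscal h (vadd w D)) by pt_ext.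
    assert (E1 : dot n p (vscal h (vadd w D)) = h * dot n p (vadd w D)).
    { unfold dot, vscal. rewrite <- sumR_scal. apply sumR_ext. intros; ring. }
    assert (E2 : sqn n (vscal h (vadd w D)) = h * (h * sqn n (vadd w D))).
    { unfold sqn, vscal. rewrite <- !sumR_scal. apply sumR_ext. intros; ring. }
    rewrite E1, E2. specialize (He2 w Hw). cbv beta in He2.
    assert (Hs := sqn_nonneg n (vadd w D)).
    assert (E3 : h * (2 * (sqn n (vadd w D) + 1)) <= 1).
    { apply Rle_trans with (/ (2 * (sqn n (vadd w D) + 1)) * (2 * (sqn n (vadd w D) + 1))).
      - apply Rmult_le_compat_r; lra.
      - rewrite Rinv_l; lra. }
    assert (E4 : h * (h * sqn n (vadd w D)) <= h * (1 / 2)) by (apply Rmult_le_compat_l; lra).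
    lra. }
  set (K' := fun z => cap0 n v x p h (vadd (vscal h D) z)).
  assert (HK' : convex_set K').
  { intros y z t Hy Hz Ht. unfold K'.
    replace (vadd (vscal h D) (comb t y z))
      with (comb t (vadd (vscal h D) y) (vadd (vscal h D) z))
      by (apply functional_extensionality; intros i; unfold vadd, comb, vscal; ring).
    now apply cap0_convex. }
  intros w Hw1 Hw2.
  (* For each axis the vertex on the side of the sign of [w k] is used, with weight
     [|w k| / (h rho) <= 1 / n]. *)
  set (y := fun k : nat => vscal (h * (if Rle_dec 0 (w k) then rho else - rho)) (basis k)).
  assert (Hy : K' (fun j => sumR n (fun k => Rabs (w k) / (h * rho) * y k j))).
  { apply convex_subcombination; auto.
    - unfold K'. replace zero with (vscal h zero) by pt_ext. apply Hcap. now left.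
    - intros k Hk. unfold y, K'.
      destruct (Rle_dec 0 (w k)).
      + replace (vscal (h * rho) (basis k)) with (vscal h (vscal rho (basis k))) by pt_ext.
        apply Hcap. right. apply in_or_app. left. apply in_map_iff. exists k. split; auto.
        apply in_seq. lia.
      + replace (vscal (h * - rho) (basis k)) with (vscal h (vscal (- rho) (basis k))) by pt_ext.
        apply Hcap. right. apply in_or_app. right. apply in_map_iff. exists k. split; auto.
        apply in_seq. lia.
    - intros k Hk. apply Rmult_le_pos; [apply Rabs_pos|].
      left. apply Rinv_0_lt_compat. now apply Rmult_lt_0_compat.
    - apply Rle_trans with (sumR n (fun _ => / INR n)).
      + apply sumR_le. intros k Hk. apply Rmult_le_reg_r with (h * rho).
        * now apply Rmult_lt_0_compat.
        * replace (Rabs (w k) / (h * rho) * (h * rho)) with (Rabs (w k)) by (field; lra).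
          unfold rho. replace (/ INR n * (h * (INR n * M))) with (M * h) by (field; lra). auto.
      + rewrite sumR_const, Rinv_r; lra. }
  unfold K' in Hy.
  replace (fun j => vscal h D j + w j)
    with (vadd (vscal h D) (fun j => sumR n (fun k => Rabs (w k) / (h * rho) * y k j))); auto.
  apply functional_extensionality. intros j. unfold vadd. f_equal.
  destruct (lt_dec j n) as [Hj|Hj].
  - rewrite (sumR_single n j); auto.
    + unfold y, vscal, basis. destruct (Nat.eq_dec j j); [|easy].
      destruct (Rle_dec 0 (w j)).
      * rewrite Rabs_right by lra. field. lra.
      * rewrite Rabs_left by lra. field. lra.
    + intros k _ Hk. unfold y, vscal, basis. destruct (Nat.eq_dec j k); [congruence|ring].
  - rewrite (Hw1 j) by lia. apply sumR_zero. intros k Hk. unfold y, vscal, basis.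
    destruct (Nat.eq_dec j k); [lia|ring].
Qed.

Lemma leb_measure_lt_translate n (S K : pt -> Prop) x c :
  leb_measure_lt n S c -> (forall z, K z -> S (vadd x z)) -> leb_measure_lt n K c.
Proof.
  intros [a [b [l [H1 [H2 [H3 H4]]]]]] HK.
  exists (fun k => vsub (a k) x), (fun k => vsub (b k) x), l.
  split; [|split; [|split; auto]].
  - intros k i. unfold vsub. specialize (H1 k i). lra.
  - replace (fun k => prodR n (fun i => vsub (b k) x i - vsub (a k) x i))
      with (fun k => prodR n (fun i => b k i - a k i)); auto.
    apply functional_extensionality. intros k. apply prodR_ext. intros i _. unfold vsub. ring.
  - intros z Hz. destruct (H4 _ (HK z Hz)) as [k Hk]. exists k. intros i Hi.
    specialize (Hk i Hi). unfold vadd in Hk. unfold vsub. lra.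
Qed.

Lemma Rpower_sqr_half r m : 0 < r -> Rpower (r ^ 2) (INR m / 2) = r ^ m.
Proof.
  intros Hr. rewrite <- (Rpower_pow 2 r Hr), Rpower_mult, <- (Rpower_pow m r Hr).
  f_equal. simpl. field.
Qed.

Lemma cap0_measure n v x p C r :
  0 < r -> leb_measure_lt n (section n v (r ^ 2) p x) (C * Rpower (r ^ 2) (INR (n + 1) / 2)) ->
  leb_measure_lt n (cap0 n v x p (r ^ 2)) (C * r ^ (n + 1)).
Proof.
  intros Hr H. rewrite Rpower_sqr_half in H by auto.
  apply (leb_measure_lt_translate n _ _ x _ H). intros z Hz. apply cap_section; auto.
  apply pow_lt; lra.
Qed.

Lemma cap_hcov n v x p C M r delta :
  (0 < n)%nat -> convex_on_B1 n v -> B1 n x -> 0 < M -> 0 < r ->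
  (exists a, contains_cube n (cap0 n v x p (r ^ 2)) a (M * r ^ 2)) ->
  leb_measure_lt n (cap0 n v x p (r ^ 2)) (C * r ^ (n + 1)) ->
  2 * INR n * (M * r ^ 2) < delta ->
  hcov n (n - 1) delta (cap n v x p (r ^ 2))
    (3 * (3 * INR n) ^ (n - 1) * 8 ^ n * C / (2 * M) * r ^ (n - 1)).
Proof.
  intros Hn Hv Hx HM Hr [a Ha] Hm Hdel.
  assert (Hr2 : 0 < r ^ 2) by (apply pow_lt; lra).
  set (s := M * r ^ 2) in *. assert (Hs : 0 < s) by now apply Rmult_lt_0_compat.
  destruct (separated_net n (cap0 n v x p (r ^ 2)) a s (C * r ^ (n + 1))) as [l [L1 L2]]; auto.
  { now apply cap0_convex. }
  { intros y [Hy _] i Hi. destruct Hx as [_ Hx], Hy as [_ Hy]. specialize (Hy i Hi).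
    unfold vadd in Hy. rewrite (Hx i Hi) in Hy. lra. }
  apply hcov_mono with (E := cap n v x p (r ^ 2)) (c := INR (length l) * (2 * INR n * s) ^ (n - 1)); auto.
  - set (A := 2 * s / 3) in *. assert (HA : 0 < A) by (unfold A; lra).
    replace (2 * INR n * s) with (3 * INR n * A) by (unfold A; field).
    destruct n as [|m]; [lia|]. replace (S m - 1)%nat with m in * by lia.
    rewrite Rpow_mult_distr.
    replace (S m + 1)%nat with (m + 2)%nat in L1 by lia. rewrite pow_add in L1.
    assert (HP : 0 <= (3 * INR (S m)) ^ m) by (apply pow_le; generalize (pos_INR (S m)); lra).
    assert (E : INR (length l) * A ^ m <= 3 * 8 ^ S m * C / (2 * M) * r ^ m).
    { apply Rmult_le_reg_r with A; auto.
      replace (INR (length l) * A ^ m * A) with (INR (length l) * A ^ S m) by (simpl; ring).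
      eapply Rle_trans; [apply L1|]. apply Req_le. unfold A, s. field. lra. }
    apply Rle_trans with ((3 * INR (S m)) ^ m * (INR (length l) * A ^ m)); [apply Req_le; ring|].
    apply Rle_trans with ((3 * INR (S m)) ^ m * (3 * 8 ^ S m * C / (2 * M) * r ^ m)).
    + now apply Rmult_le_compat_l.
    + apply Req_le. field. lra.
  - set (shift := fun z : pt => (fun j => z j + x j) : pt).
    replace (length l) with (length (map shift l)) by apply length_map.
    apply hcov_net; auto. intros y Hy.
    destruct (L2 (vsub y x)) as [z [Hz Hd]].
    { unfold cap0. replace (vadd x (vsub y x)) with y by pt_ext. auto. }
    exists (shift z). split; [now apply in_map|]. intros k Hk. specialize (Hd k Hk).
    unfold shift, vsub in *. replace (y k - (z k + x k)) with (y k - x k - z k) by ring. auto.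
Qed.

(** The level [r^2 / 8] is the one [dual_disjoint] asks for. The coordinate bound keeps the dual
    boxes in a region independent of [r] and [M], as their disjointness limits the total volume only
    inside a bounded set. *)
Lemma cap_dual n v x p C M r :
  (0 < n)%nat -> convex_on_B1 n v -> B1 n x -> subgradient n v x p -> 1 <= M -> 0 < r ->
  (exists a, contains_cube n (cap0 n v x p (r ^ 2)) a (M * r ^ 2)) ->
  leb_measure_lt n (cap0 n v x p (r ^ 2)) (C * r ^ (n + 1)) ->
  exists (u : nat -> pt) (g : nat -> R),
    unitriangular u n /\ (forall k, (k < n)%nat -> 0 < g k) /\
    (forall q, dual_box n u g (vadd p x) q ->
       (forall z, cap0 n v x p (r ^ 2) z -> Rabs (dot n (vsub q (vadd p x)) z) <= r ^ 2 / 8) /\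
       forall k, (k < n)%nat -> Rabs (vsub q (vadd p x) k) <= 1) /\
    r ^ (n - 1) <= (8 * INR n) ^ n * vp_const n * C * prodR n (fun k => 2 * g k).
Proof.
  intros Hn Hv Hx Hp HM Hr [a Ha] Hm.
  assert (Hr2 : 0 < r ^ 2) by (apply pow_lt; lra).
  assert (Hs : 0 < M * r ^ 2) by (apply Rmult_lt_0_compat; lra).
  assert (HnR : 0 < INR n) by now apply lt_0_INR.
  destruct (polar_dual_box n (cap0 n v x p (r ^ 2)) r a (M * r ^ 2) (C * r ^ (n + 1)) (r ^ 2 / 8))
    as [u [g [U1 [U2 [U3 U4]]]]]; auto.
  { now apply cap0_convex. }
  { unfold cap0. replace (vadd x zero) with x by pt_ext. now apply cap_self. }
  { intros z j Hz Hj. assert (E := cap_bounded n v x p r _ j Hp Hr Hz Hj).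
    unfold vadd in E. now replace (x j + z j - x j) with (z j) in E by ring. }
  { lra. }
  exists u, g. split; [auto|]. split; [auto|]. split.
  - intros q Hq. assert (Hz : forall z, cap0 n v x p (r ^ 2) z ->
      Rabs (dot n (vsub q (vadd p x)) z) <= r ^ 2 / 8) by (intros z Hz; now apply U3).
    split; auto. intros k Hk. set (xi := vsub q (vadd p x)) in *.
    (* Testing [xi] at [a + M r^2 e_k] and [a - M r^2 e_k] and subtracting bounds [M r^2 |xi k|] by
       [r^2 / 8]; [M >= 1] then gives the claim. *)
    assert (Hpt : forall c, Rabs c = 1 ->
      Rabs (dot n xi (fun j => 1 * a j + (c * (M * r ^ 2)) * basis k j)) <= r ^ 2 / 8).
    { intros c Hc. apply Hz.
      replace (fun j => 1 * a j + c * (M * r ^ 2) * basis k j)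
        with (fun j => a j + c * (M * r ^ 2) * basis k j)
        by (apply functional_extensionality; intros; ring).
      apply Ha.
      - intros i Hi. unfold basis. destruct (Nat.eq_dec i k); [lia|ring].
      - intros i Hi. rewrite !Rabs_mult, Hc. unfold basis.
        rewrite (Rabs_right M), (Rabs_right (r ^ 2)) by lra.
        destruct (Nat.eq_dec i k); rewrite ?Rabs_R1, ?Rabs_R0; lra. }
    assert (A1 := Hpt 1 Rabs_R1). assert (A2 := Hpt (-1) ltac:(rewrite Rabs_left; lra)).
    rewrite dot_linear_r in A1, A2.
    assert (Eb : dot n xi (basis k) = xi k).
    { unfold dot. rewrite (sumR_single n k); auto.
      - unfold basis. destruct (Nat.eq_dec k k); [ring|easy].
      - intros i _ Hi. unfold basis. destruct (Nat.eq_dec i k); [easy|ring]. }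
    rewrite Eb in A1, A2. apply Rabs_le_bounds in A1, A2.
    assert (E1 : M * r ^ 2 * xi k <= r ^ 2 / 8) by lra.
    assert (E2 : - (r ^ 2 / 8) <= M * r ^ 2 * xi k) by lra.
    assert (E3 : r ^ 2 <= M * r ^ 2) by nra.
    apply Rabs_le. split; nra.
  - assert (Hpp : 0 < prodR n (fun k => 2 * g k))
      by (apply prodR_pos; intros k Hk; specialize (U2 k Hk); lra).
    assert (Hq : 0 < (8 * INR n) ^ n) by (apply pow_lt; lra).
    assert (Hr1 : 0 < r ^ (n + 1)) by (apply pow_lt; lra).
    apply Rmult_le_reg_r with (r ^ (n + 1)); auto.
    assert (E1 : r ^ (n - 1) * r ^ (n + 1) = (8 * INR n) ^ n * (r ^ 2 / 8 / INR n) ^ n).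
    { rewrite <- pow_add, <- Rpow_mult_distr.
      replace (8 * INR n * (r ^ 2 / 8 / INR n)) with (r ^ 2) by (field; lra).
      rewrite <- pow_mult. f_equal. lia. }
    rewrite E1.
    apply Rle_trans with ((8 * INR n) ^ n * (vp_const n * (C * r ^ (n + 1)) * prodR n (fun k => 2 * g k))).
    + apply Rmult_le_compat_l; lra.
    + apply Req_le. ring.
Qed.


(** * Classes with uniform constants, and the conclusion *)

(** [C] and the slope bound [R0] enter the packing bound and have to be uniform. The threshold [h0]
    may vary with [x], since the covering lemma only asks for sufficiently small caps at each
    point. *)
Definition controlled (n : nat) (v : pt -> R) (C R0 : R) (x : pt) : Prop :=
  B1 n x /\ exists p, extreme_subgradient n v x p /\
    (forall k, (k < n)%nat -> Rabs (p k) <= R0) /\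
    exists h0, 0 < h0 /\ forall h, 0 < h < h0 ->
      leb_measure_lt n (section n v h p x) (C * Rpower h (INR (n + 1) / 2)).

Lemma B1_coord n x k : B1 n x -> (k < n)%nat -> Rabs (x k) <= 1.
Proof.
  intros [Hx _] Hk. apply Rabs_le_of_sq; [lra|].
  assert (E := sumR_term_le n k (fun i => x i ^ 2) (fun i _ => pow2_ge_0 (x i)) Hk).
  cbv beta in E. lra.
Qed.

Lemma vp_const_nonneg n : 0 <= vp_const n.
Proof. apply pow_le. generalize (pos_INR (n * 3 ^ n)). lra. Qed.

(** Disjoint caps have disjoint dual boxes, all inside the cube of half-side [R0 + 2]: [R0] for the
    slope, 1 for the point, 1 for the deviation from [vadd p x]. The bound is the same for every
    [M >= 1]. *)
Lemma disjoint_caps_sum n v C M R0 :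
  (0 < n)%nat -> convex_on_B1 n v -> 0 <= C -> 1 <= M -> 0 <= R0 ->
  forall N (x p : nat -> pt) (r : nat -> R),
  (forall i, (i < N)%nat -> B1 n (x i) /\ subgradient n v (x i) (p i) /\
     (forall k, (k < n)%nat -> Rabs (p i k) <= R0) /\ 0 < r i /\
     (exists a, contains_cube n (cap0 n v (x i) (p i) (r i ^ 2)) a (M * r i ^ 2)) /\
     leb_measure_lt n (cap0 n v (x i) (p i) (r i ^ 2)) (C * r i ^ (n + 1))) ->
  (forall i j, (i < j < N)%nat ->
     disjoint (cap n v (x i) (p i) (r i ^ 2)) (cap n v (x j) (p j) (r j ^ 2))) ->
  sumR N (fun i => r i ^ (n - 1)) <=
    (8 * INR n) ^ n * vp_const n * C * (4 ^ n * (2 * (R0 + 2)) ^ n).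
Proof.
  intros Hn Hv HC HM HR N x p r H Hd.
  set (P := fun i (t : (nat -> pt) * (nat -> R)) => let (u, g) := t in
    unitriangular u n /\ (forall k, (k < n)%nat -> 0 < g k) /\
    (forall q, dual_box n u g (vadd (p i) (x i)) q ->
       (forall z, cap0 n v (x i) (p i) (r i ^ 2) z ->
          Rabs (dot n (vsub q (vadd (p i) (x i))) z) <= r i ^ 2 / 8) /\
       forall k, (k < n)%nat -> Rabs (vsub q (vadd (p i) (x i)) k) <= 1) /\
    r i ^ (n - 1) <= (8 * INR n) ^ n * vp_const n * C * prodR n (fun k => 2 * g k)).
  assert (CH : forall i, exists t, (i < N)%nat -> P i t).
  { intros i. destruct (lt_dec i N) as [Hi|Hi].
    - destruct (H i Hi) as [H1 [H2 [H3 [H4 [H5 H6]]]]].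
      destruct (cap_dual n v (x i) (p i) C M (r i)) as [u [g Hug]]; auto.
      now exists (u, g).
    - exists (fun _ => zero, fun _ => 0). intros; lia. }
  set (f := fun i => proj1_sig (constructive_indefinite_description _ (CH i))).
  assert (Hf0 : forall i, (i < N)%nat -> P i (f i))
    by (intros i; apply (proj2_sig (constructive_indefinite_description _ (CH i)))).
  clearbody f.
  assert (Hf : forall i, (i < N)%nat -> P i (fst (f i), snd (f i))).
  { intros i Hi. specialize (Hf0 i Hi). now destruct (f i). }
  unfold P in Hf.
  assert (HA : 0 <= (8 * INR n) ^ n * vp_const n * C).
  { apply Rmult_le_pos; auto. apply Rmult_le_pos; [|apply vp_const_nonneg].
    apply pow_le. generalize (pos_INR n). lra. }
  apply Rle_trans with ((8 * INR n) ^ n * vp_const n * C *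
    sumR N (fun i => prodR n (fun k => 2 * snd (f i) k))).
  - rewrite <- sumR_scal. apply sumR_le. intros i Hi. now apply Hf.
  - apply Rmult_le_compat_l; auto.
    apply (dual_box_volume n N (fun i => fst (f i)) (fun i => snd (f i))
             (fun i => vadd (p i) (x i)) (R0 + 2)).
    + lra.
    + intros i Hi. now apply Hf.
    + intros i k Hi. now apply Hf.
    + assert (HS : forall i j q, (i < j < N)%nat ->
        dual_box n (fst (f i)) (snd (f i)) (vadd (p i) (x i)) q ->
        dual_box n (fst (f j)) (snd (f j)) (vadd (p j) (x j)) q -> False).
      { intros i j q Hij Qi Qj.
        assert (Hi : (i < N)%nat) by lia. assert (Hj : (j < N)%nat) by lia.
        destruct (H i Hi) as [Xi [_ [_ [Ri _]]]]. destruct (H j Hj) as [Xj [_ [_ [Rj _]]]].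
        apply (dual_disjoint n v (x i) (p i) (r i ^ 2) (x j) (p j) (r j ^ 2) q); auto.
        - now apply pow_lt.
        - now apply pow_lt.
        - now apply Hf.
        - now apply Hf. }
      intros i j q Hi Hj Hij Qi Qj.
      destruct (Nat.lt_ge_cases i j); [apply (HS i j q)|apply (HS j i q)]; auto; lia.
    + intros i q Hi Hq k Hk. destruct (Hf i Hi) as [_ [_ [Hb _]]].
      destruct (Hb q Hq) as [_ Hb']. specialize (Hb' k Hk).
      destruct (H i Hi) as [Xi [_ [Pi _]]]. specialize (Pi k Hk).
      assert (Xk := B1_coord n (x i) k Xi Hk). unfold vsub, vadd in Hb'.
      apply Rabs_le_bounds in Hb', Pi, Xk. apply Rabs_le. lra.
Qed.

Lemma controlled_hcov n v C R0 delta eps :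
  (0 < n)%nat -> convex_on_B1 n v -> 0 < C -> 0 <= R0 -> 0 < delta -> 0 < eps ->
  hcov n (n - 1) delta (controlled n v C R0) eps.
Proof.
  intros Hn Hv HC HR Hdel He.
  assert (HnR : 1 <= INR n) by (apply (le_INR 1); lia).
  set (B := (8 * INR n) ^ n * vp_const n * C * (4 ^ n * (2 * (R0 + 2)) ^ n)).
  assert (HB : 0 <= B).
  { unfold B. repeat apply Rmult_le_pos; try apply vp_const_nonneg; try (apply pow_le; lra); lra. }
  set (c0 := 3 * (3 * INR n) ^ (n - 1) * 8 ^ n * C / 2).
  assert (Hc0 : 0 < c0).
  { unfold c0, Rdiv. repeat apply Rmult_lt_0_compat; try (apply pow_lt; lra); lra. }
  (* [B] does not involve [M], so [M] can be taken large enough for [c0 / M * B <= eps / 2], and at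
     least 1 for the dual boxes. *)
  set (M := 1 + 2 * c0 * B / eps).
  assert (HcB : 0 <= c0 * B) by (apply Rmult_le_pos; lra).
  assert (HM : 1 <= M).
  { unfold M. assert (0 <= 2 * c0 * B / eps); [|lra].
    apply Rmult_le_pos; [lra|left; now apply Rinv_0_lt_compat]. }
  assert (Hkap : c0 / M * B <= eps / 2).
  { apply Rmult_le_reg_r with M; [lra|].
    replace (c0 / M * B * M) with (c0 * B) by (field; lra).
    unfold M. replace (eps / 2 * (1 + 2 * c0 * B / eps)) with (eps / 2 + c0 * B) by (field; lra).
    lra. }
  (* One bound serves both diameters: [6 n rho] for tripled cubes and [2 n M r^2] for net cubes,
     where [r^2 <= rho] because [rho <= 1]. *)
  set (rho := Rmin 1 (delta / (8 * INR n * M))).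
  assert (HnM : 0 < 8 * INR n * M) by (apply Rmult_lt_0_compat; lra).
  assert (Hrho0 : 0 < rho).
  { apply Rmin_pos; [lra|]. now apply Rdiv_lt_0_compat. }
  assert (Hrho1 : rho <= 1) by apply Rmin_l.
  assert (Hrho2 : rho * (8 * INR n * M) <= delta).
  { apply Rle_trans with (delta / (8 * INR n * M) * (8 * INR n * M)).
    - apply Rmult_le_compat_r; [lra|apply Rmin_r].
    - apply Req_le. field. split; lra. }
  clearbody rho.
  set (V := fun i : pt * pt * R => let '(x, p, r) := i in
    B1 n x /\ subgradient n v x p /\ (forall k, (k < n)%nat -> Rabs (p k) <= R0) /\
    0 < r <= rho /\
    (exists a, contains_cube n (cap0 n v x p (r ^ 2)) a (M * r ^ 2)) /\
    leb_measure_lt n (cap0 n v x p (r ^ 2)) (C * r ^ (n + 1))).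
  apply hcov_mono with (E := controlled n v C R0) (c := c0 / M * B + eps / 2); [auto|lra|].
  apply (vitali_cover n (n - 1) (pt * pt * R) V (fun i => fst (fst i)) snd
    (fun i => cap n v (fst (fst i)) (snd (fst i)) (snd i ^ 2))
    (controlled n v C R0) delta rho B (c0 / M) (eps / 2)); auto.
  - assert (rho * INR n <= rho * (INR n * M)) by (apply Rmult_le_compat_l; nra). nra.
  - apply Rmult_le_pos; [lra|]. left. apply Rinv_0_lt_compat. lra.
  - lra.
  - intros [[x p] r] Vi. apply Vi.
  - intros [[x p] r] y k [V1 [V2 [_ [[V4 _] _]]]] Hy Hk. cbn [fst snd] in *.
    now apply (cap_bounded n v x p r).
  - intros N f Vf Df.
    apply (disjoint_caps_sum n v C M R0 Hn Hv ltac:(lra) HM HR N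
      (fun i => fst (fst (f i))) (fun i => snd (fst (f i))) (fun i => snd (f i))); auto.
    intros i Hi. specialize (Vf i Hi). destruct (f i) as [[x p] r]. cbn [fst snd].
    destruct Vf as [V1 [V2 [V3 [[V4 _] V5]]]].
    split; [auto|]. split; [auto|]. split; [auto|]. split; auto.
  - intros [[x p] r] [V1 [V2 [V3 [V4 [V5 V6]]]]]. cbn [fst snd].
    replace (c0 / M) with (3 * (3 * INR n) ^ (n - 1) * 8 ^ n * C / (2 * M))
      by (unfold c0; field; lra).
    apply cap_hcov; auto; try lra.
    assert (r ^ 2 <= rho) by nra.
    assert (INR n * M * r ^ 2 <= INR n * M * rho) by (apply Rmult_le_compat_l; nra).
    nra.
  - intros x L [Hx [p [Hp [Hb [h0 [Hh0 Hm]]]]]] HL.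
    destruct (cap0_contains_cube n v x p M Hn Hv Hp ltac:(lra)) as [h1 [Hh1 Hc]].
    assert (Hp' : subgradient n v x p) by apply Hp.
    assert (HrL : exists r0, 0 < r0 /\ forall r, 0 < r <= r0 -> forall j, In j L ->
      disjoint (cap n v x p (r ^ 2)) (cap n v (fst (fst j)) (snd (fst j)) (snd j ^ 2))).
    { clear - HL Hx Hp'. induction L as [|j L IH].
      - exists 1. split; [lra|easy].
      - destruct IH as [r1 [R1 R1']]; [intros; apply HL; now right|].
        destruct (HL j (or_introl eq_refl)) as [_ Hj].
        destruct (cap_avoid n v x p _ _ _ Hp' Hx Hj) as [r2 [R2 R2']].
        exists (Rmin r1 r2). split; [now apply Rmin_pos|].
        intros r [Hr1 Hr2] j' [<-|Hj'].
        + apply R2'. generalize (Rmin_r r1 r2). lra.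
        + apply R1'; auto. generalize (Rmin_l r1 r2). lra. }
    destruct HrL as [r0 [Hr0 HrL]].
    (* All thresholds are imposed on [r] rather than on the height: [r <= 1] gives [r^2 <= r], and
       [h0 / 2] makes the last inequality strict. *)
    set (r := Rmin (Rmin rho r0) (Rmin h1 (h0 / 2))).
    assert (Hr : 0 < r) by (repeat apply Rmin_pos; lra).
    assert (Hr1 : r <= rho) by (eapply Rle_trans; apply Rmin_l).
    assert (Hr2 : r <= r0) by (eapply Rle_trans; [apply Rmin_l|apply Rmin_r]).
    assert (Hr3 : r <= h1) by (eapply Rle_trans; [apply Rmin_r|apply Rmin_l]).
    assert (Hr4 : r <= h0 / 2) by (eapply Rle_trans; [apply Rmin_r|apply Rmin_r]).
    assert (Hrr : 0 < r ^ 2 <= r) by nra.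
    exists (x, p, r). split; [|split; [reflexivity|]].
    + split; [auto|]. split; [auto|]. split; [auto|]. split; [lra|]. split.
      * apply Hc. lra.
      * apply cap0_measure; auto. apply Hm. lra.
    + intros j Hj. apply HrL; [split; assumption|exact Hj].
Qed.

Lemma leb_measure_lt_mono n S c c' : c <= c' -> leb_measure_lt n S c -> leb_measure_lt n S c'.
Proof.
  intros Hc [a [b [l [H1 [H2 [H3 H4]]]]]]. exists a, b, l. repeat split; auto. lra.
Qed.

(** The measure hypothesis is applied to one extreme slope at [x]; a single integer then dominates
    both its constant and its coordinates. *)
Lemma Sigma_controlled n v x :
  convex_on_B1 n v -> Sigma n v x -> exists m, controlled n v (INR (S m)) (INR (S m)) x.
Proof.
  intros Hv [Hx HS]. destruct (extreme_subgradient_exists n v x Hv Hx) as [p Hp].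
  destruct (HS p (proj1 Hp)) as [C [h0 [HC [Hh0 Hm]]]].
  set (T := sumR n (fun k => Rabs (p k))).
  assert (HT : 0 <= T) by (apply sumR_nonneg; intros; apply Rabs_pos).
  destruct (INR_unbounded (C + T)) as [m Hm'].
  exists m. rewrite S_INR. split; [auto|]. exists p. split; [auto|]. split.
  - intros k Hk. apply Rle_trans with T; [|lra].
    apply (sumR_term_le n k (fun k => Rabs (p k))); auto. intros; apply Rabs_pos.
  - exists h0. split; auto. intros h Hh. eapply leb_measure_lt_mono; [|now apply Hm].
    apply Rmult_le_compat_r; [left; apply exp_pos|lra].
Qed.

(* In dimension 0 every box has volume 1, so no countable family of boxes has finite total
   volume and no section has finite measure. *)
Lemma Sigma_dim0 v x : ~ Sigma 0 v x.
Proof.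
  intros [[_ Hx] HS]. destruct (HS zero) as [C [h0 [HC [Hh0 H]]]].
  - split; [now intros|]. intros y [_ Hy]. replace y with x.
    + unfold dot. simpl. lra.
    + apply functional_extensionality. intros i. rewrite Hx, Hy; auto; lia.
  - destruct (H (h0 / 2) ltac:(lra)) as [a [b [l [_ [Hs _]]]]]. simpl in Hs.
    destruct (INR_unbounded l) as [N HN].
    assert (E := infinite_sum_sumR_le (fun _ => 1) l N ltac:(intros; lra) Hs).
    rewrite sumR_const in E. lra.
Qed.

Theorem theorem3p1 (n : nat) (v : pt -> R) :
  convex_on_B1 n v -> hausdorff_null n (n - 1) (Sigma n v).
Proof.
  intros Hv. apply hausdorff_null_of_hcov. intros delta eps Hd He.
  destruct n as [|n].
  - apply hcov_mono with (E := Sigma 0 v) (c := 0); [auto|lra|].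
    apply hcov_empty; auto. apply Sigma_dim0.
  (* The class of index [m] receives the share [eps / 2^(m+1)]. *)
  - apply (hcov_countable (S n) (S n - 1) delta (Sigma (S n) v)
      (fun m => controlled (S n) v (INR (S m)) (INR (S m))) (fun m => eps * (/ 2) ^ (S m)) eps).
    + intros m. apply controlled_hcov; auto; try lia.
      * apply lt_0_INR. lia.
      * apply pos_INR.
      * apply Rmult_lt_0_compat; auto. apply pow_lt. lra.
    + intros N. rewrite sumR_scal. assert (E := sumR_half_pow_le1 N). nra.
    + intros x Hx. now apply Sigma_controlled.
Qed.
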